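(* Let $f\in C^2(\mathbb{R}^n\times\mathbb{R};\mathbb{R}^n)$ with $f(0,0)=0$, let $\hat D>0$ and $t_0\in\mathbb{R}$, and suppose Assumptions 1 and 2 (written out in the context) hold; let $r^*>0$ and $\kappa$ be as in Assumption 2. Consider the closed-loop system consisting of the plant $$\dot X(t)=f\big(X(t),U(t-\hat D-\delta(t,X(t)))\big),$$ the control law $$U(t)=\kappa\big(t+\hat D,\hat P(t)\big),\qquad \hat P(\theta)=X(t)+\int_{t-\hat D}^{\theta}f\big(\hat P(s),U(s)\big)\,ds,\quad t-\hat D\le\theta\le t,$$ and the observer $\hat D\hat u_t(x,t)=\hat u_x(x,t)$, $x\in[0,1]$, $\hat u(1,t)=U(t)$ (that is, $\hat u(x,t)=U(t+\hat D(x-1))$). Then there exist positive constants $c_1$, $c^{**}$, class $\mathcal{K}_\infty$ functions $\hat\mu$, $\alpha^*$, a class $\mathcal{KC}_\infty$ function $\zeta$, a class $\mathcal{KL}$ function $\beta$, and a constant $c$ with $0<c<1$, such that if the perturbation $\delta$ satisfies $$|\delta(t,\xi)|+|\delta_t(t,\xi)|+|\nabla\delta(t,\xi)|\le c_1+\hat\mu(|\xi|)\qquad\text{for all }(t,\xi)\in[t_0,\infty)\times\mathbb{R}^n,$$ then for all initial conditions which satisfy $\Pi(t_0)<c^{**}$, where $$\Pi(t)=|X(t)|+\int_{t-\hat D}^{t}\alpha^*(|U(\theta)|)\,d\theta+\int_{t-\hat D}^{t}\ddot U(\theta)^2\,d\theta+\int_{t-\hat D-\max\{0,\delta(t,X(t))\}}^{t}\dot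 U(\theta)^2\,d\theta,$$ it holds that $$\Pi(t)\le\beta\Big(\zeta\big(\Pi(t_0),\min\{r^*,c,\hat D\}\big),\,t-t_0\Big)\qquad\text{for all }t\ge t_0 .$$
   Context: $X(t)\in\mathbb{R}^n$, $U(t)\in\mathbb{R}$; $|\cdot|$ is the Euclidean norm. The perturbation $\delta:[t_0,\infty)\times\mathbb{R}^n\to\mathbb{R}$ is continuously differentiable; $\delta_t$ is its partial derivative in $t$ and $\nabla\delta$ its gradient in the state argument. Initial conditions are $X(t_0)$ together with the past values of $U$ on an interval ending at $t_0$ long enough for the delayed input and for $\Pi(t_0)$ to be defined; solutions are those along which the quantities in $\Pi$ are defined. Classes $\mathcal{K}$, $\mathcal{K}_\infty$, $\mathcal{KL}$ are the usual comparison-function classes. A function $\zeta:\mathbb{R}_+\times(0,1)\to\mathbb{R}_+$ is of class $\mathcal{KC}$ if it is of class $\mathcal{K}$ in its first argument for each value of the second and continuous in the second; it is of class $\mathcal{KC}_\infty$ if it is in $\mathcal{KC}$ and in $\mathcal{K}_\infty$ with respect to its first argument. Assumption 1 (strong forward completeness): there exist a smooth positive definite function $R_0:\mathbb{R}^n\to\mathbb{R}$ and class $\mathcal{K}_\infty$ functions $\alpha_1,\alpha_2,\alpha_3$ such that for all $X\in\mathbb{R}^n$, $\omega\in\mathbb{R}$: $\alpha_1(|X|)\le R_0(X)\le\alpha_2(|X|)$ and $\frac{\partial R_0(X)}{\partial X}f(X,\omega)\le R_0(X)+\alpha_3(|\omega|)$. Assumption 2: there exist positive constants $\mu,r^*,b,\lambda^*$,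 a class $\mathcal{K}_\infty$ function $\hat\alpha$, and $\kappa\in C^3([t_0,\infty)\times\mathbb{R}^n;\mathbb{R})$ such that for all $t\ge t_0$ and all $\xi$, $\left|\frac{\partial^{i+j}\kappa(t,\xi)}{\partial t^i\partial\xi^j}\right|\le\hat\alpha(|\xi|)$ for $0\le i\le3$, $j=0$, and $\left|\frac{\partial^{i+j}\kappa(t,\xi)}{\partial t^i\partial\xi^j}\right|\le\mu+\hat\alpha(|\xi|)$ for $0\le i\le3$, $j=1,\dots,3-i$; and for the delay-free system $\dot X(t)=f(X(t),\kappa(t,X(t)))$ and all $X(t_0)$ with $|X(t_0)|\le r^*$, one has $|X(t)|\le b|X(t_0)|e^{-\lambda^*(t-t_0)}$ for all $t\ge t_0$.
   Formalization: In Assumption 2 the exponential estimate for the delay-free system is required from every initial time s ≥ t0, with b, λ* and r* independent of s, not only from the single time t0; with t0 alone the claim fails (Perron-type example with arbitrarily small constant δ). *)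

(* Defs.v *)
From HB Require Import structures.
From mathcomp Require Import all_boot all_order all_algebra.
From mathcomp Require Import all_classical all_reals all_analysis.

Set Implicit Arguments.
Unset Strict Implicit.
Unset Printing Implicit Defensive.

Import Order.TTheory GRing.Theory Num.Theory.
Import numFieldNormedType.Exports.

Local Open Scope classical_set_scope.
Local Open Scope ring_scope.

(* The library norm on ['cV[R]_n] is the sup norm; this is the Euclidean one. *)
Definition enorm (R : realType) (n : nat) (x : 'cV[R]_n) : R :=
  Num.sqrt (\sum_(i < n) x i 0 ^+ 2).

(* Comparison functions are total functions on [R] of which only the values at
   nonnegative arguments matter. *)
Definition classK (R : realType) (a : R -> R) : Prop :=
  [/\ a 0 = 0,
      {within `[0, +oo[, continuous a} &
      forall x y, 0 <= x -> x < y -> a x < a y].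

Definition classKinf (R : realType) (a : R -> R) : Prop :=
  classK a /\ a x @[x --> +oo] --> +oo.

Definition classKL (R : realType) (b : R -> R -> R) : Prop :=
  [/\ {within [set p : R * R | 0 <= p.1 /\ 0 <= p.2],
         continuous (fun p : R * R => b p.1 p.2)},
      forall s, 0 <= s -> classK (fun r => b r s),
      forall r s s', 0 <= r -> 0 <= s -> s <= s' -> b r s' <= b r s &
      forall r, 0 <= r -> b r s @[s --> +oo] --> 0].

Definition classKC (R : realType) (z : R -> R -> R) : Prop :=
  (forall c, 0 < c < 1 -> classK (fun r => z r c)) /\
  (forall r, 0 <= r -> {within `]0, 1[, continuous (z r)}).

Definition classKCinf (R : realType) (z : R -> R -> R) : Prop :=
  classKC z /\ (forall c, 0 < c < 1 -> classKinf (fun r => z r c)).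

Section Derivatives.
Variables (R : realType) (V W : normedModType R).
Implicit Types (D : set V) (v x : V) (g : V -> W) (k : nat).

(* Difference quotient along [v] as [h] tends to 0 with [x + h v] in [D]: this
   is one-sided where [v] is transverse to the boundary of a half-space [D]. *)
Definition dquot_within D v g x : set_system W :=
  (h^-1 *: (g (h *: v + x) - g x))
    @[h --> within [set h : R | D (h *: v + x)] (0 : R)^'].

Definition derivable_within D v g x : Prop := cvg (dquot_within D v g x).

Definition derive_within D v g x : W := lim (dquot_within D v g x).

(* Class C^k on [D], with derivatives up to the boundary of [D]. *)
Fixpoint Ck D k g : Prop :=
  {within D, continuous g} /\
  match k with
  | 0%N => True
  | k'.+1 => forall v, (forall x, D x -> derivable_within D v g x) /\
                       Ck D k' (derive_within D v g)
  end.

Lemma derive_withinT v g x : derive_within setT v g x = 'D_v g x.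
Proof.
rewrite /derive_within /dquot_within /derive.
suff -> : within [set h : R | setT (h *: v + x)] (0 : R)^' = (0 : R)^' by [].
by apply/seteqP; split=> A /=; rewrite /within /=; apply: filterS => h // /(_ I).
Qed.

End Derivatives.

Section TimeVarying.
Variables (R : realType) (n : nat).

Definition from_time (t0 : R) : set (R * 'cV[R]_n) := [set p | t0 <= p.1].

Definition dir_t : R * 'cV[R]_n := (1, 0).
Definition dir_x (i : 'I_n) : R * 'cV[R]_n := (0, delta_mx i 0).

(* Euclidean norm of the array of all partial derivatives of [g] of order [i]
   in time and [j] in the state; [j = 1] is the norm of the gradient. *)
Definition dnorm (t0 : R) (i j : nat) (g : R * 'cV[R]_n -> R)
    (p : R * 'cV[R]_n) : R :=
  Num.sqrt (\sum_(J : j.-tuple 'I_n)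
    (foldr (derive_within (from_time t0)) g
       (nseq i dir_t ++ map dir_x J) p) ^+ 2).

Definition strong_forward_complete (f : 'cV[R]_n * R -> 'cV[R]_n) : Prop :=
  exists (R0 : 'cV[R]_n -> R) (a1 a2 a3 : R -> R),
    [/\ forall k, Ck setT k R0,
        R0 0 = 0 /\ (forall x, x != 0 -> 0 < R0 x),
        [/\ classKinf a1, classKinf a2 & classKinf a3],
        forall x, a1 (enorm x) <= R0 x <= a2 (enorm x) &
        forall x w, \sum_(i < n) 'D_(delta_mx i 0) R0 x * f (x, w) i 0
                      <= R0 x + a3 `|w|].

Definition delay_free_solution (f : 'cV[R]_n * R -> 'cV[R]_n)
    (kappa : R * 'cV[R]_n -> R) (s : R) (X : R -> 'cV[R]_n) : Prop :=
  {within `[s, +oo[, continuous X} /\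
  (forall t, s < t -> is_derive t 1 X (f (X t, kappa (t, X t)))).

(* The exponential estimate of the time-varying delay-free system is, as usual
   for nonautonomous systems, uniform in the initial time [s >= t0]; an estimate
   from the single initial time [t0] would not survive small perturbations.
   Solutions are unique when [f] and [kappa] are C^1, so that asserting the estimate
   for the solution that exists asserts it for every solution. *)
Definition feedback_assumption (f : 'cV[R]_n * R -> 'cV[R]_n) (t0 : R)
    (kappa : R * 'cV[R]_n -> R) (rstar : R) : Prop :=
  [/\ 0 < rstar,
      Ck (from_time t0) 3 kappa &
      exists (mu b lambda : R) (ahat : R -> R),
        [/\ [/\ 0 < mu, 0 < b & 0 < lambda],
            classKinf ahat,
            forall i t xi, (i <= 3)%N -> t0 <= t ->
              dnorm t0 i 0 kappa (t, xi) <= ahat (enorm xi),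
            forall i j t xi, (i <= 3)%N -> (1 <= j <= 3 - i)%N -> t0 <= t ->
              dnorm t0 i j kappa (t, xi) <= mu + ahat (enorm xi) &
            forall s x0, t0 <= s -> enorm x0 <= rstar ->
              exists X, [/\ delay_free_solution f kappa s X, X s = x0 &
                forall t, s <= t ->
                  enorm (X t) <= b * enorm x0 * expR (- lambda * (t - s))]]].

Definition perturbation_bound (t0 : R) (delta : R * 'cV[R]_n -> R) (c1 : R)
    (muhat : R -> R) : Prop :=
  forall t xi, t0 <= t ->
    `|delta (t, xi)|
    + `|derive_within (from_time t0) dir_t delta (t, xi)|
    + dnorm t0 0 1 delta (t, xi) <= c1 + muhat (enorm xi).

End TimeVarying.

Section ClosedLoop.
Variables (R : realType) (n : nat).
Local Notation leb := (@lebesgue_measure R).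

(* [g] is locally absolutely continuous on [I] and its derivative (which then
   exists almost everywhere) is square integrable on [I]. *)
Definition H1_on (I : interval R) (g : R -> R) : Prop :=
  [/\ measurable_fun [set` I] (g^`())%classic,
      leb.-integrable [set` I] (fun s => ((g^`())%classic s ^+ 2)%:E) &
      forall x y, x \in I -> y \in I -> x <= y ->
        g y - g x = \int[leb]_(s in `[x, y]) (g^`())%classic s].

Definition delay_reach (Dhat : R) (delta : R * 'cV[R]_n -> R)
    (X : R -> 'cV[R]_n) (t : R) : R :=
  t - Dhat - Num.max 0 (delta (t, X t)).

Definition Pi (Dhat : R) (delta : R * 'cV[R]_n -> R) (astar : R -> R)
    (X : R -> 'cV[R]_n) (U : R -> R) (t : R) : R :=
  enorm (X t)
  + \int[leb]_(s in `[t - Dhat, t]) astar `|U s|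
  + \int[leb]_(s in `[t - Dhat, t]) ((U^`(2))%classic s ^+ 2)
  + \int[leb]_(s in `[delay_reach Dhat delta X t, t]) ((U^`())%classic s ^+ 2).

(* [P t theta] is the predictor at [theta] computed at time [t]: it starts from
   [X t], so the predictor trajectory changes with [t].
   The open interval in [cl_U2] avoids the two-sided derivative of [U] at the
   end of its history, where [U] need not be differentiable. *)
Record closed_loop (f : 'cV[R]_n * R -> 'cV[R]_n) (Dhat t0 : R)
    (kappa delta : R * 'cV[R]_n -> R) (T : \bar R)
    (X : R -> 'cV[R]_n) (U : R -> R) (P : R -> R -> 'cV[R]_n)
    (u : R -> R -> R) : Prop := ClosedLoop {
  cl_X : {within [set t | t0 <= t /\ (t%:E < T)%E], continuous X};
  cl_plant : forall t, t0 < t -> (t%:E < T)%E ->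
    is_derive t 1 X (f (X t, U (t - Dhat - delta (t, X t))));
  cl_control : forall t, t0 <= t -> (t%:E < T)%E ->
    U t = kappa (t + Dhat, P t t);
  cl_P : forall t, t0 <= t -> (t%:E < T)%E ->
    {within `[t - Dhat, t], continuous (P t)};
  cl_predictor : forall t theta i, t0 <= t -> (t%:E < T)%E ->
    t - Dhat <= theta <= t ->
    P t theta i 0 =
      X t i 0 + \int[leb]_(s in `[t - Dhat, theta]) f (P t s, U s) i 0;
  cl_observer : forall x t, t0 <= t -> (t%:E < T)%E -> 0 <= x <= 1 ->
    u x t = U (t + Dhat * (x - 1));
  cl_U1 : forall t, t0 <= t -> (t%:E < T)%E ->
    H1_on `[delay_reach Dhat delta X t, t] U;
  cl_U2 : forall t, t0 <= t -> (t%:E < T)%E ->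
    H1_on `]t - Dhat, t[ (U^`())%classic
}.

End ClosedLoop.

(* Main.v *)
(** Near the origin neither a Lyapunov functional nor forward completeness is
    needed.  While state and input stay small, Gronwall's inequality bounds them
    on any bounded time interval by a multiple of their size on one past delay
    window.  The predictor issued at time [t - Dhat] misses the state at time [t]
    only because of the perturbed delay, hence by at most a constant times the
    bound on [delta] times a Lipschitz constant of the input.  So after one delay
    the plant is a small perturbation of the delay-free system; as the latter
    decays exponentially, there is a time [Q] after which the size of a window is
    halved, wherever the window lies.  Iterating, state and input decay
    exponentially in the sup norm, and a bootstrap shows that they stay small.

    Initially the sup norm is only [O(sqrt (Pi t0))], by the Cauchy-Schwarz
    inequality for the derivative of the input; this is why
    [beta r s = M * sqrt r * exp (- l s)].  For the derivatives of the input: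
    its Lipschitz constant is bounded by the size [N] of the window, and its
    second differences with step [h] by [h (h N + w)], where [w] is the
    oscillation with step [h] of the delayed inputs.  Dividing by [h ^ 2] and
    applying Fatou's lemma bounds the integral of the squared second derivative,
    since [w ^ 2] is [h] times an increment of a monotone function, and such
    increments telescope when integrated.  The functions [astar], [muhat] and
    [zeta] can be taken linear. *)

(* A solution is only given on [[t0, T)], where [T] may be finite, so every constant is fixed before
   the trajectory, the horizon [t1] and the perturbation, and estimates are made on compact
   intervals [[t0, t1]]. Two obstacles shape the proof. First, the input is defined implicitly:
   through the predictor, [U t] depends on [U] over all of [[t - D, t]], so state and input do not
   obey an ordinary differential equation. Maxima with an exponential weight of large rate absorb
   this dependence, whatever the size of the delay. Second, the history of the input has only a
   square integrable second derivative, and this roughness is handed on to later inputs by the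
   delayed input and by the starting point of the predictor. Second derivatives thus have no
   pointwise bound. Second differences do, and for these [f] and [kappa] enter only through
   finite-difference inequalities on a small ball. Sizes [N] are kept at most 1, so that squares of
   [N] can be replaced by [N] wherever a linear bound is wanted. *)
Require Import Defs.
From mathcomp Require Import all_boot all_order all_algebra.
From mathcomp Require Import all_classical all_reals all_analysis.
From mathcomp Require Import measurable_realfun.
From mathcomp Require Import ring lra.

Set Implicit Arguments.
Unset Strict Implicit.
Unset Printing Implicit Defensive.

Import Order.TTheory GRing.Theory Num.Theory.
Import numFieldNormedType.Exports.

Local Open Scope classical_set_scope.
Local Open Scope ring_scope.

(* [lra] fails once a variable or hypothesis of a section has been cleared. *)
Ltac keep H := fail.
Ltac lin := repeat match goal with
  | H : ?P |- _ => tryif keep H then fail else lazymatch type of P with Prop => clear H end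
  end; lra.

(** * Functions on intervals *)

Section Within.
Variables (T : topologicalType).
Implicit Types (A : set T).

Lemma within_comp (S W : topologicalType) A (F : T -> S) (h : S -> W) :
  {within A, continuous F} -> continuous h -> {within A, continuous (h \o F)}.
Proof.
move=> /subspace_continuousP Fc hc; apply/subspace_continuousP => x Ax.
by apply: cvg_comp (Fc x Ax) _; exact: hc.
Qed.

Lemma within_pair (S W : topologicalType) A (F : T -> S) (G : T -> W) :
  {within A, continuous F} -> {within A, continuous G} ->
  {within A, continuous (fun x => (F x, G x))}.
Proof.
move=> /subspace_continuousP Fc /subspace_continuousP Gc.
by apply/subspace_continuousP => x Ax; apply: cvg_pair; [exact: Fc|exact: Gc].
Qed.

Lemma within_within (S W : topologicalType) A (B : set S) (F : T -> S) (h : S -> W) :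
  {within A, continuous F} -> (forall x, A x -> B (F x)) ->
  {within B, continuous h} -> {within A, continuous (h \o F)}.
Proof.
move=> /subspace_continuousP Fc AB /subspace_continuousP hc.
apply/subspace_continuousP => x Ax; apply: cvg_comp (hc _ (AB _ Ax)) => P /=.
rewrite /within/= => BP.
have : \forall y \near x, A y -> B (F y) -> P (F y) by exact: Fc _ Ax _ BP.
by apply: filterS => y + Ay; apply=> //; exact: AB.
Qed.

Variables (K : numFieldType) (W : normedModType K).

Lemma withinB A (F G : T -> W) :
  {within A, continuous F} -> {within A, continuous G} ->
  {within A, continuous (fun x => F x - G x)}.
Proof.
move=> /subspace_continuousP Fc /subspace_continuousP Gc.
by apply/subspace_continuousP => x Ax; apply: cvgB; [exact: Fc|exact: Gc].
Qed.

Lemma withinD A (F G : T -> W) :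
  {within A, continuous F} -> {within A, continuous G} ->
  {within A, continuous (fun x => F x + G x)}.
Proof.
move=> /subspace_continuousP Fc /subspace_continuousP Gc.
by apply/subspace_continuousP => x Ax; apply: cvgD; [exact: Fc|exact: Gc].
Qed.

Lemma within_cst A (S : topologicalType) (c : S) : {within A, continuous (fun=> c)}.
Proof. by apply/continuous_subspaceT => x; exact: cst_continuous. Qed.

Lemma within_norm A (F : T -> W) :
  {within A, continuous F} -> {within A, continuous (fun t => `|F t|)}.
Proof. by move=> Fc; exact: (within_comp Fc (@norm_continuous _ _)). Qed.

End Within.

Section Scalar.
Variable R : realType.
Implicit Types (a b : R).

Lemma withinM (T : topologicalType) (A : set T) (F G : T -> R) :
  {within A, continuous F} -> {within A, continuous G} ->
  {within A, continuous (fun x => F x * G x)}.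
Proof.
move=> /subspace_continuousP Fc /subspace_continuousP Gc.
by apply/subspace_continuousP => x Ax; apply: cvgM; [exact: Fc|exact: Gc].
Qed.

Lemma within_max (T : topologicalType) (A : set T) (F G : T -> R) :
  {within A, continuous F} -> {within A, continuous G} ->
  {within A, continuous (fun x => Num.max (F x) (G x))}.
Proof.
move=> Fc Gc; have -> : (fun x => Num.max (F x) (G x)) =
    (fun x => (F x + G x + `|F x - G x|) * 2^-1).
  by apply/funext => x; rewrite maxr_absE.
apply: withinM; last exact: within_cst.
by apply: withinD; [exact: withinD|apply: within_norm; exact: withinB].
Qed.

Lemma within_itvS (S : topologicalType) (F : R -> S) a b c d : a <= c -> d <= b ->
  {within `[a, b], continuous F} -> {within `[c, d], continuous F}.
Proof.
move=> ac db; apply: continuous_subspaceW => x /=; rewrite !in_itv/= => /andP[cx xd].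
by rewrite (le_trans ac cx) (le_trans xd db).
Qed.

Lemma within_shift (S : topologicalType) (F : R -> S) a b h :
  {within `[a + h, b + h], continuous F} -> {within `[a, b], continuous (fun s => F (s + h))}.
Proof.
move=> Fc; apply: (within_within (F := fun s : R => s + h) (h := F) _ _ Fc).
  by apply/continuous_subspaceT => x; apply: cvgD; [exact: cvg_id|exact: cvg_cst].
by move=> x; rewrite /= !in_itv/= !lerD2r.
Qed.

(** The first alternative is there for [a = b], where there is no interior point. *)
Lemma MVT_open (f df : R -> R) a b : a <= b ->
  {within `[a, b], continuous f} ->
  (forall s, a < s < b -> is_derive s 1 f (df s)) ->
  f b - f a = 0 \/ exists2 c, a < c < b & f b - f a = df c * (b - a).
Proof.
rewrite le_eqVlt => /predU1P[->|ab] fc fd; first by left; rewrite subrr.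
have fd' x : x \in `]a, b[ -> is_derive x 1 f (df x) by rewrite in_itv/= => /fd.
right; have [c cab e] := MVT ab fd' fc.
by exists c => //; move: cab; rewrite in_itv.
Qed.

Lemma derive_ge0_le (h dh : R -> R) a b : a <= b ->
  {within `[a, b], continuous h} ->
  (forall s, a < s < b -> is_derive s 1 h (dh s)) ->
  (forall s, a < s < b -> 0 <= dh s) -> h a <= h b.
Proof.
move=> ab hc hd hn; rewrite -subr_ge0.
have [->//|[c cab ->]] := MVT_open ab hc hd.
by rewrite mulr_ge0 ?subr_ge0// hn.
Qed.

(** Both [phi - g] and [phi + g] have a nonnegative derivative. Giving the majorant through its
    primitive [phi] avoids integrating [dphi]. *)
Lemma mvi_scalar (g phi dg dphi : R -> R) a b : a <= b ->
  {within `[a, b], continuous g} -> {within `[a, b], continuous phi} ->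
  (forall s, a < s < b -> is_derive s 1 g (dg s)) ->
  (forall s, a < s < b -> is_derive s 1 phi (dphi s)) ->
  (forall s, a < s < b -> `|dg s| <= dphi s) ->
  `|g b - g a| <= phi b - phi a.
Proof.
move=> ab gc pc gd pd le.
have h1 : (phi - g) a <= (phi - g) b.
  apply: (@derive_ge0_le (phi - g) (fun s => dphi s - dg s)) => // [|s sab|s sab].
  - exact: withinB.
  - by apply: is_deriveB; [exact: pd|exact: gd].
  - by have := le _ sab; rewrite ler_norml => /andP[_]; rewrite subr_ge0.
have h2 : (phi + g) a <= (phi + g) b.
  apply: (@derive_ge0_le (phi + g) (fun s => dphi s + dg s)) => // [|s sab|s sab].
  - exact: withinD.
  - by apply: is_deriveD; [exact: pd|exact: gd].
  - by have := le _ sab; rewrite ler_norml => /andP[+ _]; lra.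
move: h1 h2; rewrite !fctE/= ler_norml => h1 h2.
by apply/andP; split; lra.
Qed.

Lemma abs_lip (U : R -> R) (lo hi Lam : R) :
  (forall x y, lo <= x -> x <= y -> y <= hi -> `|U y - U x| <= Lam * (y - x)) ->
  forall x y, lo <= x <= hi -> lo <= y <= hi -> `|U y - U x| <= Lam * `|y - x|.
Proof.
move=> H x y /andP[lx xh] /andP[ly yh]; have [xy|/ltW yx] := leP x y.
  by rewrite [X in _ * X]ger0_norm ?subr_ge0// H.
by rewrite distrC [X in _ * X]distrC [X in _ * X]ger0_norm ?subr_ge0// H.
Qed.

(** Continuity argument: at the infimum of the times where [rho <= g] the step yields a strict
    inequality, which continuity extends beyond that infimum. At [t = a] the premise of the step is
    vacuous, so the step includes the initial condition. *)
Lemma bootstrap (g : R -> R) a b rho :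
  {within `[a, b], continuous g} ->
  (forall t, a <= t <= b -> (forall s, a <= s < t -> g s <= rho) -> g t < rho) ->
  forall t, a <= t <= b -> g t < rho.
Proof.
move=> gc step t /andP[at_ tb]; rewrite ltNge; apply/negP => gt.
pose S := [set s | a <= s <= t /\ rho <= g s].
have S0 : S !=set0 by exists t; split=> //; rewrite at_ lexx.
have lS : has_lbound S by exists a => s [/andP[]].
have hi : has_inf S by split.
have sup_a : a <= inf S by apply: lb_le_inf => // s [/andP[]].
have inft : inf S <= t by apply: ge_inf => //; split=> //; rewrite at_ lexx.
have infab : a <= inf S <= b by rewrite sup_a (le_trans inft).
have below s : a <= s < inf S -> g s <= rho.
  move=> /andP[as_ si]; rewrite leNgt; apply/negP => gs.
  have : inf S <= s.
    apply: ge_inf => //; split; last exact: ltW.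
    by rewrite as_ (le_trans (ltW si)).
  by rewrite leNgt si.
have lt := step _ infab below.
have : \forall x \near within `[a, b] (nbhs (inf S)), g x < rho.
  have /subspace_continuousP := gc.
  have e0 : 0 < rho - g (inf S) by rewrite subr_gt0.
  move=> /(_ (inf S)); rewrite /= in_itv/= infab => /(_ isT).
  move=> /cvgrPdist_lt /(_ _ e0); apply: filterS => x; rewrite /from_subspace.
  by rewrite ltr_norml => /andP[+ _]; lra.
rewrite near_withinE => /nbhs_ballP[e /= e0 He].
have [s [/andP[as_ st] gs] se] := inf_adherent e0 hi.
have infs : inf S <= s by apply: ge_inf => //; split=> //; rewrite as_.
have : g s < rho.
  apply: He; last by rewrite /= in_itv/= as_ (le_trans st).
  by rewrite /ball/= ltr_norml; apply/andP; split; lra.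
by rewrite ltNge gs.
Qed.

Lemma within_expR a (A : set R) (K c : R) :
  {within A, continuous (fun s => c * expR (K * (s - a)))}.
Proof.
apply/continuous_subspaceT => s; apply: cvgMr; apply: continuous_comp; last exact: continuous_expR.
by apply: cvgMr; apply: cvgB; [exact: cvg_id|exact: cvg_cst].
Qed.

Lemma is_derive_lin a (c s : R) : is_derive s 1 (fun s : R => c * (s - a)) c.
Proof.
have := is_deriveM (is_derive_cst c s 1) (is_deriveB (is_derive_id s 1) (is_derive_cst a s 1)).
by move=> h; apply: is_derive_eq h _; rewrite /cst subr0 scaler0 addr0 [LHS]mulr1.
Qed.

Lemma is_derive_expM a (K c s : R) :
  is_derive s 1 (fun s => c * expR (K * (s - a))) (c * K * expR (K * (s - a))).
Proof.
have d1 : is_derive s 1 (fun s : R => K * (s - a)) K.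
  exact: is_derive_lin.
have d2 := @is_derive1_comp R expR _ s _ _ (is_derive_expR _) d1.
have := is_deriveM (is_derive_cst c s 1) d2.
by rewrite /= scaler0 addr0 => h; apply: is_derive_eq h _; rewrite /GRing.scale/=; ring.
Qed.

Lemma within_lin a (A : set R) (c : R) : {within A, continuous (fun s => c * (s - a))}.
Proof.
by apply/continuous_subspaceT => s; apply: cvgMr; apply: cvgB; [exact: cvg_id|exact: cvg_cst].
Qed.

End Scalar.

(** * Mean value and Gronwall inequalities for vector functions *)

Section Vector.
Variables (R : realType) (n : nat).
Local Notation V := 'cV[R]_n.

Lemma coord_le_norm (x : V) i : `|x i 0| <= `|x|.
Proof.
rewrite [leRHS]/Num.Def.normr/= mx_normrE.
exact: (le_bigmax _ (fun ij => `|x ij.1 ij.2|) (i, 0)).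
Qed.

Lemma norm_le_coord (x : V) (c : R) :
  0 <= c -> (forall i, `|x i 0| <= c) -> `|x| <= c.
Proof.
move=> c0 H; rewrite [leLHS]/Num.Def.normr/= mx_normrE (bigmax_le _ c0)//= => -[i j] _.
by rewrite (ord1 j).
Qed.

Lemma is_derive_coord (W : normedModType R) (F : W -> V) x v d i :
  is_derive x v F d -> is_derive x v (fun y => F y i 0) (d i 0).
Proof.
move=> [Fd <-]; have Fi := (derivable_mxP F x v).1 Fd i 0.
by apply: DeriveDef => //; rewrite derive_mx// mxE.
Qed.

Lemma is_derive_mx (W : normedModType R) (F : W -> V) x v (d : V) :
  (forall i, is_derive x v (fun y => F y i 0) (d i 0)) -> is_derive x v F d.
Proof.
move=> H; have Fd : derivable F x v.
  by apply/derivable_mxP => i j; rewrite (ord1 j); case: (H i).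
apply: DeriveDef => //; rewrite derive_mx//; apply/matrixP => i j.
by rewrite mxE (ord1 j); case: (H i).
Qed.

Lemma within_coord (A : set R) (F : R -> V) i :
  {within A, continuous F} -> {within A, continuous (fun t => F t i 0)}.
Proof. by move=> Fc; exact: (within_comp Fc (@coord_continuous _ _ _ i 0)). Qed.

Lemma mvi (g : R -> V) (phi : R -> R) (dg : R -> V) (dphi : R -> R) (a b : R) : a <= b ->
  {within `[a, b], continuous g} -> {within `[a, b], continuous phi} ->
  (forall s, a < s < b -> is_derive s 1 g (dg s)) ->
  (forall s, a < s < b -> is_derive s 1 phi (dphi s)) ->
  (forall s, a < s < b -> `|dg s| <= dphi s) ->
  `|g b - g a| <= phi b - phi a.
Proof.
move=> ab gc pc gd pd le; apply: norm_le_coord => [|i].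
  rewrite subr_ge0; apply: (derive_ge0_le ab pc pd) => s /le; exact: le_trans.
rewrite !mxE; apply: (mvi_scalar ab (within_coord gc) pc _ pd).
  by move=> s sab; apply: is_derive_coord; exact: gd.
by move=> s sab; apply: le_trans (le _ sab); exact: coord_le_norm.
Qed.

Lemma mvi_lin (g dg : R -> V) (c a b : R) : a <= b ->
  {within `[a, b], continuous g} ->
  (forall s, a < s < b -> is_derive s 1 g (dg s)) ->
  (forall s, a < s < b -> `|dg s| <= c) ->
  `|g b - g a| <= c * (b - a).
Proof.
move=> ab gc gd le.
have -> : c * (b - a) = c * (b - a) - c * (a - a) by rewrite subrr mulr0 subr0.
apply: (mvi ab gc (@within_lin R a _ c) gd (fun s _ => is_derive_lin a c s) le).
Qed.

(** The norm of [y] need not be differentiable, so nothing is differentiated but [y]: the maximum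
    [m] of [|y|] against the weight [expR (- K * (s - a))] gives an exponential bound on [dy], and
    the mean value inequality up to the maximiser bounds [m] by half of itself plus the data. *)
Lemma gronwall (y dy : R -> V) (phi dphi : R -> R) (L a b : R) : 0 < L -> a <= b ->
  {within `[a, b], continuous y} -> {within `[a, b], continuous phi} ->
  (forall s, a < s < b -> is_derive s 1 y (dy s)) ->
  (forall s, a < s < b -> is_derive s 1 phi (dphi s)) ->
  (forall s, a < s < b -> 0 <= dphi s) ->
  (forall s, a < s < b -> `|dy s| <= L * `|y s| + dphi s) ->
  forall t, a <= t <= b ->
    `|y t| <= 2 * expR (2 * L * (b - a)) * (`|y a| + (phi b - phi a)).
Proof.
move=> L0 ab yc pc yd pd p0 le.
(* With this rate [L * m / K] is [m / 2], which is absorbed into the left-hand side; the price is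
   the factor 2 of the conclusion. *)
pose K := 2 * L.
pose w (s : R) : R := `|y s| * (1 * expR (- K * (s - a))).
have wc : {within `[a, b], continuous w}.
  by apply: withinM; [exact: within_norm|exact: within_expR].
have [c /[!in_itv]/= /andP[ac cb] cmax] := EVT_max ab wc.
pose m : R := w c.
have ym s : a <= s <= b -> `|y s| <= m * expR (K * (s - a)).
  move=> sab; have := cmax s; rewrite in_itv/= => /(_ sab).
  rewrite -/m /w mul1r mulNr expRN => h.
  by rewrite -ler_pdivrMr ?expR_gt0//.
have phimono s t : a <= s -> s <= t -> t <= b -> phi s <= phi t.
  move=> as_ st tb.
  have xab x : s < x < t -> a < x < b.
    by move=> /andP[sx xt]; rewrite (le_lt_trans as_ sx) (lt_le_trans xt tb).
  apply: (derive_ge0_le st (within_itvS as_ tb pc)) => x /xab; [exact: pd|exact: p0].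
have m0 : 0 <= m by rewrite /m /w mulr_ge0// mul1r expR_ge0.
pose psi s := L * m / K * expR (K * (s - a)) + phi s.
have yc' : `|y c| <= `|y a| + (L * m / K * (expR (K * (c - a)) - 1)) + (phi c - phi a).
  have H : `|y c - y a| <= psi c - psi a.
    apply: (@mvi y psi dy (fun s => L * m / K * K * expR (K * (s - a)) + dphi s) a c ac).
    - exact: within_itvS yc.
    - apply: withinD; first exact: within_expR.
      exact: within_itvS pc.
    - by move=> s /andP[as_ sc]; apply: yd; rewrite as_ (lt_le_trans sc).
    - move=> s /andP[as_ sc]; apply: is_deriveD; first exact: is_derive_expM.
      by apply: pd; rewrite as_ (lt_le_trans sc).
    - move=> s /andP[as_ sc].
      have sab : a < s < b by rewrite as_ (lt_le_trans sc).
      apply: (le_trans (le _ sab)); rewrite lerD2r.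
      rewrite divfK; last by rewrite mulf_neq0 ?lt0r_neq0.
      by rewrite -mulrA ler_pM2l// ym// !ltW//; case/andP: sab.
  have : `|y c| <= `|y a| + `|y c - y a|.
    by rewrite -{1}(subrK (y a) (y c)) addrC ler_normD.
  move=> /le_trans; apply; rewrite -addrA lerD2l (le_trans H)//.
  by rewrite /psi subrr mulr0 expR0; lra.
have LK : L * m / K = m / 2 by rewrite /K; field; rewrite lt0r_neq0.
have E1 : 1 <= expR (K * (c - a)).
  by rewrite -expR0 ler_expR mulr_ge0 ?subr_ge0// /K mulr_ge0// ltW.
have mc : `|y c| = m * expR (K * (c - a)).
  by rewrite /m /w mul1r mulNr -mulrA -expRD addNr expR0 mulr1.
have pb : phi c <= phi b by exact: phimono.
have m2 : m <= 2 * (`|y a| + (phi b - phi a)).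
  have pc0 : phi a <= phi c by exact: phimono.
  set S := `|y a| + (phi b - phi a).
  have S0 : 0 <= S by rewrite addr_ge0// subr_ge0 (le_trans pc0).
  have : m / 2 * expR (K * (c - a)) <= S.
    move: yc'; rewrite LK mc /S [m / 2 * (_ - 1)]mulrBr mulr1.
    have : 0 <= m / 2 by rewrite divr_ge0.
    by rewrite [m / 2 * expR _]mulrAC; set A := m * expR _; lra.
  have : m / 2 <= m / 2 * expR (K * (c - a)) by rewrite ler_peMr// divr_ge0.
  lra.
move=> t tab; apply: (le_trans (ym _ tab)).
rewrite [leRHS]mulrAC; apply: ler_pM => //.
by rewrite ler_expR ler_pM2l ?mulr_gt0// lerB//; case/andP: tab.
Qed.

End Vector.

Section Vector2.
Variables (R : realType) (n : nat).
Local Notation V := 'cV[R]_n.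

(** The differential inequality is only known in the ball of radius [rho]. As the bound that it
    implies is smaller than [rho], the curve never leaves the ball. *)
Lemma gronwall_local (y dy : R -> V) (phi dphi : R -> R) (L rho a b : R) : 0 < L -> a <= b ->
  {within `[a, b], continuous y} -> {within `[a, b], continuous phi} ->
  (forall s, a < s < b -> is_derive s 1 y (dy s)) ->
  (forall s, a < s < b -> is_derive s 1 phi (dphi s)) ->
  (forall s, a < s < b -> 0 <= dphi s) ->
  (forall s, a < s < b -> `|y s| <= rho -> `|dy s| <= L * `|y s| + dphi s) ->
  2 * expR (2 * L * (b - a)) * (`|y a| + (phi b - phi a)) < rho ->
  forall t, a <= t <= b ->
    `|y t| <= 2 * expR (2 * L * (b - a)) * (`|y a| + (phi b - phi a)).
Proof.
move=> L0 ab yc pc yd pd p0 le small.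
set B := 2 * _ * _ in small *.
have key t : a <= t <= b -> (forall s, a <= s < t -> `|y s| <= rho) -> `|y t| <= B.
  move=> /andP[at_ tb] H.
  have sub s : a < s < t -> a < s < b by move=> /andP[-> /= st]; exact: lt_le_trans tb.
  have pp : phi t <= phi b.
    apply: (derive_ge0_le tb (within_itvS at_ (lexx _) pc)) => s /andP[ts sb].
      by apply: pd; rewrite sb (le_lt_trans at_ ts).
    by apply: p0; rewrite sb (le_lt_trans at_ ts).
  have pp0 : phi a <= phi t.
    apply: (derive_ge0_le at_ (within_itvS (lexx _) tb pc)) => s /sub; [exact: pd|exact: p0].
  have := @gronwall R n y dy phi dphi L a t L0 at_ (within_itvS (lexx _) tb yc)
    (within_itvS (lexx _) tb pc) (fun s h => yd s (sub s h)) (fun s h => pd s (sub s h))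
    (fun s h => p0 s (sub s h)).
  have Hd s : a < s < t -> `|dy s| <= L * `|y s| + dphi s.
    move=> ast; apply: le (sub _ ast) (H _ _).
    by case/andP: ast => as_ ->; rewrite ltW.
  move=> /(_ Hd t); rewrite at_ lexx => /(_ isT) /le_trans; apply.
  apply: ler_pM.
  - by rewrite mulr_ge0 ?expR_ge0.
  - by rewrite addr_ge0 ?subr_ge0.
  - by rewrite ler_pM2l// ler_expR ler_pM2l ?mulr_gt0// lerB.
  - by rewrite lerD2l lerB.
have lt t : a <= t <= b -> `|y t| < rho.
  apply: (bootstrap (within_norm yc)) => s sab H.
  by apply: le_lt_trans small; apply: key.
move=> t tab; apply: key => // s /andP[as_ st]; apply/ltW/lt; rewrite as_ (le_trans (ltW st))//.
by case/andP: tab.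
Qed.

End Vector2.

(** * Local bounds on the data *)

Section Slices.
Variable R : realType.

(** Along an affine slice [j] that stays in [D] for small steps, the relative difference quotient is
    the ordinary one. Only the direction [v] matters, so [j y] may lie on the boundary of [D]. *)
Lemma is_derive_slice (E F W : normedModType R) (D : set E) (v : E) (g : E -> W)
    (j : F -> E) (y w : F) :
  (forall h : R, j (h *: w + y) = h *: v + j y) ->
  (\forall h \near (0 : R), D (h *: v + j y)) ->
  derivable_within D v g (j y) ->
  is_derive y w (g \o j) (derive_within D v g (j y)).
Proof.
move=> jE nD dg.
have qE : dquot_within D v g (j y) =
    ((fun h : R => h^-1 *: ((g \o j \o shift y) (h *: w) - (g \o j) y)) @ (0 : R)^').
  rewrite /dquot_within.
  have -> : within [set h : R | D (h *: v + j y)] (0 : R)^' = (0 : R)^'.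
    apply/seteqP; split=> A /=; rewrite /within /=.
      move=> H; have nD' : \forall h \near (0 : R)^', D (h *: v + j y).
        by apply: cvg_within.
      by apply: filterS2 H nD' => h Hh Dh; exact: Hh.
    by apply: filterS => h Ah _.
  by f_equal; apply/funext => h /=; rewrite jE.
move: dg; rewrite /derivable_within /derive_within qE => dg.
by apply: DeriveDef.
Qed.

Lemma is_derive_translate (E W : normedModType R) (g : E -> W) (x b v : E) d :
  is_derive (x + b) v g d -> is_derive x v (fun y => g (y + b)) d.
Proof.
move=> [gd gE].
have e : (fun h : R => h^-1 *: (((fun y => g (y + b)) \o shift x) (h *: v) - g (x + b)))
       = (fun h : R => h^-1 *: ((g \o shift (x + b)) (h *: v) - g (x + b))).
  by apply/funext => h /=; rewrite addrA.
by apply: DeriveDef; [rewrite /derivable e|rewrite /derive e].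
Qed.

End Slices.

(** * Lipschitz bounds from partial derivatives *)

Section CoordLip.
Variables (R : realType) (n : nat).
Local Notation V := 'cV[R]_n.
Local Notation e_ i := (delta_mx i 0 : 'cV[R]_n).

(** The coordinate box spanned by [x] and [y]: a path from [x] to [y] that changes one coordinate at
    a time stays in it, and for the sup norm it stays in any ball around 0 containing [x] and
    [y]. *)
Definition box (x y z : V) : Prop :=
  forall i, Num.min (x i 0) (y i 0) <= z i 0 <= Num.max (x i 0) (y i 0).

Lemma box_norm x y z r : `|x| <= r -> `|y| <= r -> box x y z -> `|z| <= r.
Proof.
move=> xr yr b; apply: norm_le_coord => [|i]; first by apply: le_trans xr.
have /andP[b1 b2] := b i.
have := le_trans (coord_le_norm x i) xr; have := le_trans (coord_le_norm y i) yr.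
rewrite !ler_norml => /andP[y1 y2] /andP[x1 x2]; apply/andP; split.
  by apply: le_trans b1; rewrite le_min x1 y1.
by apply: (le_trans b2); rewrite ge_max x2 y2.
Qed.

Lemma box_shift x y z b : box x y z -> box (x + b) (y + b) (z + b).
Proof. by move=> H i; rewrite !mxE -addr_minl -addr_maxl !lerD2r. Qed.

Lemma coord_step (G : V -> R) (dG : V -> R) i (x : V) (tau M : R) : 0 <= tau ->
  (forall s, 0 <= s <= tau -> is_derive (s *: e_ i + x) (e_ i) G (dG (s *: e_ i + x))) ->
  (forall s, 0 <= s <= tau -> `|dG (s *: e_ i + x)| <= M) ->
  `|G (tau *: e_ i + x) - G x| <= M * tau.
Proof.
move=> t0 Gd Gb.
pose phi s := G (s *: e_ i + x).
have pd s : 0 <= s <= tau -> is_derive s 1 phi (dG (s *: e_ i + x)).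
  move=> /Gd Gds.
  have := @is_derive_slice R V R R setT (e_ i) G (fun s : R => s *: e_ i + x) s 1.
  rewrite derive_withinT derive_val; apply.
  - by move=> h; rewrite scalerDl -scalerA scale1r addrA.
  - by near=> h.
  - rewrite /derivable_within /dquot_within.
    have -> : within [set h : R | [set: V] (h *: e_ i + (s *: e_ i + x))] (0 : R)^' = (0 : R)^'.
      by apply/seteqP; split=> A /=; rewrite /within/=; apply: filterS => h // /(_ Logic.I).
    exact: ex_derive.
have pc : {within `[0, tau], continuous phi}.
  apply: derivable_within_continuous => s; rewrite in_itv/= => /pd [pds _]; exact: pds.
have := @mvi_scalar R phi (fun s => M * (s - 0)) (fun s => dG (s *: e_ i + x)) (fun=> M) 0 tau
  t0 pc (@within_lin R 0 _ M).
rewrite /phi scale0r add0r subrr mulr0 !subr0; apply.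
- by move=> s /andP[s0 st]; apply: pd; rewrite !ltW.
- by move=> s _; exact: is_derive_lin.
- by move=> s /andP[s0 st]; apply: Gb; rewrite !ltW.
Unshelve. all: by end_near. Qed.

(** Only partial derivatives are available, so the coordinates are switched from [x] to [y] one by
    one; each of the [n] switches costs at most [M * |y - x|]. *)
Lemma coord_lip (G : V -> R) (dG : 'I_n -> V -> R) (x y : V) M : 0 <= M ->
  (forall i z, box x y z -> is_derive z (e_ i) G (dG i z)) ->
  (forall i z, box x y z -> `|dG i z| <= M) ->
  `|G y - G x| <= n%:R * M * `|y - x|.
Proof.
move=> M0 Gd Gb.
pose mix k : V := \col_i (if (i < k)%N then y i 0 else x i 0).
have mix0 : mix 0%N = x by apply/colP => i; rewrite mxE ltn0.
have mixn : mix n = y by apply/colP => i; rewrite mxE ltn_ord.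
have step k : (k < n)%N -> `|G (mix k.+1) - G (mix k)| <= M * `|y - x|.
  move=> kn; pose i := Ordinal kn.
  have mS : mix k.+1 = (y i 0 - x i 0) *: e_ i + mix k.
    apply/colP => j; rewrite !mxE; have [->|ji] := eqVneq j i.
      by rewrite eqxx ltnn ltnSn mulr1 subrK.
    rewrite andFb mulr0 add0r ltnS leq_eqVlt.
    have /negbTE -> : (j != k :> nat) by apply: contra ji => /eqP jk; apply/eqP/val_inj.
    by [].
  have tle : `|y i 0 - x i 0| <= `|y - x|.
    by have := coord_le_norm (y - x) i; rewrite !mxE.
  have [le|lt] := leP 0 (y i 0 - x i 0).
    have bx s : 0 <= s <= y i 0 - x i 0 -> box x y (s *: e_ i + mix k).
      move=> /andP[s0 st] j; rewrite !mxE; have [->|ji] := eqVneq j i.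
        rewrite eqxx ltnn mulr1 ge_min le_max; apply/andP; split; apply/orP; [left|right]; lra.
      by rewrite andFb mulr0 add0r; case: ifP => _; rewrite ge_min le_max lexx ?orbT.
    rewrite mS; apply: (le_trans (coord_step le (fun s h => Gd i _ (bx s h)) (fun s h => Gb i _ (bx s h)))).
    by rewrite ler_wpM2l// -[leLHS]ger0_norm.
  (* A decreasing coordinate is run backwards, from [mix k.+1] to [mix k], since [coord_step] only
     moves forwards. *)
  have bx s : 0 <= s <= - (y i 0 - x i 0) -> box x y (s *: e_ i + mix k.+1).
    move=> /andP[s0 st] j; rewrite !mxE; have [->|ji] := eqVneq j i.
      rewrite eqxx ltnSn mulr1 ge_min le_max; apply/andP; split; apply/orP; [right|left]; lra.
    by rewrite andFb mulr0 add0r; case: ifP => _; rewrite ge_min le_max lexx ?orbT.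
  have le' : 0 <= - (y i 0 - x i 0) by lra.
  have := coord_step le' (fun s h => Gd i _ (bx s h)) (fun s h => Gb i _ (bx s h)).
  have <- : mix k = - (y i 0 - x i 0) *: e_ i + mix k.+1 by rewrite mS addrA scaleNr addNr add0r.
  rewrite distrC => /le_trans; apply; rewrite ler_wpM2l//.
  by apply: le_trans tle; rewrite ler0_norm// ltW.
have ind k : (k <= n)%N -> `|G (mix k) - G x| <= k%:R * (M * `|y - x|).
  elim: k => [_|k IH kn]; first by rewrite mix0 subrr normr0 mul0r.
  rewrite -(subrKA (G (mix k))) (le_trans (ler_normD _ _))//.
  by rewrite -natr1 mulrDl mul1r addrC lerD ?step// IH// ltnW.
by have := ind n (leqnn _); rewrite mixn mulrA.
Qed.

Lemma enorm_le (x : V) : enorm x <= n%:R * `|x|.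
Proof.
rewrite /enorm -[leRHS]ger0_norm ?mulr_ge0// -sqrtr_sqr ler_sqrt ?sqr_ge0//.
apply: (@le_trans _ _ (\sum_(i < n) `|x| ^+ 2)).
  apply: ler_sum => i _; rewrite -real_normK ?num_real// lerXn2r ?nnegrE//.
  exact: coord_le_norm.
rewrite sumr_const card_ord -[leLHS]mulr_natl exprMn ler_wpM2r ?sqr_ge0//.
by rewrite [leRHS]expr2 -natrM ler_nat; case: (n) => // k; rewrite leq_pmulr.
Qed.

Lemma coord_le_enorm (x : V) i : `|x i 0| <= enorm x.
Proof.
rewrite /enorm -sqrtr_sqr ler_wsqrtr// (bigD1 i)//= lerDl sumr_ge0// => j _.
exact: sqr_ge0.
Qed.

Lemma norm_le_enorm (x : V) : `|x| <= enorm x.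
Proof. by apply: norm_le_coord => [|i]; [exact: sqrtr_ge0|exact: coord_le_enorm]. Qed.

Lemma enorm0 : enorm (0 : V) = 0.
Proof. by rewrite /enorm big1 ?sqrtr0// => i _; rewrite mxE expr0n. Qed.

Lemma dnorm_ge (t0 : R) i j (g : R * V -> R) p (J : j.-tuple 'I_n) :
  `|foldr (derive_within (from_time t0)) g (nseq i (dir_t R n) ++ map (@dir_x R n) J) p|
    <= dnorm t0 i j g p.
Proof.
rewrite /dnorm -sqrtr_sqr ler_wsqrtr// (bigD1 J)//= lerDl sumr_ge0// => K _.
exact: sqr_ge0.
Qed.

End CoordLip.

(** * Differences in time and state on the half-space of later times *)

Section TimeDomain.
Variables (R : realType) (n : nat) (t0 : R).
Local Notation V := 'cV[R]_n.
Local Notation D := (@from_time R n t0).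
Local Notation dt := (dir_t R n).

(** State directions are tangent to the boundary of the domain, so the initial time is included;
    [is_derive_t] has to move both ways in time and therefore asks for [t0 < t]. *)
Lemma is_derive_x (g : R * V -> R) (t : R) (xi : V) i : t0 <= t ->
  derivable_within D (dir_x R i) g (t, xi) ->
  is_derive xi (delta_mx i 0 : V) (fun z => g (t, z)) (derive_within D (dir_x R i) g (t, xi)).
Proof.
move=> t0t dg; apply: (@is_derive_slice R (R * V)%type V R D (dir_x R i) g (fun z => (t, z)) xi) => //.
  by move=> h; rewrite /dir_x /GRing.scale/= /GRing.add/= /add_pair/= scaler0 add0r.
by near=> h; rewrite /from_time/= scaler0 add0r.
Unshelve. all: by end_near. Qed.

Lemma is_derive_t (g : R * V -> R) (t : R) (xi : V) : t0 < t ->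
  derivable_within D dt g (t, xi) ->
  is_derive t 1 (fun s => g (s, xi)) (derive_within D dt g (t, xi)).
Proof.
move=> t0t dg; apply: (@is_derive_slice R (R * V)%type R R D dt g (fun s => (s, xi)) t 1) => //.
  by move=> h; rewrite /dir_t /GRing.scale/= /GRing.add/= /add_pair/= scaler0 add0r.
rewrite /from_time/=; near=> h.
have : `|h| < t - t0.
  by near: h; apply: (@nbhs0_lt R R); rewrite subr_gt0.
rewrite ltr_norml => /andP[+ _]; rewrite /GRing.scale/= mulr1; lra.
Unshelve. all: by end_near. Qed.

Lemma within_time (g : R * V -> R) xi a b : t0 <= a ->
  {within D, continuous g} -> {within `[a, b], continuous (fun s => g (s, xi))}.
Proof.
move=> t0a gc; apply: (within_within (F := fun s : R => (s, xi)) _ _ gc).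
  by apply: within_pair; [apply/continuous_subspaceT => x; exact: cvg_id|exact: within_cst].
by move=> s; rewrite /= in_itv/= /from_time/= => /andP[as_ _]; exact: le_trans as_.
Qed.

Lemma time_lip (g : R * V -> R) xi K a b : t0 <= a -> a <= b ->
  {within D, continuous g} -> (forall p, D p -> derivable_within D dt g p) ->
  (forall s, a < s < b -> `|derive_within D dt g (s, xi)| <= K) ->
  `|g (b, xi) - g (a, xi)| <= K * (b - a).
Proof.
move=> t0a ab gc gd gb.
have := @mvi_scalar R (fun s => g (s, xi)) (fun s => K * (s - a))
  (fun s => derive_within D dt g (s, xi)) (fun=> K) a b ab (within_time t0a gc)
  (@within_lin R a _ K).
rewrite subrr mulr0 subr0; apply => //.
- move=> s /andP[as_ sb]; have t0s := le_lt_trans t0a as_.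
  by apply: is_derive_t => //; apply: gd; exact: ltW.
- by move=> s _; exact: is_derive_lin.
Qed.

(** The mean value inequality twice: once for the time derivative over a step [h], then for the
    first difference [psi] over another step [h]. *)
Lemma time_lip2 (g : R * V -> R) xi K a h : t0 <= a -> 0 <= h -> 0 <= K ->
  Ck D 2 g ->
  (forall s, t0 <= s -> `|derive_within D dt (derive_within D dt g) (s, xi)| <= K) ->
  `|g (a + h + h, xi) - g (a + h, xi) - (g (a + h, xi) - g (a, xi))| <= K * h * h.
Proof.
move=> t0a h0 K0 [gc /(_ dt)[gd [g1c /(_ dt)[g1d _]]]] gb.
pose psi s := g (s + h, xi) - g (s, xi).
have ah : a <= a + h by rewrite lerDl.
have pc : {within `[a, a + h], continuous psi}.
  apply: withinB; last exact: within_time.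
  apply: (within_within (F := fun s : R => s + h) (B := `[a, a + h + h]%classic)
    (h := fun s => g (s, xi))); last by apply: within_time.
    by apply/continuous_subspaceT => x; apply: cvgD; [exact: cvg_id|exact: cvg_cst].
  move=> s; rewrite /= !in_itv/= lerD2r => /andP[as_ ->]; rewrite andbT.
  by rewrite (le_trans as_)// lerDl.
have := @mvi_scalar R psi (fun s => K * h * (s - a))
  (fun s => derive_within D dt g (s + h, xi) - derive_within D dt g (s, xi))
  (fun=> K * h) a (a + h) ah pc (@within_lin R a _ (K * h)).
rewrite subrr mulr0 subr0 /psi; have -> : a + h - a = h by rewrite addrC addKr.
apply.
- move=> s /andP[as_ sb]; have t0s := le_lt_trans t0a as_.
  have t0sh : t0 < s + h by rewrite (lt_le_trans t0s)// lerDl.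
  apply: is_deriveB; last by apply: is_derive_t => //; apply: gd; exact: ltW.
  apply: (@is_derive_translate R R R (fun s => g (s, xi))).
  by apply: is_derive_t => //; apply: gd; exact: ltW.
- by move=> s _; exact: is_derive_lin.
- move=> s /andP[as_ sb]; have t0s := le_lt_trans t0a as_.
  have ssh : s <= s + h by rewrite lerDl.
  have := @time_lip (derive_within D dt g) xi K s (s + h) (ltW t0s) ssh g1c g1d.
  have -> : s + h - s = h by rewrite addrC addKr.
  by apply=> u /andP[su _]; apply: gb; rewrite (le_trans (ltW t0s))// ltW.
Qed.

End TimeDomain.

(** * Finite differences of the feedback and of the perturbation *)

Section KappaBounds.
Variables (R : realType) (n : nat) (t0 : R).
Local Notation V := 'cV[R]_n.
Local Notation D := (@from_time R n t0).
Local Notation dt := (dir_t R n).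
Local Notation dx := (@dir_x R n).
Implicit Types (g kappa delta : R * V -> R).

Lemma state_lip g (K t : R) (x y : V) : 0 <= K -> t0 <= t ->
  (forall v, forall p, D p -> derivable_within D v g p) ->
  (forall i z, box x y z -> `|derive_within D (dx i) g (t, z)| <= K) ->
  `|g (t, y) - g (t, x)| <= n%:R * K * `|y - x|.
Proof.
move=> K0 t0t gd gb.
apply: (@coord_lip R n (fun z => g (t, z)) (fun i z => derive_within D (dx i) g (t, z))) => //.
by move=> i z _; apply: is_derive_x => //; exact: gd.
Qed.

(** All that is used of the feedback, without derivatives and uniformly in time: these are the
    differences into which the second difference of [kappa (t + D, P t t)] along the trajectory is
    decomposed in [U_second_diff]. The fourth clause is the one that needs derivatives of order
    three, two in time and one in the state. *)
Definition tame kappa (K : R) : Prop :=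
  [/\ forall t, t0 <= t -> kappa (t, 0) = 0,
   forall t (x y : V), t0 <= t -> `|x| <= 1 -> `|y| <= 1 ->
     `|kappa (t, y) - kappa (t, x)| <= K * `|y - x|,
   forall t h (x y : V), t0 <= t -> 0 <= h -> `|x| <= 1 -> `|y| <= 1 ->
     `|kappa (t + h, y) - kappa (t, y) - (kappa (t + h, x) - kappa (t, x))| <= K * h * `|y - x|,
   forall t h (x y : V), t0 <= t -> 0 <= h -> `|x| <= 1 -> `|y| <= 1 ->
     `|kappa (t + h + h, y) - kappa (t + h, y) - (kappa (t + h, y) - kappa (t, y))
       - (kappa (t + h + h, x) - kappa (t + h, x) - (kappa (t + h, x) - kappa (t, x)))|
       <= K * h * h * `|y - x| &
   forall t (x a b : V), t0 <= t -> `|x| <= 1 -> `|x + a| <= 1 -> `|x + b| <= 1 ->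
     `|x + a + b| <= 1 ->
     `|kappa (t, x + a + b) - kappa (t, x + a) - (kappa (t, x + b) - kappa (t, x))|
       <= K * `|a| * `|b|].

Lemma classK_le (a : R -> R) x y : classK a -> 0 <= x -> x <= y -> a x <= a y.
Proof.
by move=> [_ _ am] x0; rewrite le_eqVlt => /predU1P[->//|xy]; apply/ltW/am.
Qed.

Lemma kappa_tame kappa (mu : R) (ahat : R -> R) : 0 < mu -> classKinf ahat ->
  Ck D 3 kappa ->
  (forall i t xi, (i <= 3)%N -> t0 <= t -> dnorm t0 i 0 kappa (t, xi) <= ahat (enorm xi)) ->
  (forall i j t xi, (i <= 3)%N -> (1 <= j <= 3 - i)%N -> t0 <= t ->
              dnorm t0 i j kappa (t, xi) <= mu + ahat (enorm xi)) ->
  exists2 K, 0 < K & tame kappa K.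
Proof.
move=> mu0 [aK _] kC k0 k1.
pose B := mu + ahat n%:R.
have a0 x : 0 <= x -> 0 <= ahat x.
  by move=> x0; case: (aK) => <- _ _; exact: classK_le.
have B0 : 0 < B by rewrite ltr_pwDl// a0.
have bnd i j (J : j.-tuple 'I_n) t xi : (i <= 3)%N -> (1 <= j <= 3 - i)%N -> t0 <= t -> `|xi| <= 1 ->
    `|foldr (derive_within D) kappa (nseq i dt ++ map dx J) (t, xi)| <= B.
  move=> i3 j3 t0t x1; apply: (le_trans (dnorm_ge _ _ _ _ _)).
  apply: (le_trans (k1 _ _ _ _ i3 j3 t0t)); rewrite lerD2l; apply: classK_le => //.
    exact: sqrtr_ge0.
  by apply: (le_trans (enorm_le _)); rewrite -[leRHS]mulr1 ler_wpM2l.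
have bx i t xi : t0 <= t -> `|xi| <= 1 -> `|derive_within D (dx i) kappa (t, xi)| <= B.
  exact: (bnd 0%N 1%N [tuple i]).
have btx i t xi : t0 <= t -> `|xi| <= 1 ->
    `|derive_within D dt (derive_within D (dx i) kappa) (t, xi)| <= B.
  exact: (bnd 1%N 1%N [tuple i]).
have bttx i t xi : t0 <= t -> `|xi| <= 1 ->
    `|derive_within D dt (derive_within D dt (derive_within D (dx i) kappa)) (t, xi)| <= B.
  exact: (bnd 2%N 1%N [tuple i]).
have bxx i j t xi : t0 <= t -> `|xi| <= 1 ->
    `|derive_within D (dx i) (derive_within D (dx j) kappa) (t, xi)| <= B.
  exact: (bnd 0%N 2%N [tuple i; j]).
have [kc kd] := kC.
have kdx i : Ck D 2 (derive_within D (dx i) kappa) by case: (kd (dx i)).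
have kd' v p : D p -> derivable_within D v kappa p by case: (kd v) => + _; apply.
have kdd i v p : D p -> derivable_within D v (derive_within D (dx i) kappa) p.
  by case: (kdx i) => _ /(_ v)[+ _]; apply.
have isx t z i : t0 <= t -> is_derive z (delta_mx i 0 : V) (fun z => kappa (t, z))
    (derive_within D (dx i) kappa (t, z)).
  by move=> t0t; apply: is_derive_x => //; exact: kd'.
pose N := n%:R : R.
have N0 : 0 <= N by rewrite /N.
(* One switch of coordinates costs [N * B], the second difference in the state costs two switches,
   [N * (N * B)]; [K] dominates both and is positive even if [n = 0]. *)
pose K := (N + 1) * ((N + 1) * B).
have NB : N * B <= K.
  have : 0 <= N * N * B by rewrite !mulr_ge0 // ltW.
  have : 0 <= N * B by rewrite !mulr_ge0 // ltW.
  by rewrite /K; lra.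
have NNB : N * (N * B) <= K.
  have : 0 <= N * B by rewrite !mulr_ge0 // ltW.
  by rewrite /K; lra.
have K0 : 0 < K by rewrite /K !mulr_gt0// ltr_wpDl.
exists K => //; split.
(* The bound of order zero is [ahat (enorm 0)], and a comparison function vanishes at 0. *)
- move=> t t0t; apply/eqP; rewrite -normr_eq0 eq_le normr_ge0 andbT.
  have := k0 0%N t 0 isT t0t; rewrite enorm0; case: (aK) => -> _ _; apply: le_trans.
  exact: (@dnorm_ge R n t0 0 0 kappa (t, 0) [tuple]).
- move=> t x y t0t x1 y1; apply: (@le_trans _ _ (N * B * `|y - x|)); last by rewrite ler_wpM2r.
  apply: state_lip => //; first exact: ltW.
  by move=> i z bz; apply: bx => //; exact: box_norm bz.
- move=> t h x y t0t h0 x1 y1.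
  have t0h : t0 <= t + h by rewrite (le_trans t0t)// lerDl.
  apply: (@le_trans _ _ (N * (B * h) * `|y - x|)).
    apply: (@coord_lip R n (fun z => kappa (t + h, z) - kappa (t, z))
      (fun i z => derive_within D (dx i) kappa (t + h, z) - derive_within D (dx i) kappa (t, z))).
    + by rewrite mulr_ge0// ltW.
    + by move=> i z bz; apply: is_deriveB; exact: isx.
    + move=> i z bz; have [gc gd] := kdx i.
      have tth : t <= t + h by rewrite lerDl.
      have := @time_lip R n t0 (derive_within D (dx i) kappa) z B t (t + h) t0t tth gc
        (fun p Dp => kdd i dt p Dp).
      have -> : t + h - t = h by rewrite addrC addKr.
      apply=> s /andP[ts _]; apply: btx; first by rewrite (le_trans t0t)// ltW.
      exact: box_norm bz.
  by rewrite mulrA !ler_wpM2r.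
- move=> t h x y t0t h0 x1 y1.
  have t0h : t0 <= t + h by rewrite (le_trans t0t)// lerDl.
  have t0hh : t0 <= t + h + h by rewrite (le_trans t0h)// lerDl.
  apply: (@le_trans _ _ (N * (B * h * h) * `|y - x|)).
    pose dk i z s := derive_within D (dx i) kappa (s, z).
    apply: (@coord_lip R n (fun z => kappa (t + h + h, z) - kappa (t + h, z) -
         (kappa (t + h, z) - kappa (t, z)))
      (fun i z => dk i z (t + h + h) - dk i z (t + h) - (dk i z (t + h) - dk i z t))).
    + by rewrite !mulr_ge0// ltW.
    + by move=> i z bz; apply: is_deriveB; apply: is_deriveB; exact: isx.
    + move=> i z bz; apply: (@time_lip2 R n t0) => //; first exact: ltW.
      move=> s t0s; apply: bttx => //; exact: box_norm bz.
  by rewrite !mulrA !ler_wpM2r.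
- move=> t x a b t0t x1 xa1 xb1 xab1.
  have -> : x + a + b = x + b + a by rewrite addrAC.
  have := @coord_lip R n (fun z => kappa (t, z + b) - kappa (t, z))
      (fun i z => derive_within D (dx i) kappa (t, z + b) - derive_within D (dx i) kappa (t, z))
      x (x + a) (N * B * `|b|).
  have -> : x + a + b = x + b + a by rewrite addrAC.
  have -> : x + a - x = a by rewrite addrC addKr.
  have -> : kappa (t, x + b + a) - kappa (t, x + a) - (kappa (t, x + b) - kappa (t, x)) =
     kappa (t, x + b + a) - kappa (t, x + a) - (kappa (t, x + b) - kappa (t, x)) by [].
  move=> H; apply: le_trans (H _ _ _) _.
  + by rewrite !mulr_ge0// ltW.
  + move=> i z bz; apply: is_deriveB; last exact: isx.
    by apply: (@is_derive_translate R V R (fun z => kappa (t, z))); exact: isx.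
  + move=> i z bz; have -> : `|b| = `|z + b - z| by rewrite addrAC subrr add0r.
    apply: state_lip => //; first exact: ltW.
      by move=> v p Dp; exact: kdd.
    move=> j w bw; apply: bxx => //; apply: box_norm bw; first exact: box_norm bz.
    by have := box_shift b bz; apply: box_norm.
  + by rewrite mulrA [leLHS]mulrAC ler_wpM2r// ler_wpM2r.
Qed.

Lemma delta_lip delta (eps : R) : 0 <= eps -> Ck D 1 delta ->
  (forall t xi, t0 <= t -> `|xi| <= 1 ->
     `|delta (t, xi)| + `|derive_within D dt delta (t, xi)| + dnorm t0 0 1 delta (t, xi) <= eps) ->
  forall t t' x y, t0 <= t -> t <= t' -> `|x| <= 1 -> `|y| <= 1 ->
    `|delta (t', y) - delta (t, x)| <= eps * (t' - t) + n%:R * eps * `|y - x|.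
Proof.
move=> e0 [dc dd] db t t' x y t0t tt' x1 y1.
have dn t1 xi : 0 <= dnorm t0 0 1 delta (t1, xi) by exact: sqrtr_ge0.
rewrite -(subrKA (delta (t, y))) (le_trans (ler_normD _ _))// lerD//.
  have dtd p : D p -> derivable_within D dt delta p by case: (dd dt) => h _; exact: h.
  apply: (time_lip t0t tt' dc dtd) => s /andP[ts _]; apply: le_trans (db s y _ _) => //; last by rewrite (le_trans t0t)// ltW.
  by rewrite -addrA addrCA lerDl addr_ge0.
apply: state_lip => //; first by move=> v; case: (dd v) => h _; exact: h.
move=> i z bz; apply: le_trans (db t z _ _) => //; last exact: box_norm bz.
apply: le_trans (_ : _ <= dnorm t0 0 1 delta (t, z)) _.
  exact: (@dnorm_ge R n t0 0 1 delta (t, z) [tuple i]).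
by rewrite lerDr addr_ge0.
Qed.

End KappaBounds.

(** * The vector field near the origin *)

Section FBounds.
Variables (R : realType) (n : nat).
Local Notation V := 'cV[R]_n.
Local Notation E := (V * R)%type.
Implicit Types (f : E -> V).

Definition lip_ball f (r L : R) : Prop := forall x y u v,
  `|x| <= r -> `|y| <= r -> `|u| <= r -> `|v| <= r ->
  `|f (x, u) - f (y, v)| <= L * (`|x - y| + `|u - v|).

(** The input is frozen: this is applied to predictors issued at different times but evaluated at
    the same time, which share the value of the input. *)
Definition lip2_ball f (r L : R) : Prop := forall x a b u,
  `|x| <= r -> `|x + a| <= r -> `|x + b| <= r -> `|x + a + b| <= r -> `|u| <= r ->
  `|f (x + a + b, u) - f (x + a, u) - (f (x + b, u) - f (x, u))| <= L * `|a| * `|b|.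

Definition fdir i : E := (delta_mx i 0, 0).
Definition fdiru : E := (0, 1).

Lemma is_derive_fx f (x : V) (u : R) i k : derivable_within setT (fdir i) f (x, u) ->
  is_derive x (delta_mx i 0 : V) (fun z => f (z, u) k 0)
    (derive_within setT (fdir i) f (x, u) k 0).
Proof.
move=> df; apply: (@is_derive_coord R n V (fun z => f (z, u))).
apply: (@is_derive_slice R E V V setT (fdir i) f (fun z => (z, u)) x) => //.
  by move=> h; rewrite /fdir /GRing.scale/= /GRing.add/= /add_pair/= scaler0 add0r.
by near=> h.
Unshelve. all: by end_near. Qed.

Lemma is_derive_fu f (x : V) (u : R) k : derivable_within setT fdiru f (x, u) ->
  is_derive u 1 (fun z => f (x, z) k 0) (derive_within setT fdiru f (x, u) k 0).
Proof.
move=> df; apply: (@is_derive_coord R n R (fun z => f (x, z))).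
apply: (@is_derive_slice R E R V setT fdiru f (fun z => (x, z)) u 1) => //.
  by move=> h; rewrite /fdir /GRing.scale/= /GRing.add/= /add_pair/= scaler0 add0r.
by near=> h.
Unshelve. all: by end_near. Qed.

Lemma u_lip f (x : V) (M u v : R) k : 0 <= M ->
  (forall p, derivable_within setT fdiru f p) ->
  (forall w, Num.min u v <= w <= Num.max u v -> `|derive_within setT fdiru f (x, w)| <= M) ->
  `|f (x, v) k 0 - f (x, u) k 0| <= M * `|v - u|.
Proof.
move=> M0 fd; wlog uv : u v / u <= v.
  move=> H fb; have [uv|/ltW vu] := leP u v; first exact: H.
  by rewrite distrC (distrC v); apply: H => // w; rewrite minC maxC; exact: fb.
move=> fb; rewrite (ger0_norm (_ : 0 <= v - u)) ?subr_ge0//.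
pose phi (z : R) : R := f (x, z) k 0.
have pd (s : R) : is_derive s (1 : R) phi (derive_within setT fdiru f (x, s) k 0) by exact: is_derive_fu.
have pc : {within `[u, v], continuous phi}.
  by apply: derivable_within_continuous => s _; case: (pd s).
have := @mvi_scalar R phi (fun s => M * (s - u)) (fun s => derive_within setT fdiru f (x, s) k 0)
  (fun=> M) u v uv pc (@within_lin R u _ M) (fun s _ => pd s) (fun s _ => is_derive_lin u M s).
rewrite subrr mulr0 subr0; apply => s /andP[us sv].
by rewrite (le_trans (coord_le_norm _ k))// fb// min_l// max_r// !ltW.
Qed.

Lemma within_setT (S W : topologicalType) (g : S -> W) :
  {within setT, continuous g} -> continuous g.
Proof.
move=> /subspace_continuousP gc x A gA.
have : \forall y \near x, [set: S] y -> A (g y) by exact: gc gA.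
by apply: filterS => y; apply.
Qed.

Lemma near_bounded (I : finType) (g : I -> E -> V) : (forall i, continuous (g i)) ->
  exists r M, [/\ 0 < r <= 1, 0 <= M &
    forall i x u, `|x| <= r -> `|u| <= r -> `|g i (x, u)| <= M].
Proof.
move=> gc.
have /filter_forall : forall i, \forall p \near (0 : E), `|g i p| <= `|g i 0| + 1.
  move=> i; have /cvgrPdist_lt/(_ 1 ltr01) := gc i 0.
  apply: filterS => p /ltW h; rewrite -(subrK (g i 0) (g i p)) addrC.
  by rewrite (le_trans (ler_normD _ _))// lerD2l distrC.
move=> /nbhs_ballP[e /= e0 He].
exists (Num.min 1 (e / 2)), (\big[Num.max/0]_i (`|g i 0| + 1)); split.
- by rewrite lt_min ltr01 divr_gt0//= ge_min lexx.
- by rewrite bigmax_ge_id.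
- move=> i x u; rewrite !le_min => /andP[_ xe] /andP[_ ue].
  apply: (@le_trans _ _ (`|g i 0| + 1)); last exact: le_bigmax.
  have lte (y : R) : y <= e / 2 -> y < e by move=> h; apply: (le_lt_trans h); lra.
  apply: (He (x, u)); split; rewrite /= -ball_normE/= sub0r normrN; exact: lte.
Qed.

Lemma f_local f : Ck setT 2 f ->
  exists r L, [/\ 0 < r <= 1, 0 < L, lip_ball f r L & lip2_ball f r L].
Proof.
move=> [fc fd].
have d1 v p : derivable_within setT v f p by case: (fd v) => + _; apply.
have c1 v : continuous (derive_within setT v f).
  by case: (fd v) => _ [+ _]; exact: within_setT.
have d2 v w p : derivable_within setT w (derive_within setT v f) p.
  by case: (fd v) => _ [_ /(_ w)[+ _]]; apply.
have c2 v w : continuous (derive_within setT w (derive_within setT v f)).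
  by case: (fd v) => _ [_ /(_ w)[_ [+ _]]]; exact: within_setT.
have [r1 [M1 [/andP[r10 r11] M10 b1]]] := near_bounded (fun i => c1 (fdir i)).
have [r2 [M2 [/andP[r20 r21] M20 b2]]] := near_bounded (fun _ : unit => c1 fdiru).
have [r3 [M3 [/andP[r30 r31] M30 b3]]] :=
  near_bounded (fun ij : 'I_n * 'I_n => c2 (fdir ij.1) (fdir ij.2)).
pose r := Num.min r1 (Num.min r2 r3).
have rr1 : r <= r1 by rewrite ge_min lexx.
have rr2 : r <= r2 by rewrite !ge_min lexx orbT.
have rr3 : r <= r3 by rewrite !ge_min lexx !orbT.
pose N := n%:R : R.
have N0 : 0 <= N by rewrite /N.
(* The terms serve, in order, the variation in the state, the variation in the input, the second
   difference in the state, and positivity. *)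
pose L := N * M1 + M2 + N * (N * M3) + 1.
have NM1 : 0 <= N * M1 by rewrite mulr_ge0.
have NM3 : 0 <= N * (N * M3) by rewrite !mulr_ge0.
have L0 : 0 < L by rewrite /L; lra.
exists r, L; split => //.
- by rewrite !lt_min r10 r20 r30/= (le_trans rr1).
- move=> x y u v xr yr ur vr; apply: norm_le_coord.
    by rewrite mulr_ge0 ?addr_ge0// ltW.
  move=> k; rewrite !mxE -(subrKA (f (y, u) k 0)) (le_trans (ler_normD _ _))// mulrDr lerD//.
    apply: (@le_trans _ _ (N * M1 * `|x - y|)); last by rewrite ler_wpM2r// /L; lra.
    apply: (@coord_lip R n (fun z => f (z, u) k 0) (fun i z => derive_within setT (fdir i) f (z, u) k 0)) => //.
      by move=> i z _; exact: is_derive_fx.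
    move=> i z bz; rewrite (le_trans (coord_le_norm _ k))// b1 ?(le_trans _ rr1)//.
    exact: box_norm bz.
  apply: (@le_trans _ _ (M2 * `|u - v|)); last by rewrite ler_wpM2r// /L; lra.
  apply: u_lip => // w /andP[w1 w2]; apply: (b2 tt); first exact: le_trans rr2.
  apply: le_trans rr2; move: ur vr; rewrite !ler_norml => /andP[u1 u2] /andP[v1 v2].
  apply/andP; split; first by apply: le_trans w1; rewrite le_min u1 v1.
  by apply: (le_trans w2); rewrite ge_max u2 v2.
- move=> x a b u xr xar xbr xabr ur; apply: norm_le_coord.
    by rewrite !mulr_ge0// ltW.
  move=> k; rewrite !mxE.
  have -> : f (x + a + b, u) k 0 - f (x + a, u) k 0 - (f (x + b, u) k 0 - f (x, u) k 0) =
    (fun z => f (z + b, u) k 0 - f (z, u) k 0) (x + a) -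
    (fun z => f (z + b, u) k 0 - f (z, u) k 0) x by [].
  apply: (@le_trans _ _ (N * (N * M3 * `|b|) * `|a|)); last first.
    rewrite [leLHS]mulrAC [leLHS]mulrA ler_wpM2r// [N * _ * _]mulrAC ler_wpM2r//.
    by rewrite /L; lra.
  have {3}-> : a = x + a - x by rewrite addrC addKr.
  apply: (@coord_lip R n (fun z => f (z + b, u) k 0 - f (z, u) k 0)
     (fun i z => derive_within setT (fdir i) f (z + b, u) k 0
     - derive_within setT (fdir i) f (z, u) k 0)).
  + by rewrite !mulr_ge0.
  + move=> i z bz; apply: is_deriveB; last exact: is_derive_fx.
    by apply: (@is_derive_translate R V R (fun z => f (z, u) k 0)); exact: is_derive_fx.
  + move=> i z bz; have {2}-> : b = z + b - z by rewrite addrC addKr.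
    apply: (@coord_lip R n (fun z => derive_within setT (fdir i) f (z, u) k 0)
      (fun j z => derive_within setT (fdir j) (derive_within setT (fdir i) f) (z, u) k 0)) => //.
      by move=> j w _; exact: is_derive_fx.
    move=> j w bw; rewrite (le_trans (coord_le_norm _ k))// (b3 (i, j)) ?(le_trans _ rr3)//.
    apply: box_norm bw; first exact: box_norm bz.
    exact: (box_norm xbr xabr (box_shift b bz)).
Qed.

End FBounds.

(** * Trajectories of the delayed system *)

Section Differences.
Variables (R : realType) (n : nat).
Local Notation V := 'cV[R]_n.

Lemma diff_pair (F G dF dG : R -> V) (a b c : R) : a <= b ->
  {within `[a, b], continuous F} -> {within `[a, b], continuous G} ->
  (forall s, a < s < b -> is_derive s 1 F (dF s)) ->
  (forall s, a < s < b -> is_derive s 1 G (dG s)) ->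
  (forall s, a < s < b -> `|dF s - dG s| <= c) ->
  `|F b - F a - (G b - G a)| <= c * (b - a).
Proof.
move=> ab Fc Gc Fd Gd le.
have -> : F b - F a - (G b - G a) = (F b - G b) - (F a - G a).
  by apply/matrixP => i j; rewrite !mxE; ring.
apply: (@mvi_lin R n (fun s => F s - G s) (fun s => dF s - dG s)) => //.
  exact: withinB.
by move=> s hs; apply: is_deriveB; [exact: Fd|exact: Gd].
Qed.

Lemma diff2 (F dF : R -> V) (a h c : R) : 0 <= h ->
  {within `[a, a + h + h], continuous F} ->
  (forall s, a < s < a + h + h -> is_derive s 1 F (dF s)) ->
  (forall s, a < s < a + h -> `|dF (s + h) - dF s| <= c) ->
  `|F (a + h + h) - F (a + h) - (F (a + h) - F a)| <= c * h.
Proof.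
move=> h0 Fc Fd le; have ah : a <= a + h by lra.
have := @diff_pair (fun s => F (s + h)) F (fun s => dF (s + h)) dF a (a + h) c ah.
have -> : a + h - a = h by lra.
move=> H; apply: H; last exact: le.
- by apply: within_shift; apply: within_itvS Fc; lra.
- by apply: within_itvS Fc; lra.
- move=> s hs; apply: is_derive_translate; apply: Fd; move: hs; lra.
- by move=> s hs; apply: Fd; move: hs; lra.
Qed.

Lemma norm_third (p0 p1 : V) (r : R) : `|p0| <= r / 3 -> `|p1| <= r / 3 ->
  `|p1 + p1 - p0| <= r.
Proof.
move=> h0 h1; apply: (le_trans (ler_normB _ _)).
have := ler_normD p1 p1; lra.
Qed.

(** The algebra of [p_second_diff]. There [p], [m] and [k] are predictors issued at [t], [t + h] or
    [t + 2h] (the index) and evaluated near the end of the window, [u] and [v] are predictors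
    evaluated near its beginning, and [x] are states. The second difference of the predictor splits
    into one along the newest predictor, twice a mixed one, and one across the three predictors at
    the same time [t]. The last is carried back by Gronwall to the start of the newest window, where
    it splits in the same way into differences of states and of predictors. *)
Lemma second_diff_combine (E D L a1 aP aU h w N cc : R)
    (p2 m2 k2 p1 k1 p0 v1 u2 u1 x0 x1 x2 : V) :
  0 <= E -> 0 <= D -> 0 <= L -> 0 <= a1 -> 0 <= aP -> 0 <= aU -> 0 <= h -> 0 <= w -> 0 <= N ->
  cc <= a1 * a1 * (N * (h * h)) ->
  `|x2 - x1 - (x1 - x0)| <= L * (2 * L * N * h + w) * h ->
  `|u2 - u1 - (v1 - x1)| <= L * (a1 * N * h) * h ->
  `|u2 - u1 - (u1 - x0)| <= L * (aP * N * h + w) * h ->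
  `|k2 - k1 - (k1 - p0)| <= E * (`|x2 - v1 - (v1 - u2)| + L * D * cc) ->
  `|m2 - k2 - (p1 - k1)| <= L * (a1 * N * h) * h ->
  `|p2 - m2 - (m2 - k2)| <= L * (aP * N * h + aU * N * h) * h ->
  `|p2 - p1 - (p1 - p0)| <=
    (E * (2 * L * L + 3 * (L * a1) + L * aP + L * D * (a1 * a1) + 2 * L) +
     2 * (L * a1) + L * (aP + aU)) * h * (h * N + w).
Proof.
move=> E0 D0 L0 a10 aP0 aU0 h0 w0 N0 ccb A B C Z F G.
have za : `|x2 - v1 - (v1 - u2)| <= L * (2 * L * N * h + w) * h + 2 * (L * (a1 * N * h) * h)
    + L * (aP * N * h + w) * h.
  have -> : x2 - v1 - (v1 - u2) = (x2 - x1 - (x1 - x0)) + (u2 - u1 - (v1 - x1))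
     + (u2 - u1 - (v1 - x1)) - (u2 - u1 - (u1 - x0)).
    by apply/matrixP => i j; rewrite !mxE; ring.
  apply: (le_trans (ler_normB _ _)); rewrite lerD//.
  apply: (le_trans (ler_normD _ _)).
  have n1 := ler_normD (x2 - x1 - (x1 - x0)) (u2 - u1 - (v1 - x1)).
  by clear - A B n1; lra.
have Z2 : `|k2 - k1 - (k1 - p0)| <= E * (L * (2 * L * N * h + w) * h + 2 * (L * (a1 * N * h) * h)
    + L * (aP * N * h + w) * h + L * D * (a1 * a1 * (N * (h * h)))).
  apply: (le_trans Z); rewrite ler_wpM2l// lerD// ler_wpM2l// mulr_ge0//.
have -> : p2 - p1 - (p1 - p0) = (p2 - m2 - (m2 - k2)) + (m2 - k2 - (p1 - k1))
   + (m2 - k2 - (p1 - k1)) + (k2 - k1 - (k1 - p0)).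
  by apply/matrixP => i j; rewrite !mxE; ring.
apply: (le_trans (ler_normD _ _)).
have n1 := ler_normD (p2 - m2 - (m2 - k2)) (m2 - k2 - (p1 - k1)).
have n2 := ler_normD (p2 - m2 - (m2 - k2) + (m2 - k2 - (p1 - k1))) (m2 - k2 - (p1 - k1)).
set S := (X in _ <= X).
have key : L * (aP * N * h + aU * N * h) * h + 2 * (L * (a1 * N * h) * h) +
   E * (L * (2 * L * N * h + w) * h + 2 * (L * (a1 * N * h) * h) + L * (aP * N * h + w) * h +
      L * D * (a1 * a1 * (N * (h * h)))) <= S.
  rewrite -subr_ge0 /S.
  set S' := (X in 0 <= X).
  have -> : S' = E * (L * a1 + 2 * L) * h * (h * N) +
   (E * (2 * L * L + 3 * (L * a1) + L * aP + L * D * (a1 * a1)) + 2 * (L * a1) + L * (aP + aU)) * h * w.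
    by rewrite /S'; ring.
  by rewrite !(addr_ge0, mulr_ge0).
move: S key => S key; clear - F G Z2 n1 n2 key; move: key n2 n1 Z2 G F; lin.
Qed.

End Differences.

Section Trajectories.
Variables (R : realType) (n : nat).
Local Notation V := 'cV[R]_n.
Variables (f : V * R -> V) (kappa : R * V -> R) (D t0 r L K rho : R).
Hypotheses (D0 : 0 < D) (r0_1 : 0 < r <= 1) (L0 : 0 < L) (K0 : 0 < K).
Hypotheses (f00 : f (0, 0) = 0) (fL : lip_ball f r L) (fL2 : lip2_ball f r L).
Hypothesis kT : tame t0 kappa K.

(** The amplification that [gronwall] with rate [L] allows over one delay. *)
Definition gain : R := 2 * expR (2 * L * D).
Local Notation E := gain.

Hypotheses (rho0 : 0 < rho) (rhor : 3 * (E * (1 + L * D) * rho) < r).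

Ltac keep H ::=
  lazymatch constr:((D0, r0_1, L0, K0, f00, fL, fL2, kT, rho0, rhor)) with
  | context [H] => idtac
  end.

(** The closed loop on [[t0, t1]] with the perturbation abstracted away: it survives only in the
    time [sg t] of the delayed input, which is nondecreasing, 2-Lipschitz and within [eps] of
    [t - D]. [rb] is where the history of the input begins, and [rho] bounds state and input, so
    that the local estimates on [f] and [kappa] apply. *)
Record trajectory (eps t1 rb : R) (X : R -> V) (U : R -> R) (P : R -> R -> V)
    (sg : R -> R) : Prop := Trajectory {
  orb_rb : rb <= t0 - D;
  orb_Xc : {within `[t0, t1], continuous X};
  orb_Xd : forall t, t0 < t < t1 -> is_derive t 1 X (f (X t, U (sg t)));
  orb_Uc : {within `[rb, t1], continuous U};
  orb_Pc : forall t, t0 <= t <= t1 -> {within `[t - D, t], continuous (P t)};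
  orb_P0 : forall t, t0 <= t <= t1 -> P t (t - D) = X t;
  orb_Pd : forall t th, t0 <= t <= t1 -> t - D < th < t ->
    is_derive th 1 (P t) (f (P t th, U th));
  orb_U : forall t, t0 <= t <= t1 -> U t = kappa (t + D, P t t);
  orb_sb : forall t, t0 <= t <= t1 -> rb <= sg t;
  orb_sD : forall t, t0 <= t <= t1 -> `|sg t - (t - D)| <= eps;
  orb_sL : forall s t, t0 <= s -> s <= t -> t <= t1 -> 0 <= sg t - sg s <= 2 * (t - s);
  orb_Xr : forall t, t0 <= t <= t1 -> `|X t| <= rho;
  orb_Ur : forall t, rb <= t <= t1 -> `|U t| <= rho }.

Lemma gain_ge2 : 2 <= E.
Proof. by rewrite /gain ler_peMr// -expR0 ler_expR !mulr_ge0// ltW. Qed.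

Lemma gain_le c : c <= D -> 2 * expR (2 * L * c) <= E.
Proof. by move=> cD; rewrite /gain ler_pM2l// ler_expR ler_pM2l// mulr_gt0. Qed.

Lemma gainE : E = 2 * expR (2 * L * D). Proof. by []. Qed.

Opaque gain.

Lemma rho_r : rho <= r / 3.
Proof.
have E2 := gain_ge2; have LD : 0 < L * D by rewrite mulr_gt0.
have : rho <= E * (1 + L * D) * rho.
  by rewrite ler_peMl ?(ltW rho0)// -[leLHS]mulr1 ler_pM//; lra.
by move: rhor; lra.
Qed.

Lemma f_bound x u : `|x| <= r -> `|u| <= r -> `|f (x, u)| <= L * (`|x| + `|u|).
Proof.
move=> xr ur; have := @fL x 0 u 0 xr _ ur _.
rewrite f00 !subr0 !normr0; apply; case/andP: r0_1 => ? _; exact: ltW.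
Qed.

Lemma kappa_bound t x : t0 <= t -> `|x| <= 1 -> `|kappa (t, x)| <= K * `|x|.
Proof.
move=> t0t x1; have [k0 k1 _ _ _] := kT.
by have := k1 t 0 x t0t; rewrite normr0 ler01 k0// !subr0; apply.
Qed.

Local Notation CP := (E * (1 + L * D)).

Lemma CP_ge2 : 2 <= CP.
Proof.
have := gain_ge2; have LD : 0 < L * D by rewrite mulr_gt0.
by move=> E2; apply: (le_trans E2); rewrite ler_peMr//; lra.
Qed.

Section OneTrajectory.
Variables (eps t1 rb : R) (X : R -> V) (U : R -> R) (P : R -> R -> V) (sg : R -> R).
Hypotheses (epsD : 0 < eps <= D) (orb : trajectory eps t1 rb X U P sg).

Ltac keep H ::=
  lazymatch constr:((D0, r0_1, L0, K0, f00, fL, fL2, kT, rho0, rhor, epsD, orb)) with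
  | context [H] => idtac
  end.

Let e0 : 0 < eps. Proof. by case/andP: epsD. Qed.
Let eD : eps <= D. Proof. by case/andP: epsD. Qed.

Lemma t0D (t th : R) : t0 <= t <= t1 -> t - D <= th -> rb <= th.
Proof. by move=> /andP[t0t _]; have := orb_rb orb; lra. Qed.

(** A third of [r], because second differences are estimated by extrapolating linearly from two
    predictors [p0] and [p1], and [p1 + p1 - p0] must remain in the ball of radius [r]. *)
Lemma P_small (t th : R) : t0 <= t <= t1 -> t - D <= th <= t -> `|P t th| <= r / 3.
Proof.
move=> ht hth; have DD : t - (t - D) = D by lra.
have tD : t - D <= t by lra.
have pd s : t - D < s < t -> is_derive s 1 (fun s => L * rho * (s - (t - D))) (L * rho).
  by move=> _; exact: is_derive_lin.
have pp s : t - D < s < t -> 0 <= L * rho by move=> _; rewrite mulr_ge0 // ltW.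
have := @gronwall_local R n (P t) (fun s => f (P t s, U s)) (fun s => L * rho * (s - (t - D)))
  (fun=> L * rho) L r (t - D) t L0 tD (orb_Pc orb ht) (@within_lin R _ _ _)
  (fun s => orb_Pd orb ht) pd pp.
rewrite subrr mulr0 subr0 DD (orb_P0 orb ht) -gainE => H.
have rr := rho_r; have [r0 r1] := andP r0_1.
have small : E * (`|X t| + L * rho * D) <= r / 3.
  apply: (@le_trans _ _ (E * (1 + L * D) * rho)); last by move: rhor; lra.
  have -> : E * (1 + L * D) * rho = E * (rho + L * rho * D) by ring.
  rewrite ler_pM2l ?lerD2r ?(orb_Xr orb)//; have := gain_ge2; lra.
apply: (le_trans _ small); apply: H => //; last by lra.
move=> s /andP[s1 s2] Pr; have Us : `|U s| <= rho.
  by apply: (orb_Ur orb); rewrite (t0D ht) ?(ltW s1)//=; move/andP: ht; lra.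
apply: le_trans (f_bound Pr _) _; first by lra.
by rewrite mulrDr lerD2l ler_pM2l.
Qed.

Lemma P_r (t th : R) : t0 <= t <= t1 -> t - D <= th <= t -> `|P t th| <= r.
Proof. by move=> a b; have := P_small a b; have /andP[] := r0_1; lra. Qed.

Lemma U_r (t : R) : rb <= t <= t1 -> `|U t| <= r.
Proof. by move=> /(orb_Ur orb); have := rho_r; have /andP[] := r0_1; lra. Qed.

Lemma X_r (t : R) : t0 <= t <= t1 -> `|X t| <= r.
Proof. by move=> /(orb_Xr orb); have := rho_r; have /andP[] := r0_1; lra. Qed.

Lemma sg_t1 (t : R) : t0 <= t <= t1 -> rb <= sg t <= t1.
Proof.
move=> ht; rewrite (orb_sb orb)//=; have := orb_sD orb ht; rewrite ler_norml.
by move: ht eD; lra.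
Qed.

(** The majorant of the input is a free function, so that it can be constant, as in [P_bound], or
    exponential, as in [growth_aux]. *)
Lemma P_forced (t : R) (phi dphi : R -> R) : t0 <= t <= t1 ->
  {within `[t - D, t], continuous phi} ->
  (forall s, t - D < s < t -> is_derive s 1 phi (dphi s)) ->
  (forall s, t - D < s < t -> L * `|U s| <= dphi s) ->
  forall th : R, t - D <= th <= t -> `|P t th| <= E * (`|X t| + (phi t - phi (t - D))).
Proof.
move=> ht pc pd pU; have DD : t - (t - D) = D by lra.
have tD : t - D <= t by rewrite gerBl ltW.
have := @gronwall R n (P t) (fun s => f (P t s, U s)) phi dphi L (t - D) t L0 tD (orb_Pc orb ht)
  pc (fun s => orb_Pd orb ht) pd.
rewrite DD (orb_P0 orb ht) -gainE; apply.
  by move=> s /pU; apply: le_trans; rewrite mulr_ge0// ltW.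
move=> s hs; apply: le_trans (f_bound _ _) _.
- by apply: P_r => //; move: hs; lra.
- by apply: U_r; rewrite (t0D ht)//=; move: hs ht; lra.
- by rewrite mulrDr lerD2l; exact: pU.
Qed.

Lemma P_bound (t u : R) : t0 <= t <= t1 -> (forall s : R, t - D <= s <= t -> `|U s| <= u) ->
  forall th : R, t - D <= th <= t -> `|P t th| <= E * (`|X t| + L * D * u).
Proof.
move=> ht Uu th hth.
have -> : L * D * u = L * u * (t - (t - D)) - L * u * (t - D - (t - D)) by ring.
apply: (@P_forced t (fun s => L * u * (s - (t - D))) (fun=> L * u)) => //.
- exact: within_lin.
- by move=> s _; exact: is_derive_lin.
- by move=> s hs; rewrite ler_pM2l// Uu//; move: hs; lra.
Qed.

(** Predictors issued at different times solve the same equation with the same input, so their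
    difference obeys Gronwall without forcing. *)
Lemma flow_diff (t t' a b : R) : t0 <= t <= t1 -> t0 <= t' <= t1 -> t - D <= a -> t' - D <= a ->
  a <= b -> b <= t -> b <= t' ->
  forall th : R, a <= th <= b -> `|P t' th - P t th| <= E * `|P t' a - P t a|.
Proof.
move=> ht ht' ta t'a ab bt bt' th hth.
have := @gronwall R n (fun s => P t' s - P t s) (fun s => f (P t' s, U s) - f (P t s, U s))
  (cst 0) (cst 0) L a b L0 ab.
rewrite subrr addr0 => H.
have {}H : `|P t' th - P t th| <= 2 * expR (2 * L * (b - a)) * `|P t' a - P t a|.
  apply: H hth.
  - apply: withinB.
      exact: within_itvS (orb_Pc orb ht').
    exact: within_itvS (orb_Pc orb ht).
  - exact: within_cst.
  - move=> s hs; apply: is_deriveB; apply: (orb_Pd orb) => //; move: hs; lra.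
  - by [].
  - move=> s hs; rewrite addr0.
    have := @fL (P t' s) (P t s) (U s) (U s); rewrite subrr normr0 addr0; apply.
    + by apply: P_r => //; move: hs; lra.
    + by apply: P_r => //; move: hs; lra.
    + by apply: U_r; rewrite (t0D ht)//=; move: hs ht; lra.
    + by apply: U_r; rewrite (t0D ht)//=; move: hs ht; lra.
apply: (le_trans H); rewrite ler_wpM2r// gain_le//; move: ta; lra.
Qed.

(** The past of the input is included down to [s - 2 * D], since the perturbed delay is at most
    [D + eps <= 2 * D]: from time [s] on, plant and predictors use only what is bounded here. *)
Definition bnd_on (s t N : R) : Prop :=
  (forall x : R, s <= x <= t -> `|X x| <= N) /\
  (forall x : R, rb <= x -> s - 2 * D <= x <= t -> `|U x| <= N).

Lemma bnd_on_sub (s t N s' t' : R) : s <= s' -> t' <= t -> bnd_on s t N -> bnd_on s' t' N.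
Proof. by move=> ss tt [bX bU]; split=> x; [move=> h; apply: bX|move=> h h'; apply: bU => //]; lra. Qed.

Lemma sg_lo (t : R) : t0 <= t <= t1 -> t - 2 * D <= sg t <= t.
Proof. by move=> /(orb_sD orb); rewrite ler_norml; move: eD; lra. Qed.

Lemma X_lip (s t N : R) : t0 <= s -> s <= t -> t <= t1 -> bnd_on s t N ->
  `|X t - X s| <= 2 * L * N * (t - s).
Proof.
move=> ts st tt [bX bU].
apply: (@mvi_lin R n X (fun x => f (X x, U (sg x)))) => //.
- exact: within_itvS (orb_Xc orb).
- by move=> x hx; apply: (orb_Xd orb); move: hx; lra.
- move=> x hx; have hx1 : t0 <= x <= t1 by move: hx; lra.
  apply: le_trans (f_bound (X_r hx1) (U_r (sg_t1 hx1))) _.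
  have := bX x; have := bU (sg x) (orb_sb orb hx1); have := sg_lo hx1.
  move=> hs hU hX; have {}hU : `|U (sg x)| <= N by apply: hU; move: hx; lra.
  have {}hX : `|X x| <= N by apply: hX; move: hx; lra.
  have -> : 2 * L * N = L * (N + N) by ring.
  by rewrite ler_pM2l// lerD.
Qed.

Lemma P_bnd (s t N x : R) : t0 <= s -> t <= t1 -> bnd_on s t N -> s <= x <= t ->
  forall th : R, x - D <= th <= x -> `|P x th| <= CP * N.
Proof.
move=> ts tt [bX bU] hx th hth.
have hx1 : t0 <= x <= t1 by move: hx; lra.
apply: le_trans (@P_bound x N hx1 _ th hth) _.
  by move=> y hy; apply: bU; [apply: (t0D hx1)|]; move: hx hy D0; lra.
have -> : CP * N = E * (N + L * D * N) by ring.
by rewrite ler_pM2l ?lerD2r ?bX//; have := gain_ge2; lra.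
Qed.

(** The maximum [m] of state and input against an exponential weight of rate [G] is estimated by
    itself. Wherever the recent input enters, in the plant or in the predictor, it enters through an
    integral, which gains a factor [1 / G]; so a large rate suffices and no smallness of the delay
    or of the feedback gain. *)
Lemma growth_aux (s t H a : R) : t0 <= s -> s <= t -> t <= t1 -> t <= s + H ->
  0 <= a -> bnd_on s s a ->
  let B := 1 + K * E in
  bnd_on s t (2 * B * (1 + L * H + L * D) * expR (6 * L * B * H) * a).
Proof.
move=> ts st tt tH a0 [bX bU] B.
have E2 := gain_ge2.
have KE : 0 < K * E by rewrite mulr_gt0//; lra.
have B1 : 1 <= B by rewrite /B; lra.
(* Chosen so that [B * (3 * L * m / G)] is [m / 2], which is absorbed in [key]. *)
pose G := 6 * L * B; have G0 : 0 < G by rewrite /G !mulr_gt0//; lra.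
have wX := within_norm (within_itvS ts tt (orb_Xc orb)).
have rbs : rb <= s by have := orb_rb orb; move: D0; lra.
have wU := within_norm (within_itvS rbs tt (orb_Uc orb)).
pose w (x : R) : R := Num.max `|X x| `|U x| * (1 * expR (- G * (x - s))).
have wc : {within `[s, t], continuous w}.
  apply: withinM; last exact: within_expR.
  exact: within_max.
have [c /[!in_itv]/= /andP[sc ct] cmax] := EVT_max st wc.
pose m : R := w c.
have m0 : 0 <= m by rewrite /m /w mulr_ge0 ?mul1r ?expR_ge0// le_max normr_ge0.
have mb (x : R) : s <= x <= t -> Num.max `|X x| `|U x| <= m * expR (G * (x - s)).
  move=> sab; have := cmax x; rewrite in_itv/= => /(_ sab).
  by rewrite -/m /w mul1r mulNr expRN => h; rewrite -ler_pdivrMr ?expR_gt0.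
have mX (x : R) : s <= x <= t -> `|X x| <= m * expR (G * (x - s)).
  by move=> /mb; apply: le_trans; rewrite le_max lexx.
have mU (x : R) : s <= x <= t -> `|U x| <= m * expR (G * (x - s)).
  by move=> /mb; apply: le_trans; rewrite le_max lexx orbT.
have mono (x y : R) : x <= y -> m * expR (G * (x - s)) <= m * expR (G * (y - s)).
  by move=> xy; rewrite ler_wpM2l// ler_expR ler_pM2l// lerB.
have U_all (x y : R) : rb <= x -> s - 2 * D <= x -> x <= y -> s <= y -> y <= t ->
    `|U x| <= a + m * expR (G * (y - s)).
  move=> rx sx xy sy yt; have [xs|sx'] := leP x s.
    by apply: le_trans (bU _ rx _) _; [move: xs sx; lin|rewrite lerDl mulr_ge0// expR_ge0].
  apply: le_trans (mU _ _) _; first by move: sx' yt xy; lin.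
  by apply: le_trans (mono _ _ xy) _; rewrite lerDr.
have mG (k g : R) : k * m / G * G * g = k * (m * g) by field; rewrite lt0r_neq0.
have Xb (x : R) : s <= x <= t ->
    `|X x| <= a * (1 + L * H) + 2 * L * m / G * expR (G * (x - s)).
  move=> /andP[sx xt].
  have := @mvi R n X (fun y => 2 * L * m / G * expR (G * (y - s)) + L * a * (y - s))
    (fun y => f (X y, U (sg y))) (fun y => 2 * L * m / G * G * expR (G * (y - s)) + L * a) s x sx
    (within_itvS ts (le_trans xt tt) (orb_Xc orb)).
  rewrite subrr !mulr0 addr0 expR0 mulr1 => HX.
  have {HX}: `|X x - X s| <= 2 * L * m / G * expR (G * (x - s)) + L * a * (x - s) - 2 * L * m / G.
    apply: HX.
    - apply: withinD; [exact: within_expR|exact: within_lin].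
    - by move=> y hy; apply: (orb_Xd orb); move: hy xt tt ts; lin.
    - by move=> y _; apply: is_deriveD; [exact: is_derive_expM|exact: is_derive_lin].
    - move=> y hy; have hy1 : t0 <= y <= t1 by move: hy xt tt ts; lin.
      apply: le_trans (f_bound (X_r hy1) (U_r (sg_t1 hy1))) _.
      rewrite mG.
      have h1 : `|X y| <= m * expR (G * (y - s)) by apply: mX; move: hy xt; lin.
      have h2 : `|U (sg y)| <= a + m * expR (G * (y - s)).
        have := sg_lo hy1 => hs; apply: U_all (orb_sb orb hy1) _ _ _ _; move: hy hs xt; lin.
      have -> : 2 * L * (m * expR (G * (y - s))) + L * a =
        L * (m * expR (G * (y - s)) + (a + m * expR (G * (y - s)))) by ring.
      by rewrite ler_pM2l// lerD.
  have Xs : `|X s| <= a by apply: bX; rewrite lexx.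
  have tr : `|X x| <= `|X s| + `|X x - X s|.
    by rewrite -{1}(subrK (X s) (X x)) addrC ler_normD.
  have h1 : L * a * (x - s) <= a * (L * H).
    have -> : a * (L * H) = L * a * H by ring.
    by rewrite ler_wpM2l ?mulr_ge0 ?(ltW L0)//; move: xt tH; lin.
  have h2 : 0 <= 2 * L * m / G by rewrite divr_ge0 ?(ltW G0)// !mulr_ge0// ltW.
  by rewrite [a * (1 + _)]mulrDr mulr1; move: h2 h1 tr Xs; lin.
have Pb (x : R) : s <= x <= t -> `|P x x| <= E * (`|X x| + L * D * a + L * m / G * expR (G * (x - s))).
  move=> hx; have hx1 : t0 <= x <= t1 by move: hx tt ts; lin.
  pose phi (y : R) := L * m / G * expR (G * (y - s)) + L * a * (y - (x - D)).
  have xx : x - D <= x <= x by rewrite gerBl ltW/=.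
  apply: le_trans (@P_forced x phi (fun y => L * m / G * G * expR (G * (y - s)) + L * a) hx1 _ _ _ x xx) _.
  - apply: withinD; [exact: within_expR|exact: within_lin].
  - by move=> y _; apply: is_deriveD; [exact: is_derive_expM|exact: is_derive_lin].
  - move=> y hy; have -> : L * m / G * G * expR (G * (y - s)) + L * a = L * (a + m * expR (G * (y - s))).
      by rewrite mG; ring.
    rewrite ler_pM2l//; have [ys|sy] := leP y s.
      apply: le_trans (bU y _ _) _; first by apply: (t0D hx1); move: hy; lin.
        by move: hy hx D0 ys; lin.
      by rewrite lerDl mulr_ge0// expR_ge0.
    apply: U_all; [apply: (t0D hx1)|..]; move: hy hx D0 sy; lin.
  - rewrite ler_pM2l; last by move: E2; lin.
    rewrite /phi subrr mulr0 addr0.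
    have -> : x - (x - D) = D by lin.
    have : 0 <= L * m / G * expR (G * (x - D - s)) by rewrite !mulr_ge0 ?expR_ge0 ?invr_ge0 ?(ltW G0) ?(ltW L0).
    by rewrite [L * a * D]mulrAC; lin.
have r1 : r <= 1 by case/andP: r0_1.
have Ub (x : R) : s <= x <= t -> `|U x| <= K * E * (a * (1 + L * H + L * D) + 3 * L * m / G * expR (G * (x - s))).
  move=> hx; have hx1 : t0 <= x <= t1 by move: hx tt ts; lin.
  rewrite (orb_U orb hx1); have t0x : t0 <= x + D by move: hx1 D0; lin.
  have xx : x - D <= x <= x by rewrite gerBl ltW/=.
  apply: le_trans (kappa_bound t0x (le_trans (P_r hx1 xx) r1)) _.
  rewrite -mulrA ler_pM2l//; apply: (le_trans (Pb x hx)); rewrite ler_pM2l; last by move: E2; lin.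
  by have := Xb x hx; lin.
have H0 : 0 <= H by move: tH st; lin.
have LH : 0 <= L * H by rewrite mulr_ge0// ltW.
have LD : 0 <= L * D by rewrite mulr_ge0// ltW.
have Mb (x : R) : s <= x <= t -> Num.max `|X x| `|U x| <=
    B * (a * (1 + L * H + L * D) + 3 * L * m / G * expR (G * (x - s))).
  move=> hx; set S := a * (1 + L * H + L * D) + _.
  have g0 : 0 <= L * m / G * expR (G * (x - s)) by rewrite !mulr_ge0 ?expR_ge0 ?invr_ge0 ?(ltW G0) ?(ltW L0).
  have XS : `|X x| <= S.
    apply: (le_trans (Xb x hx)); rewrite /S; have : 0 <= a * (L * D) by rewrite mulr_ge0.
    by rewrite (mulrDr a (1 + _)); move: g0; lin.
  have S0 : 0 <= S by apply: le_trans XS.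
  have : `|U x| <= K * E * S by exact: Ub.
  have : 0 <= K * E * S by rewrite mulr_ge0// ltW.
  by rewrite ge_max /B mulrDl mul1r => h1 h2; apply/andP; split; move: h1 XS h2 S0; lin.
have key : m <= 2 * B * (1 + L * H + L * D) * a.
  have g1 : 1 <= expR (G * (c - s)).
    by rewrite -[leLHS]expR0 ler_expR mulr_ge0 ?subr_ge0// ltW.
  have me : m * expR (G * (c - s)) = Num.max `|X c| `|U c|.
    by rewrite /m /w mul1r mulNr -mulrA -expRD addNr expR0 mulr1.
  have := Mb c; rewrite sc ct -me => /(_ isT).
  have -> : B * (a * (1 + L * H + L * D) + 3 * L * m / G * expR (G * (c - s))) =
    B * (1 + L * H + L * D) * a + m * expR (G * (c - s)) / 2.
    by rewrite /G; field; rewrite !lt0r_neq0//; move: B1; lin.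
  have : m <= m * expR (G * (c - s)) by rewrite ler_peMr.
  lin.
have fin (x : R) : s <= x <= t -> m * expR (G * (x - s)) <=
    2 * B * (1 + L * H + L * D) * expR (6 * L * B * H) * a.
  move=> hx; rewrite [leRHS]mulrAC ler_pM ?expR_ge0// ler_expR ler_pM2l//.
  by move: hx tH; lin.
split=> [x hx|x rx hx].
  by apply: le_trans (fin x hx); exact: mX.
have [xs|sx] := leP x s; last first.
  by apply: le_trans (fin x _); [apply: mU|]; move: hx sx; lin.
apply: le_trans (bU x rx _) _; first by move: hx xs; lin.
rewrite -{1}[a]mul1r ler_wpM2r//.
have e1 : 1 <= expR (6 * L * B * H) by rewrite -[leLHS]expR0 ler_expR mulr_ge0// ltW.
have b1 : 1 <= 2 * B * (1 + L * H + L * D).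
  by rewrite -[leLHS]mulr1 ler_pM//; move: B1 LD LH; lin.
by rewrite -[leLHS]mulr1 ler_pM.
Qed.

Lemma P_lip (s t N x a b : R) : t0 <= s -> t <= t1 -> bnd_on s t N -> s <= x <= t ->
  x - D <= a -> a <= b -> b <= x -> `|P x b - P x a| <= L * (CP + 1) * N * (b - a).
Proof.
move=> ts tt bd hx xa ab bx; have [bX bU] := bd.
have hx1 : t0 <= x <= t1 by move: hx; lra.
apply: (@mvi_lin R n (P x) (fun y => f (P x y, U y))) => //.
- exact: within_itvS (orb_Pc orb hx1).
- by move=> y hy; apply: (orb_Pd orb hx1); move: hy; lra.
- move=> y hy; have hy1 : x - D <= y <= x by move: hy; lra.
  have yrb : rb <= y by apply: (t0D hx1); move: hy; lra.
  apply: le_trans (f_bound (P_r hx1 hy1) (U_r _)) _; first by rewrite yrb /=; move: hy hx; lra.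
  have -> : L * (CP + 1) * N = L * (CP * N + N) by ring.
  rewrite ler_pM2l// lerD ?(P_bnd ts tt bd hx)// bU//.
  by move: hy hx D0; lra.
Qed.

(** At [t - D], where the later predictor starts from [X t], the earlier one has run for a time
    [t - s] from [X s]; so both are within a multiple of [t - s] of [X s], and [flow_diff] carries
    the gap along. *)
Lemma first_diff (s t N : R) : t0 <= s -> s <= t -> t <= t1 -> t - s <= D -> bnd_on s t N ->
  forall th : R, t - D <= th <= s ->
    `|P t th - P s th| <= E * (L * (CP + 3)) * N * (t - s).
Proof.
move=> ts st tt tsD bd th hth.
have hs : t0 <= s <= t1 by lra.
have ht : t0 <= t <= t1 by lra.
have sD : s - D <= t - D by lra.
apply: le_trans (flow_diff hs ht sD _ _ _ st hth) _ => //; first by lra.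
have -> : E * (L * (CP + 3)) * N * (t - s) = E * (L * ((CP + 3) * (N * (t - s)))) by ring.
rewrite ler_pM2l; last by have := gain_ge2; lra.
rewrite (orb_P0 orb ht); have sst : s <= s <= t by lra.
have h1 := P_lip ts tt bd sst (lexx _) sD _.
rewrite (orb_P0 orb hs) in h1.
have {}h1 : `|P s (t - D) - X s| <= L * (CP + 1) * N * (t - D - (s - D)) by apply: h1; lra.
have h2 := X_lip ts st tt bd.
have -> : X t - P s (t - D) = (X t - X s) - (P s (t - D) - X s) by rewrite opprB addrA subrK.
apply: (le_trans (ler_normB _ _)).
have -> : L * ((CP + 3) * (N * (t - s))) =
  2 * L * N * (t - s) + L * (CP + 1) * N * (t - D - (s - D)) by ring.
exact: lerD.
Qed.

Lemma p_diff (s t N : R) : t0 <= s -> s <= t -> t <= t1 -> t - s <= D -> bnd_on s t N ->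
  `|P t t - P s s| <= (E * (L * (CP + 3)) + L * (CP + 1)) * N * (t - s).
Proof.
move=> ts st tt tsD bd.
have hss : t - D <= s <= s by lra.
have h1 := first_diff ts st tt tsD bd hss.
have hst : s <= t <= t by lra.
have tDs : t - D <= s by lra.
have h2 := P_lip ts tt bd hst tDs st (lexx _).
rewrite -(subrKA (P t s)) (le_trans (ler_normD _ _))//.
by rewrite !mulrDl addrC lerD.
Qed.

Lemma U_diff (s t N : R) : t0 <= s -> s <= t -> t <= t1 -> t - s <= D -> bnd_on s t N ->
  `|U t - U s| <= K * (E * (L * (CP + 3)) + L * (CP + 1) + CP) * N * (t - s).
Proof.
move=> ts st tt tsD bd.
have hs : t0 <= s <= t1 by lra.
have ht : t0 <= t <= t1 by lra.
have r1 : r <= 1 by case/andP: r0_1.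
have ss : s - D <= s <= s by rewrite gerBl ltW/=.
have t_t : t - D <= t <= t by rewrite gerBl ltW/=.
have Pt1 := le_trans (P_r ht t_t) r1; have Ps1 := le_trans (P_r hs ss) r1.
rewrite (orb_U orb hs) (orb_U orb ht).
have [k0 k1 k2 _ _] := kT.
have t0D' : t0 <= t + D by move: ts st D0; lra.
have t0D'' : t0 <= s + D by move: ts st D0; lin.
rewrite -(subrKA (kappa (t + D, P s s))) (le_trans (ler_normD _ _))//.
have h1 := k1 _ _ _ t0D' Ps1 Pt1; have h2 := p_diff ts st tt tsD bd.
have h3 : `|kappa (t + D, P s s) - kappa (s + D, P s s)| <= K * (t - s) * `|P s s|.
  have ts0 : 0 <= t - s by move: st; lin.
  have := k2 (s + D) (t - s) 0 (P s s) t0D'' ts0; rewrite normr0 ler01 subr0.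
  have -> : s + D + (t - s) = t + D by ring.
  by rewrite !k0// !subr0; apply.
have sst : s <= s <= t by move: st; lin.
have h4 := P_bnd ts tt bd sst ss.
have h5 : K * (t - s) * `|P s s| <= K * (t - s) * (CP * N).
  by rewrite ler_wpM2l// mulr_ge0 ?(ltW K0)//; move: st; lin.
have h6 : K * `|P t t - P s s| <= K * ((E * (L * (CP + 3)) + L * (CP + 1)) * N * (t - s)).
  by rewrite ler_pM2l.
have -> : K * (E * (L * (CP + 3)) + L * (CP + 1) + CP) * N * (t - s) =
  K * ((E * (L * (CP + 3)) + L * (CP + 1)) * N * (t - s)) + K * (t - s) * (CP * N) by ring.
by apply: lerD; [exact: le_trans h6|exact: le_trans h5].
Qed.

(** Beyond distance [D] the windows of the two predictors no longer overlap; there the crude bound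
    [2 * N] is used, whence the term [2 / D]. *)
Lemma U_lip (s t N : R) : t0 <= s -> t <= t1 -> bnd_on s t N ->
  forall x y : R, s <= x -> x <= y -> y <= t ->
  `|U y - U x| <= (K * (E * (L * (CP + 3)) + L * (CP + 1) + CP) + 2 / D) * N * (y - x).
Proof.
move=> ts tt bd x y sx xy yt.
have N0 : 0 <= N.
  have sxt : s <= x <= t by lra.
  by case: bd => /(_ x sxt) h _; apply: le_trans h.
have CP2 := CP_ge2; have E2 := gain_ge2.
have c0 : 0 <= K * (E * (L * (CP + 3)) + L * (CP + 1) + CP) * N * (y - x).
  have h1 : 0 <= E * (L * (CP + 3)).
    by rewrite mulr_ge0 ?(le_trans _ E2)// mulr_ge0 ?(ltW L0)//; lra.
  have h2 : 0 <= L * (CP + 1) by rewrite mulr_ge0 ?(ltW L0)//; lra.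
  rewrite mulr_ge0 ?subr_ge0// mulr_ge0// mulr_ge0 ?(ltW K0)//; lra.
have [le|lt] := leP (y - x) D.
  apply: le_trans (U_diff _ xy _ le (bnd_on_sub sx yt bd)) _; [lra|lra|].
  rewrite mulrDl [leRHS]mulrDl lerDl !mulr_ge0 ?subr_ge0//.
  by rewrite invr_ge0 ltW.
rewrite mulrDl [leRHS]mulrDl (le_trans _ (_ : 2 / D * N * (y - x) <= _))//; last by rewrite lerDr.
apply: (@le_trans _ _ (2 * N)).
  have [_ bU] := bd; have rbs : rb <= s by have := orb_rb orb; move: D0; lra.
  apply: (le_trans (ler_normB _ _)).
  have := bU x (le_trans rbs sx); have := bU y (le_trans rbs (le_trans sx xy)).
  move=> hy hx; have : `|U y| <= N by apply: hy; move: D0; lra.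
  have : `|U x| <= N by apply: hx; move: D0; lra.
  lin.
have -> : 2 / D * N * (y - x) = 2 * N * ((y - x) / D) by ring.
by rewrite ler_peMr ?mulr_ge0// ler_pdivlMr// mul1r ltW.
Qed.

(** The predictor issued at [th] is compared with the true state one delay ahead, [X (s + D)]: both
    solve the same equation, except that the plant sees the input at [sg (s + D)] instead of [s], an
    error of at most [eps * Lam]. At [s = q - D] the true state is the starting point of the
    predictor issued at [q], and from there on [flow_diff] applies. Hence two factors [E]. *)
Lemma mismatch (Lam th q : R) : t0 <= th -> th <= q -> q <= t1 -> q - D <= th -> 0 <= Lam ->
  (forall x y : R, th - D - eps <= x -> x <= y -> y <= q -> `|U y - U x| <= Lam * (y - x)) ->
  `|P q th - P th th| <= E * E * L * D * (eps * Lam).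
Proof.
move=> tth thq qt qD Lam0 UL.
have hth : t0 <= th <= t1 by lra.
have hq : t0 <= q <= t1 by lra.
have DD : q - D - (th - D) <= D by lra.
have ab : th - D <= q - D by lra.
have s1 : `|P th (q - D) - X q| <= E * (L * D * (eps * Lam)).
  have := @gronwall R n (fun s => P th s - X (s + D))
    (fun s => f (P th s, U s) - f (X (s + D), U (sg (s + D))))
    (fun s => L * (eps * Lam) * (s - (th - D))) (fun=> L * (eps * Lam)) L (th - D) (q - D) L0 ab.
  rewrite !subrK (orb_P0 orb hth) !subrr normr0 mulr0 subr0 add0r => H.
  have -> : X q = X (q - D + D) by rewrite subrK.
  apply: le_trans (H _ _ _ _ _ _ (q - D) _) _ => {H}.
  - apply: withinB; first by apply: within_itvS (orb_Pc orb hth); lra.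
    apply: (within_within (F := fun s : R => s + D) (B := `[t0, t1]%classic) (h := X) _ _ (orb_Xc orb)).
      by apply/continuous_subspaceT => x; apply: cvgD; [exact: cvg_id|exact: cvg_cst].
    by move=> x; rewrite /= !in_itv/=; lra.
  - exact: within_lin.
  - move=> s hs; apply: is_deriveB; first by apply: (orb_Pd orb hth); move: hs; lra.
    have hs1 : t0 < s + D < t1 by move: hs; lra.
    have h := orb_Xd orb hs1.
    exact: (is_derive_translate h).
  - by move=> s _; exact: is_derive_lin.
  - by move=> s _; rewrite !mulr_ge0 // ltW.
  - move=> s hs.
    have hs1 : t0 <= s + D <= t1 by move: hs; lra.
    have hs2 : th - D <= s <= th by move: hs; lra.
    have hs3 : rb <= s <= t1 by rewrite (t0D hth)/=; move: hs2 qt thq; lin.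
    apply: le_trans (@fL _ _ _ _ (P_r hth hs2) (X_r hs1) (U_r hs3) (U_r (sg_t1 hs1))) _.
    rewrite mulrDr lerD2l ler_pM2l//.
    have := orb_sD orb hs1; rewrite addrK => sge.
    have : `|U s - U (sg (s + D))| <= Lam * `|sg (s + D) - s|.
      move: sge; rewrite ler_norml => sge.
      have [le|/ltW le] := leP s (sg (s + D)).
        rewrite distrC [X in _ * X]ger0_norm ?subr_ge0//; apply: UL => //; first by move: hs2 e0; lin.
        by move: sge hs eD; lra.
      rewrite (distrC _ s) [X in _ * X]ger0_norm ?subr_ge0//; apply: UL => //.
        by move: sge hs2; lra.
      by move: hs; lra.
    by move=> h; apply: (le_trans h); rewrite mulrC ler_wpM2r.
  - by rewrite ab lexx.
  - rewrite ler_pM ?mulr_ge0 ?expR_ge0 ?subr_ge0 ?(ltW L0) ?(ltW e0)// ?gain_le//.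
    rewrite [leRHS]mulrAC ler_wpM2l// !mulr_ge0// ltW//.
have thD : th - D <= q - D by lra.
have hh : q - D <= th <= th by lra.
have := flow_diff hq hth (lexx (q - D)) thD qD thq (lexx th) hh.
rewrite distrC (orb_P0 orb hq) => h; apply: (le_trans h).
have -> : E * E * L * D * (eps * Lam) = E * (E * (L * D * (eps * Lam))) by ring.
by rewrite ler_wpM2l//; have := gain_ge2; lin.
Qed.

(** This is [mismatch] with [th = q - D], where the predictor issued at [q] is [X q] itself: up to
    the mismatch, the input applied one delay ago is the delay-free feedback at the current
    state. *)
Lemma U_near_feedback (Lam q : R) : t0 <= q - D -> q <= t1 -> 0 <= Lam ->
  (forall x y : R, q - 2 * D - eps <= x -> x <= y -> y <= q -> `|U y - U x| <= Lam * (y - x)) ->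
  `|U (q - D) - kappa (q, X q)| <= K * (E * E * L * D * (eps * Lam)).
Proof.
move=> tq qt Lam0 UL.
have hq : t0 <= q <= t1 by move: tq D0; lra.
have hqD : t0 <= q - D <= t1 by move: D0; lra.
have qq : q - D <= q by rewrite gerBl ltW.
have r1 : r <= 1 by case/andP: r0_1.
have xx : q - D - D <= q - D <= q - D by rewrite gerBl ltW/=.
have := mismatch tq qq qt (lexx _) Lam0; rewrite (orb_P0 orb hq) => H.
rewrite (orb_U orb hqD) subrK.
have [_ k1 _ _ _] := kT; have t0q : t0 <= q by lra.
apply: le_trans (k1 _ _ _ t0q (le_trans (X_r hq) r1) (le_trans (P_r hqD xx) r1)) _.
rewrite ler_pM2l// distrC; apply: H => x y h1 h2 h3; apply: UL => //.
by move: h1; lra.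
Qed.

(** Bounds the input by the current state alone. On the window of the predictor issued at [q] every
    input is already feedback, and by [mismatch] nearly the feedback at this very predictor; so the
    predictor nearly follows the delay-free closed loop and is controlled by its initial value
    [X q]. *)
Lemma U_small (Lam q : R) : t0 <= q - D -> q <= t1 -> 0 <= Lam ->
  (forall x y : R, q - 2 * D - eps <= x -> x <= y -> y <= q -> `|U y - U x| <= Lam * (y - x)) ->
  `|U q| <= K * (2 * expR (2 * (L * (1 + K)) * D) *
     (`|X q| + L * (K * (E * E * L * D * (eps * Lam))) * D)).
Proof.
move=> tq qt Lam0 UL.
have hq : t0 <= q <= t1 by move: tq D0; lra.
have qq : q - D <= q by rewrite gerBl ltW.
have r1 : r <= 1 by case/andP: r0_1.
have [_ k1 _ _ _] := kT; have t0q : t0 <= q + D by move: D0; lra.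
have qDq : q - D <= q <= q by rewrite qq lexx.
rewrite (orb_U orb hq); apply: le_trans (kappa_bound t0q (le_trans (P_r hq qDq) r1)) _.
rewrite ler_pM2l//.
set M := K * (E * E * L * D * (eps * Lam)).
have LK0 : 0 < L * (1 + K) by rewrite mulr_gt0// ltr_wpDl.
have := @gronwall R n (P q) (fun s => f (P q s, U s)) (fun s => L * M * (s - (q - D)))
  (fun=> L * M) (L * (1 + K)) (q - D) q LK0 qq (orb_Pc orb hq) (@within_lin R _ _ _)
  (fun s => orb_Pd orb hq) (fun s _ => is_derive_lin _ _ _).
have -> : q - (q - D) = D by lra.
rewrite subrr mulr0 subr0 (orb_P0 orb hq); apply => //.
  move=> s _; rewrite /M !mulr_ge0 ?(ltW L0) ?(ltW K0) ?(ltW D0) ?(ltW e0)//; have := gain_ge2; lra.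
move=> s hs.
have hs1 : q - D <= s <= q by move: hs; lra.
have hs2 : t0 <= s <= t1 by move: hs; lra.
have hs3 : rb <= s <= t1 by rewrite (t0D hq)/=; move: hs1 qt; lin.
apply: le_trans (f_bound (P_r hq hs1) (U_r hs3)) _.
have -> : L * (1 + K) * `|P q s| + L * M = L * (`|P q s| + (K * `|P q s| + M)) by ring.
rewrite ler_pM2l// lerD2l (orb_U orb hs2).
have t0s : t0 <= s + D by move: hs2 D0; lra.
have ss : s - D <= s <= s by rewrite gerBl ltW/=.
have Ps1 := le_trans (P_r hs2 ss) r1; have Pq1 := le_trans (P_r hq hs1) r1.
rewrite -[kappa _](subrK (kappa (s + D, P q s))) (le_trans (ler_normD _ _))// addrC lerD ?kappa_bound//.
apply: le_trans (k1 _ _ _ t0s Pq1 Ps1) _; rewrite ler_pM2l// distrC.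
apply: mismatch => //; [move: hs2; lin|move: hs1; lin|move: hs1; lin|].
by move=> x y h1 h2 h3; apply: UL => //; move: h1 hs1; lin.
Qed.

(** * Second differences of state, predictor and input *)

Lemma X_diff2 (t h N w : R) : t0 <= t -> 0 <= h -> t + h + h <= t1 ->
  bnd_on t (t + h + h) N ->
  (forall s, t <= s <= t + h -> `|U (sg (s + h)) - U (sg s)| <= w) ->
  `|X (t + h + h) - X (t + h) - (X (t + h) - X t)| <= L * (2 * L * N * h + w) * h.
Proof.
move=> tt h0 ht bd wX; apply: (@diff2 R n X (fun s => f (X s, U (sg s)))) => //.
- by apply: within_itvS (orb_Xc orb).
- by move=> s hs; apply: (orb_Xd orb); move: hs; lra.
- move=> s hs; have hs1 : t0 <= s <= t1 by move: hs; lra.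
  have hs2 : t0 <= s + h <= t1 by move: hs; lra.
  apply: le_trans (@fL _ _ _ _ (X_r hs2) (X_r hs1) (U_r (sg_t1 hs2)) (U_r (sg_t1 hs1))) _.
  rewrite ler_pM2l//; apply: lerD; last by apply: wX; move: hs; lra.
  have := @X_lip s (s + h) N; have -> : s + h - s = h by lra.
  by apply; [move: hs tt; lin|move: h0; lin|move: hs ht; lin|apply: bnd_on_sub bd; move: hs; lin].
Qed.

Lemma P_pair (x y a b c : R) : t0 <= x <= t1 -> t0 <= y <= t1 -> x - D <= a -> y - D <= a ->
  a <= b -> b <= x -> b <= y ->
  (forall s, a < s < b -> `|P x s - P y s| <= c) ->
  `|P x b - P x a - (P y b - P y a)| <= L * c * (b - a).
Proof.
move=> hx hy xa ya ab bx by_ le.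
apply: (@diff_pair R n (P x) (P y) (fun s => f (P x s, U s)) (fun s => f (P y s, U s))) => //.
- exact: within_itvS (orb_Pc orb hx).
- exact: within_itvS (orb_Pc orb hy).
- by move=> s hs; apply: (orb_Pd orb hx); move: hs; lra.
- by move=> s hs; apply: (orb_Pd orb hy); move: hs; lra.
- move=> s hs; have hs0 : x - D <= s <= x by move: hs; lra.
  have hs1 : y - D <= s <= y by move: hs; lra.
  have Us : `|U s| <= r by apply: U_r; rewrite (t0D hx)/=; move: hs0; lra.
  have := @fL _ _ _ _ (P_r hx hs0) (P_r hy hs1) Us Us.
  by rewrite subrr normr0 addr0 => /le_trans; apply; rewrite ler_pM2l// le.
Qed.

Lemma P_diff2 (s t N x a h w : R) : t0 <= s -> t <= t1 -> bnd_on s t N -> s <= x <= t ->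
  0 <= h -> x - D <= a -> a + h + h <= x ->
  (forall y, a <= y <= a + h -> `|U (y + h) - U y| <= w) ->
  `|P x (a + h + h) - P x (a + h) - (P x (a + h) - P x a)| <=
    L * (L * (CP + 1) * N * h + w) * h.
Proof.
move=> ts tt bd hx h0 xa ax le.
have hx1 : t0 <= x <= t1 by move: hx; lra.
apply: (@diff2 R n (P x) (fun y => f (P x y, U y))) => //.
- exact: within_itvS (orb_Pc orb hx1).
- by move=> y hy; apply: (orb_Pd orb hx1); move: hy; lra.
- move=> y hy; have hy0 : x - D <= y <= x by move: hy; lra.
  have hy1 : x - D <= y + h <= x by move: hy; lra.
  have Us : `|U y| <= r by apply: U_r; rewrite (t0D hx1)/=; move: hy0; lra.
  have Us1 : `|U (y + h)| <= r by apply: U_r; rewrite (t0D hx1)/=; move: hy1 hx tt; lin.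
  apply: le_trans (@fL _ _ _ _ (P_r hx1 hy1) (P_r hx1 hy0) Us1 Us) _.
  rewrite ler_pM2l//; apply: lerD; last by apply: le; move: hy; lra.
  have := @P_lip s t N x y (y + h) ts tt bd hx.
  have -> : y + h - y = h by lra.
  by apply; move: hy0 hy1 h0; lin.
Qed.

(** For predictor values [p0], [p1], [p2] at the same time, [f] is compared at [p2] and at the
    extrapolated point [p1 + p1 - p0]. Their distance is the second difference itself, which gives
    the linear term; the rest is a second difference of [f] with equal increments [p1 - p0], of size
    [L * (c * c)]. *)
Lemma P_second_gronwall (x y z a b c : R) : t0 <= x -> x <= y -> y <= z -> z <= t1 ->
  z - D <= a -> a <= b -> b <= x -> 0 <= c ->
  (forall s, a <= s <= b -> `|P y s - P x s| <= c) ->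
  `|P z b - P y b - (P y b - P x b)| <=
    E * (`|P z a - P y a - (P y a - P x a)| + L * D * (c * c)).
Proof.
move=> tx xy yz zt za ab bx c0 le.
have hx : t0 <= x <= t1 by lra.
have hy : t0 <= y <= t1 by lra.
have hz : t0 <= z <= t1 by lra.
have E2 := gain_ge2.
have cc0 : 0 <= c * c by rewrite mulr_ge0.
have zc : {within `[a, b], continuous (fun s => P z s - P y s - (P y s - P x s))}.
  apply: withinB; apply: withinB.
  - by apply: within_itvS (orb_Pc orb hz); lra.
  - by apply: within_itvS (orb_Pc orb hy); lra.
  - by apply: within_itvS (orb_Pc orb hy); move: za yz bx xy; lin.
  - by apply: within_itvS (orb_Pc orb hx); lra.
have := @gronwall R n (fun s => P z s - P y s - (P y s - P x s))
    (fun s => f (P z s, U s) - f (P y s, U s) - (f (P y s, U s) - f (P x s, U s)))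
    (fun s => L * (c * c) * (s - a)) (fun=> L * (c * c)) L _ _ L0 ab zc (@within_lin R _ _ _).
rewrite subrr mulr0 subr0 => H.
apply: le_trans (H _ _ _ _ b _) _ => {H}.
- move=> s hs; apply: is_deriveB; apply: is_deriveB.
  + by apply: (orb_Pd orb hz); move: hs; lra.
  + by apply: (orb_Pd orb hy); move: hs; lra.
  + by apply: (orb_Pd orb hy); move: hs; lra.
  + by apply: (orb_Pd orb hx); move: hs; lra.
- by move=> s _; exact: is_derive_lin.
- by move=> s _; rewrite mulr_ge0// ltW.
- move=> s hs; have hs0 : x - D <= s <= x by move: hs; lra.
  have hs1 : y - D <= s <= y by move: hs; lra.
  have hs2 : z - D <= s <= z by move: hs bx za yz xy; lin.
  have Us : `|U s| <= r by apply: U_r; rewrite (t0D hx)/=; move: hs0 zt yz xy; lin.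
  have hy0 := P_small hx hs0; have hy1 := P_small hy hs1.
  have bb : `|P y s - P x s| <= c by apply: le; move: hs; lin.
  have r2 := P_r hz hs2; have r1 := P_r hy hs1; have r0 := P_r hx hs0.
  move: (P x s) (P y s) (P z s) (U s) hy0 hy1 bb Us r0 r1 r2 => p0 p1 p2 u hp0 hp1 bb ur r0 r1 r2.
  set b0 := p1 - p0 in bb *.
  have p1E : p1 = p0 + b0 by rewrite /b0 addrC subrK.
  have pbb : `|p0 + b0 + b0| <= r.
    have -> : p0 + b0 + b0 = p1 + b0 by rewrite p1E.
    have -> : p1 + b0 = p1 + p1 - p0 by rewrite /b0 addrA.
    exact: norm_third.
  have pb : `|p0 + b0| <= r by rewrite -p1E.
  clearbody b0.
  have h1 := @fL2 p0 b0 b0 u r0 pb pb pbb ur.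
  have h2 := @fL p2 (p0 + b0 + b0) u u r2 pbb ur ur.
  rewrite subrr normr0 addr0 in h2.
  have -> : p2 - p1 - b0 = p2 - (p0 + b0 + b0) by rewrite -p1E opprD addrA.
  rewrite -p1E in h1 h2 *.
  rewrite -(subrKA (f (p1 + b0, u)) (f (p2, u))) -addrA.
  apply: (le_trans (ler_normD _ _)); apply: lerD => //.
  by apply: (le_trans h1); rewrite -mulrA ler_pM2l// ler_pM.
- by rewrite ab lexx.
- have abD : b - a <= D by lra.
  apply: ler_pM.
  + by rewrite mulr_ge0 ?expR_ge0.
  + by rewrite addr_ge0// mulr_ge0 ?subr_ge0// mulr_ge0 ?(ltW L0).
  + exact: gain_le.
  + rewrite lerD2l -[leRHS]mulrA -[leLHS]mulrA ler_pM2l// mulrC ler_wpM2r//.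
Qed.

Local Notation c1 := (E * (L * (CP + 3))).
Local Notation cP := (L * (CP + 1)).
Local Notation cU := (K * (c1 + cP + CP)).

(** The oscillation [w] stands for what is not smooth: the delayed input in the plant and the input
    at the start of the predictor window. [N <= 1] makes the quadratic term from [P_second_gronwall]
    linear in [N]. *)
Lemma p_second_diff (t h N w : R) : t0 <= t -> 0 <= h -> h + h <= D -> t + h + h <= t1 ->
  N <= 1 -> bnd_on t (t + h + h) N ->
  (forall s, t <= s <= t + h -> `|U (sg (s + h)) - U (sg s)| <= w) ->
  (forall s, t - D <= s <= t - D + h -> `|U (s + h) - U s| <= w) ->
  `|P (t + h + h) (t + h + h) - P (t + h) (t + h) - (P (t + h) (t + h) - P t t)| <=
    (E * (2 * L * L + 3 * (L * c1) + L * cP + L * D * (c1 * c1) + 2 * L) +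
     2 * (L * c1) + L * (cP + cU)) * h * (h * N + w).
Proof.
move=> tt h0 hD ht N1 bd wX wU.
have N0 : 0 <= N.
  have tth : t <= t <= t + h + h by lra.
  by case: bd => /(_ t tth) hX _; apply: le_trans hX.
have CP2 := CP_ge2; have E2 := gain_ge2; have E0 : 0 <= E by lra.
have c10 : 0 <= c1 by rewrite mulr_ge0// mulr_ge0 ?(ltW L0)//; lra.
have cP0 : 0 <= cP by rewrite mulr_ge0 ?(ltW L0)//; lra.
have cU0 : 0 <= cU by rewrite mulr_ge0 ?(ltW K0)//; lra.
have ht0 : t0 <= t <= t1 by lra.
have ht1 : t0 <= t + h <= t1 by lra.
have ht2 : t0 <= t + h + h <= t1 by move: ht h0 tt; lin.
have w0 : 0 <= w.
  have tth : t <= t <= t + h by move: h0; lin.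
  exact: le_trans (wX t tth).
have bd1 : bnd_on t (t + h) N by apply: bnd_on_sub bd; move: h0; lin.
have bd2 : bnd_on (t + h) (t + h + h) N by apply: bnd_on_sub bd; move: h0; lin.
have hh1 : t <= t + h by move: h0; lin.
have hh2 : t + h <= t + h + h by move: h0; lin.
have hhD : h <= D by move: hD h0; lin.
have t0h : t0 <= t + h by move: h0 tt; lin.
have thD : t + h + h - D <= t by move: hD; lin.
have in0 : t <= t <= t + h + h by move: h0; lin.
have in2 : t <= t + h + h <= t + h + h by move: h0; lin.
have e1 : t + h - t = h by lin.
have e2 : t + h + h - (t + h) = h by lin.
have e3 : t + h + h - D - (t + h - D) = h by lin.
have e4 : t - D + h = t + h - D by lin.
have e5 : t + h - D + h = t + h + h - D by lin.
have i1 : t - D <= t + h - D by move: h0; lin.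
have i2 : t + h - D <= t + h + h - D by move: h0; lin.
have i3 : t + h - D <= t by move: hD h0; lin.
have i4 : t + h + h - D <= t + h by move: hD h0; lin.
have q1 s : t + h - D < s < t + h + h - D -> t + h - D <= s <= t by move: hD; lin.
have q2 s : t + h + h - D <= s <= t -> t + h - D <= s <= t by move: h0; lin.
have q3 s : t < s < t + h -> t + h + h - D <= s <= t + h by move: hD; lin.
have q4 y : t <= y <= t + h -> [/\ t0 <= y, y <= y + h, y + h <= t1 & y + h <= t + h + h].
  by move=> hy; split; move: hy tt h0 hD ht; lin.
have FD1 (th : R) : t + h - D <= th <= t -> `|P (t + h) th - P t th| <= c1 * N * h.
  by have := @first_diff t (t + h) N tt hh1 (proj2 (andP ht1)) _ bd1 th; rewrite e1; apply.
have FD2 (th : R) : t + h + h - D <= th <= t + h ->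
    `|P (t + h + h) th - P (t + h) th| <= c1 * N * h.
  by have := @first_diff (t + h) (t + h + h) N t0h hh2 ht _ bd2 th; rewrite e2; apply.
have A := X_diff2 tt h0 ht bd wX.
have B := @P_pair t (t + h) (t + h - D) (t + h + h - D) (c1 * N * h) ht0 ht1 i1 (lexx _) i2 thD i4.
rewrite e3 (orb_P0 orb ht1) in B.
have {}B : `|P t (t + h + h - D) - P t (t + h - D) - (P (t + h) (t + h + h - D) - X (t + h))| <=
    L * (c1 * N * h) * h.
  by apply: B => s /q1; rewrite distrC; exact: FD1.
have C := @P_diff2 t (t + h + h) N t (t - D) h w tt ht bd in0 h0 (lexx _).
rewrite e4 e5 (orb_P0 orb ht0) in C.
have {}C : `|P t (t + h + h - D) - P t (t + h - D) - (P t (t + h - D) - X t)| <=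
    L * (cP * N * h + w) * h.
  by apply: C => // y hy; apply: wU; rewrite e4.
have cNh : 0 <= c1 * N * h by rewrite mulr_ge0// mulr_ge0.
have Z := @P_second_gronwall t (t + h) (t + h + h) (t + h + h - D) t (c1 * N * h) tt hh1 hh2 ht
  (lexx _) thD (lexx _) cNh.
have {}Z : `|P (t + h + h) t - P (t + h) t - (P (t + h) t - P t t)| <=
    E * (`|P (t + h + h) (t + h + h - D) - P (t + h) (t + h + h - D) -
      (P (t + h) (t + h + h - D) - P t (t + h + h - D))| + L * D * (c1 * N * h * (c1 * N * h))).
  by apply: Z => s /q2; exact: FD1.
rewrite (orb_P0 orb ht2) in Z.
have Fp := @P_pair (t + h + h) (t + h) t (t + h) (c1 * N * h) ht2 ht1 thD i3 hh1 hh2 (lexx _).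
rewrite e1 in Fp.
have {}Fp : `|P (t + h + h) (t + h) - P (t + h + h) t - (P (t + h) (t + h) - P (t + h) t)| <=
    L * (c1 * N * h) * h.
  by apply: Fp => s /q3; exact: FD2.
have G := @P_diff2 t (t + h + h) N (t + h + h) t h (cU * N * h) tt ht bd in2 h0 thD (lexx _).
have {}G : `|P (t + h + h) (t + h + h) - P (t + h + h) (t + h) -
    (P (t + h + h) (t + h) - P (t + h + h) t)| <= L * (cP * N * h + cU * N * h) * h.
  apply: G => y hy; have := @U_diff y (y + h) N.
  have [hy1 hy2 hy3 hy4] := q4 _ hy.
  have -> : y + h - y = h by rewrite addrC addKr.
  apply => //; apply: bnd_on_sub bd => //; by case/andP: hy.
have cc : c1 * N * h * (c1 * N * h) <= c1 * c1 * (N * (h * h)).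
  have -> : c1 * N * h * (c1 * N * h) = c1 * c1 * (N * (N * (h * h))) by ring.
  apply: ler_wpM2l; first exact: mulr_ge0.
  by apply: ler_piMl => //; rewrite mulr_ge0// mulr_ge0.
move: (P (t + h + h) (t + h + h)) (P (t + h + h) (t + h)) (P (t + h + h) t) (P (t + h) (t + h))
  (P (t + h) t) (P t t) (P (t + h) (t + h + h - D)) (P t (t + h + h - D)) (P t (t + h - D))
  (X t) (X (t + h)) (X (t + h + h)) A B C Z Fp G.
move: c1 cP cU c10 cP0 cU0 cc => a1 aP aU a10 aP0 aU0 cc p2 m2 k2 p1 k1 p0 v1 u2 u1 x0 x1 x2.
move=> A B C Z Fp G; have D00 := ltW D0; have L00 := ltW L0.
apply: (second_diff_combine E0 D00 L00 a10 aP0 aU0 h0 w0 N0 cc A B C Z Fp G).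
Qed.

Local Notation cp := (c1 + cP).

(** With [q] extrapolated linearly from the first two predictors, the second difference of the
    feedback splits into the error [p2 - q] in the state, a second difference in time at [q], twice
    a mixed difference, and a second difference in the state along [p0], [p1], [q]; each is a clause
    of [tame]. *)
Lemma U_second_diff (t h N Dp : R) : t0 <= t -> 0 <= h -> h + h <= D -> t + h + h <= t1 ->
  N <= 1 -> bnd_on t (t + h + h) N ->
  `|P (t + h + h) (t + h + h) - P (t + h) (t + h) - (P (t + h) (t + h) - P t t)| <= Dp ->
  `|U (t + h + h) - U (t + h) - (U (t + h) - U t)| <=
    K * Dp + (K * (3 * CP) + 2 * (K * cp) + K * (cp * cp)) * h * (h * N).
Proof.
move=> tt h0 hD ht N1 bd pD.
have r1 : r <= 1 by case/andP: r0_1.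
have N0 : 0 <= N.
  have tth : t <= t <= t + h + h by lra.
  by case: bd => /(_ t tth) hX _; apply: le_trans hX.
have ht0 : t0 <= t <= t1 by lra.
have ht1 : t0 <= t + h <= t1 by lra.
have ht2 : t0 <= t + h + h <= t1 by lra.
have in0 : t <= t <= t + h + h by lra.
have in1 : t <= t + h <= t + h + h by lra.
have hh1 : t <= t + h by lra.
have hhD : t + h - t <= D by lra.
have e1 : t + h - t = h by rewrite addrC addKr.
have tD : t0 <= t + D by lra.
have dd (x : R) : x - D <= x <= x by rewrite gerBl ltW/=.
have K00 := ltW K0; have CP0 : 0 <= CP by have := CP_ge2; lin.
have P0s := P_small ht0 (dd t); have P1s := P_small ht1 (dd _).
have P2r := P_r ht2 (dd _).
have P0b := P_bnd tt ht bd in0 (dd t); have P1b := P_bnd tt ht bd in1 (dd _).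
have pd := p_diff tt hh1 (proj2 (andP ht1)) hhD (bnd_on_sub (lexx _) (proj2 (andP in1)) bd).
rewrite e1 in pd.
rewrite (orb_U orb ht0) (orb_U orb ht1) (orb_U orb ht2).
have [k0 k1 k2 k3 k4] := kT.
have [-> ->] : t + h + h + D = t + D + h + h /\ t + h + D = t + D + h by split; ring.
move: (P (t + h + h) (t + h + h)) (P (t + h) (t + h)) (P t t) (t + D) tD P0s P1s P2r P0b P1b pd pD.
move=> p2 p1 p0 tau t0tau P0s P1s P2r P0b P1b pd pD.
have E2 := gain_ge2.
have cp0 : 0 <= cp.
  by rewrite addr_ge0// mulr_ge0 ?mulr_ge0 ?(ltW L0)//; move: CP0; lin.
move: cp cp0 pd => a a0 pd.
set q := p1 + p1 - p0; pose bb := p1 - p0.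
have qr : `|q| <= 1 by apply: le_trans r1; exact: norm_third.
have p0r : `|p0| <= 1 by apply: (le_trans P0s); have := normr_ge0 p0; move: r1; lin.
have p1r : `|p1| <= 1 by apply: (le_trans P1s); have := normr_ge0 p0; move: r1; lin.
have p2r : `|p2| <= 1 by apply: le_trans r1.
have q3 : `|q| <= 3 * CP * N.
  apply: (le_trans (ler_normB _ _)); have := ler_normD p1 p1; move: P1b P0b; lin.
have tauh : t0 <= tau + h by move: t0tau h0; lin.
have tauhh : t0 <= tau + h + h by move: t0tau h0; lin.
have qp : q - p1 = bb by rewrite /q /bb addrAC addrK.
have n00 : `|0 : V| <= 1 by rewrite normr0.
have T1 : `|kappa (tau + h + h, p2) - kappa (tau + h + h, q)| <= K * Dp.
  apply: le_trans (k1 _ _ _ tauhh qr p2r) _; rewrite ler_pM2l//.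
  by have <- : p2 - p1 - (p1 - p0) = p2 - q by rewrite /q; apply/matrixP => i j; rewrite !mxE; ring.
(* The other state in the clause of [tame] is 0, where the feedback vanishes at all times. *)
have T2 : `|kappa (tau + h + h, q) - kappa (tau + h, q) - (kappa (tau + h, q) - kappa (tau, q))|
    <= K * h * h * (3 * CP * N).
  have := k3 tau h 0 q t0tau h0 n00 qr; rewrite !k0// !subr0 => /le_trans; apply.
  by rewrite ler_wpM2l// mulr_ge0// mulr_ge0.
have T3 : `|kappa (tau + h, q) - kappa (tau, q) - (kappa (tau + h, p1) - kappa (tau, p1))|
    <= K * h * (a * N * h).
  have := k2 tau h p1 q t0tau h0 p1r qr; rewrite qp => /le_trans; apply.
  by rewrite ler_wpM2l// mulr_ge0.
have T4 : `|kappa (tau, q) - kappa (tau, p1) - (kappa (tau, p1) - kappa (tau, p0))|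
    <= K * (a * N * h) * (a * N * h).
  have p1E : p1 = p0 + bb by rewrite /bb addrC subrK.
  have qE : q = p0 + bb + bb by rewrite -p1E -qp addrC subrK.
  have := k4 tau p0 bb bb t0tau p0r; rewrite -qE -p1E => /(_ p1r p1r qr) /le_trans; apply.
  by apply: ler_pM => //; [rewrite mulr_ge0|rewrite ler_pM2l].
have sq : K * (a * N * h) * (a * N * h) <= K * (a * a) * h * (h * N).
  have -> : K * (a * N * h) * (a * N * h) = K * (a * a) * h * (N * (h * N)) by ring.
  apply: ler_wpM2l; first by rewrite !mulr_ge0.
  by apply: ler_piMl => //; rewrite mulr_ge0.
have -> : kappa (tau + h + h, p2) - kappa (tau + h, p1) - (kappa (tau + h, p1) - kappa (tau, p0))
  = (kappa (tau + h + h, p2) - kappa (tau + h + h, q))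
  + (kappa (tau + h + h, q) - kappa (tau + h, q) - (kappa (tau + h, q) - kappa (tau, q)))
  + (kappa (tau + h, q) - kappa (tau, q) - (kappa (tau + h, p1) - kappa (tau, p1)))
  + (kappa (tau + h, q) - kappa (tau, q) - (kappa (tau + h, p1) - kappa (tau, p1)))
  + (kappa (tau, q) - kappa (tau, p1) - (kappa (tau, p1) - kappa (tau, p0))) by ring.
have tri (x1 x2 x3 x4 : R) : `|x1 + x2 + x3 + x3 + x4| <= `|x1| + `|x2| + 2 * `|x3| + `|x4|.
  have := ler_normD (x1 + x2 + x3 + x3) x4; have := ler_normD (x1 + x2 + x3) x3.
  by have := ler_normD (x1 + x2) x3; have := ler_normD x1 x2; lin.
apply: (le_trans (tri _ _ _ _)).
have -> : K * Dp + (K * (3 * CP) + 2 * (K * a) + K * (a * a)) * h * (h * N) =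
  K * Dp + K * h * h * (3 * CP * N) + 2 * (K * h * (a * N * h)) + K * (a * a) * h * (h * N) by ring.
by rewrite lerD ?(le_trans T4)// lerD ?lerD// ler_pM2l.
Qed.

(** The delay-free solution [Z] is restarted from [X s1]; the input of the plant differs from the
    feedback at [X] by [eps * Lam] for the perturbed delay plus the error of [U_near_feedback]. The
    condition on [b] and [rho] keeps both [Z] and the feedback at [Z] in the ball of radius [r]. *)
Lemma nominal_compare (rstar b lam s1 s2 a1 Lam : R) :
  (forall s x0, t0 <= s -> enorm x0 <= rstar -> exists Z, [/\ delay_free_solution f kappa s Z, Z s = x0 &
     forall t, s <= t -> enorm (Z t) <= b * enorm x0 * expR (- lam * (t - s))]) ->
  0 < b -> 0 < lam -> n%:R * rho <= rstar -> (1 + K) * (b * (n%:R * rho)) <= r ->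
  t0 + D <= s1 -> s1 <= s2 -> s2 <= t1 -> `|X s1| <= a1 -> 0 <= Lam ->
  (forall x y : R, s1 - 2 * D - eps <= x -> x <= y -> y <= s2 -> `|U y - U x| <= Lam * (y - x)) ->
  forall t, s1 <= t <= s2 -> `|X t| <= b * (n%:R * a1) * expR (- lam * (t - s1)) +
    2 * expR (2 * (L * (1 + K)) * (s2 - s1)) *
     (L * (1 + K * (E * E * L * D)) * (eps * Lam) * (s2 - s1)).
Proof.
move=> NOM b0 lam0 nr bnr ts1 s12 s2t Xs1 Lam0 UL t hts.
have r1 : r <= 1 by case/andP: r0_1.
have hs1 : t0 <= s1 <= t1 by move: D0; lra.
have n0 : 0 <= n%:R :> R by [].
have en1 : enorm (X s1) <= n%:R * `|X s1| by exact: enorm_le.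
have t0s1 : t0 <= s1 by case/andP: hs1.
have [|Z [[Zc Zd] Zs1 Zb]] := NOM s1 (X s1) t0s1.
  by apply: (le_trans en1); apply: le_trans nr; rewrite ler_wpM2l// (orb_Xr orb).
have Zle (c : R) : `|X s1| <= c -> forall x, s1 <= x -> `|Z x| <= b * (n%:R * c) * expR (- lam * (x - s1)).
  move=> hc x sx; apply: le_trans (norm_le_enorm _) _; apply: (le_trans (Zb x sx)).
  rewrite ler_wpM2r ?expR_ge0// ler_pM2l// (le_trans en1)// ler_wpM2l//.
have K00 := ltW K0; have L00 := ltW L0; have D00 := ltW D0.
have bnr0 : 0 <= b * (n%:R * rho) by rewrite !mulr_ge0// ltW.
have Zr x : s1 <= x -> (1 + K) * `|Z x| <= r.
  move=> sx; apply: le_trans bnr; rewrite ler_pM2l; last by move: K00; lin.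
  apply: (le_trans (Zle rho (orb_Xr orb hs1) x sx)).
  rewrite ler_piMr// -[leRHS]expR0 ler_expR mulNr oppr_le0 mulr_ge0 ?subr_ge0// ltW//.
have LK0 : 0 < L * (1 + K) by rewrite mulr_gt0//; move: K00; lin.
have eL : 0 <= eps * Lam by rewrite mulr_ge0// ltW.
have E0 : 0 <= E by have := gain_ge2; lin.
set M := E * E * L * D; have M0 : 0 <= M by rewrite /M !mulr_ge0.
have yb : `|X t - Z t| <= 2 * expR (2 * (L * (1 + K)) * (s2 - s1)) *
     (L * (1 + K * M) * (eps * Lam) * (s2 - s1)).
  have := @gronwall R n (fun s => X s - Z s) (fun s => f (X s, U (sg s)) - f (Z s, kappa (s, Z s)))
    (fun s => L * (1 + K * M) * (eps * Lam) * (s - s1)) (fun=> L * (1 + K * M) * (eps * Lam))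
    (L * (1 + K)) s1 s2 LK0 s12.
  rewrite Zs1 !subrr normr0 mulr0 subr0 add0r; apply => //.
  - apply: withinB; first exact: within_itvS (orb_Xc orb).
    by apply: continuous_subspaceW Zc => x /=; rewrite !in_itv/= andbT => /andP[].
  - exact: within_lin.
  - move=> s hs; apply: is_deriveB; first by apply: (orb_Xd orb); move: hs D0 s2t ts1; lin.
    by apply: Zd; case/andP: hs.
  - by move=> s _; exact: is_derive_lin.
  - by move=> s _; rewrite mulr_ge0// mulr_ge0// addr_ge0// mulr_ge0.
  - move=> s hs; have hs0 : t0 <= s <= t1 by move: hs D0 s2t ts1; lin.
    have s1s : s1 <= s by move: hs; lin.
    have t0s : t0 <= s by case/andP: hs0.
    have Zr1 := Zr _ s1s; have Zn := normr_ge0 (Z s).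
    have KZ : 0 <= K * `|Z s| by rewrite mulr_ge0.
    have Zsr : `|Z s| <= r by move: KZ Zr1; lin.
    have Zs1' := le_trans Zsr r1.
    have kZ : `|kappa (s, Z s)| <= r by apply: (le_trans (kappa_bound t0s Zs1')); move: Zn Zr1; lin.
    apply: le_trans (@fL _ _ _ _ (X_r hs0) Zsr (U_r (sg_t1 hs0)) kZ) _.
    have h1 : `|U (sg s) - U (s - D)| <= eps * Lam.
      have sge := orb_sD orb hs0; have sgl := sge; rewrite ler_norml in sgl.
      have a1' : s1 - 2 * D - eps <= s - D <= s2 by move: hs e0 D0; lin.
      have a2' : s1 - 2 * D - eps <= sg s <= s2 by move: hs e0 D0 eD sgl; lin.
      have hh := abs_lip UL a1' a2'.
      apply: (le_trans hh); rewrite mulrC; exact: ler_wpM2r.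
    have h2 : `|U (s - D) - kappa (s, X s)| <= K * M * (eps * Lam).
      rewrite -mulrA; apply: U_near_feedback => //; [by move: hs ts1; lin|by case/andP: hs0|].
      by move=> x y hx xy hy; apply: UL => //; move: hs hx hy; lin.
    have [_ k1 _ _ _] := kT.
    have h3 := k1 s (Z s) (X s) t0s Zs1' (le_trans (X_r hs0) r1).
    have h4 : `|U (sg s) - kappa (s, Z s)| <= eps * Lam + K * M * (eps * Lam) + K * `|X s - Z s|.
      rewrite -(subrKA (kappa (s, X s))) (le_trans (ler_normD _ _))// lerD//.
      by rewrite -(subrKA (U (s - D))) (le_trans (ler_normD _ _))// lerD.
    have -> : L * (1 + K) * `|X s - Z s| + L * (1 + K * M) * (eps * Lam) =
      L * (`|X s - Z s| + (eps * Lam + K * M * (eps * Lam) + K * `|X s - Z s|)) by ring.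
    by rewrite ler_pM2l// lerD2l.
have -> : X t = Z t + (X t - Z t) by rewrite addrC subrK.
apply: (le_trans (ler_normD _ _)); apply: lerD yb; apply: Zle => //.
by case/andP: hts.
Qed.

End OneTrajectory.

Ltac keep H ::=
  lazymatch constr:((D0, r0_1, L0, K0, f00, fL, fL2, kT, rho0, rhor)) with
  | context [H] => idtac
  end.

(** Here and in the next two lemmas the constant is named before the trajectory, hence is uniform in
    [eps], [t1] and the position of the window. *)
Lemma growth (H : R) : 0 <= H -> exists2 C, 1 <= C &
  forall eps t1 rb X U P sg, 0 < eps <= D -> trajectory eps t1 rb X U P sg ->
  forall s t a, t0 <= s -> s <= t -> t <= t1 -> t <= s + H -> 0 <= a ->
    bnd_on rb X U s s a -> bnd_on rb X U s t (C * a).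
Proof.
move=> H0; pose B := 1 + K * E.
exists (2 * B * (1 + L * H + L * D) * expR (6 * L * B * H)).
  have KE : 0 < K * E by rewrite mulr_gt0//; have := gain_ge2; lra.
  have LH : 0 <= L * H by rewrite mulr_ge0// ltW.
  have LD : 0 <= L * D by rewrite mulr_ge0// ltW.
  have B1 : 1 <= B by rewrite /B; lra.
  have LB : 0 <= 6 * L * B by rewrite !mulr_ge0 ?(ltW L0)//; lra.
  have e1 : 1 <= expR (6 * L * B * H) by rewrite -[leLHS]expR0 ler_expR mulr_ge0.
  have b1 : 1 <= 2 * B * (1 + L * H + L * D).
    by rewrite -[leLHS]mulr1 ler_pM//; lra.
  by rewrite -[leLHS]mulr1 ler_pM.
move=> eps t1 rb X U P sg eD orb s t a *.
exact: (growth_aux eD orb).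
Qed.

Lemma second_diff_bound : exists2 C, 0 < C &
  forall eps t1 rb X U P sg, 0 < eps <= D -> trajectory eps t1 rb X U P sg ->
  forall t h N w, t0 <= t -> 0 <= h -> h + h <= D -> t + h + h <= t1 ->
  N <= 1 -> bnd_on rb X U t (t + h + h) N ->
  (forall s, t <= s <= t + h -> `|U (sg (s + h)) - U (sg s)| <= w) ->
  (forall s, t - D <= s <= t - D + h -> `|U (s + h) - U s| <= w) ->
  `|U (t + h + h) - U (t + h) - (U (t + h) - U t)| <= C * h * (h * N + w).
Proof.
have E2 := gain_ge2; have CP2 := CP_ge2; have L00 := ltW L0; have K00 := ltW K0.
have D00 := ltW D0.
pose CQ := CP; rewrite -/CQ in CP2.
pose c1 := E * (L * (CQ + 3)); pose cP := L * (CQ + 1); pose cU := K * (c1 + cP + CQ).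
pose cp := c1 + cP.
have c10 : 0 <= c1 by rewrite /c1 mulr_ge0 ?mulr_ge0 //; lra.
have cP0 : 0 <= cP by rewrite /cP mulr_ge0//; lra.
have cU0 : 0 <= cU by rewrite /cU mulr_ge0//; lra.
have cp0 : 0 <= cp by rewrite /cp addr_ge0.
pose A := E * (2 * L * L + 3 * (L * c1) + L * cP + L * D * (c1 * c1) + 2 * L) +
     2 * (L * c1) + L * (cP + cU).
pose B := K * (3 * CQ) + 2 * (K * cp) + K * (cp * cp).
have E0 : 0 <= E by lra.
have CP0 : 0 <= CQ by lra.
have A0 : 0 <= A by rewrite /A !(addr_ge0, mulr_ge0).
have B0 : 0 <= B by rewrite /B !(addr_ge0, mulr_ge0).
exists (K * A + B + 1); first by rewrite ltr_wpDl// addr_ge0// mulr_ge0.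
move=> eps t1 rb X U P sg eD orb t h N w tt h0 hD ht N1 bd wX wU.
have N0 : 0 <= N.
  have tth : t <= t <= t + h + h by move: h0; lin.
  by case: bd => /(_ t tth) hX _; apply: le_trans hX.
have w0 : 0 <= w.
  have tth : t <= t <= t + h by move: h0; lin.
  exact: le_trans (wX t tth).
have H1 := p_second_diff eD orb tt h0 hD ht N1 bd wX wU.
have H2 := U_second_diff eD orb tt h0 hD ht N1 bd H1.
apply: (le_trans H2); rewrite -/CQ -/c1 -/cP -/cU -/cp -/A -/B -subr_ge0.
have -> : (K * A + B + 1) * h * (h * N + w) - (K * (A * h * (h * N + w)) + B * h * (h * N)) =
  B * h * w + h * (h * N + w) by ring.
by rewrite !(addr_ge0, mulr_ge0).
Qed.

Lemma U_lip_bound : exists2 C, 0 < C &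
  forall eps t1 rb X U P sg, 0 < eps <= D -> trajectory eps t1 rb X U P sg ->
  forall s t N, t0 <= s -> t <= t1 -> bnd_on rb X U s t N ->
  forall x y : R, s <= x -> x <= y -> y <= t -> `|U y - U x| <= C * N * (y - x).
Proof.
have E2 := gain_ge2; have CP2 := CP_ge2; have L00 := ltW L0; have K00 := ltW K0.
have CP0 : 0 <= E * (1 + L * D) by lra.
exists (K * (E * (L * (E * (1 + L * D) + 3)) + L * (E * (1 + L * D) + 1) + E * (1 + L * D)) + 2 / D).
  rewrite ltr_wpDl ?divr_gt0// mulr_ge0// addr_ge0// addr_ge0// mulr_ge0 ?mulr_ge0//; lra.
move=> eps t1 rb X U P sg eD orb s t N ts tt bd x y sx xy yt.
exact: (U_lip eD orb ts tt bd sx xy yt).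
Qed.

(** By time [s + 4 * D] the input is feedback and has a Lipschitz constant proportional to [a] over
    the whole past that matters. From there the plant follows the delay-free system for long enough
    to shrink, and [U_small] transfers the decay from state to input. *)
Lemma decay (rstar b lam : R) :
  (forall s x0, t0 <= s -> enorm x0 <= rstar -> exists Z, [/\ delay_free_solution f kappa s Z, Z s = x0 &
     forall t, s <= t -> enorm (Z t) <= b * enorm x0 * expR (- lam * (t - s))]) ->
  0 < b -> 0 < lam -> n%:R * rho <= rstar -> (1 + K) * (b * (n%:R * rho)) <= r ->
  exists Q eps0, [/\ 8 * D <= Q, 0 < eps0 <= D &
   forall eps t1 rb X U P sg, 0 < eps -> eps <= eps0 -> trajectory eps t1 rb X U P sg ->
   forall s a, t0 <= s -> s + Q <= t1 -> 0 <= a ->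
    bnd_on rb X U s s a -> bnd_on rb X U (s + Q) (s + Q) (a / 2)].
Proof.
move=> NOM b0 lam0 nr bnr.
have D00 := ltW D0; have L00 := ltW L0; have K00 := ltW K0.
have E2 := gain_ge2; have E0 : 0 <= E by lra.
have [|C1 C11 G1] := @growth (4 * D); first by rewrite mulr_ge0.
have [CL CL0 UL] := U_lip_bound.
pose M := E * E * L * D; have M0 : 0 <= M by rewrite /M !mulr_ge0.
pose F := 2 * expR (2 * (L * (1 + K)) * D).
have F0 : 0 <= F by rewrite /F mulr_ge0 ?expR_ge0.
pose B0 := 1 + K * F; have B01 : 1 <= B0 by rewrite lerDl mulr_ge0.
have B00 : 0 <= B0 by lra.
(* The factor in front of the exponential in the final bound. It comes from the growth over [4 * D]
   only, so that [Q] can be defined from it. *)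
pose A := B0 * (b * (n%:R * C1)).
have A0 : 0 <= A by rewrite /A !mulr_ge0// ?(ltW b0)//; move: C11; lin.
(* The comparison starts at [s + 4 * D], and smallness is needed on the last [2 * D] before [s + Q].
   This leaves at least [2 * D + 4 * A / lam] for the decay, enough for
   [A * expR (- lam * _) <= 1 / 4] by [1 + x <= expR x]. *)
pose Q := 8 * D + 4 * A / lam.
have QD : 8 * D <= Q by rewrite /Q lerDl divr_ge0 ?(ltW lam0)// mulr_ge0.
have Q0 : 0 <= Q by move: QD D00; lin.
have [C2 C21 G2] := @growth Q Q0.
pose G := 2 * expR (2 * (L * (1 + K)) * Q) * (L * (1 + K * M) * Q).
have G0 : 0 <= G by rewrite /G !mulr_ge0 ?expR_ge0// addr_ge0// mulr_ge0.
pose J := L * (K * M) * D.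
have J0 : 0 <= J by rewrite /J !mulr_ge0.
pose W := B0 * (G + J) * (CL * C2).
have C20 : 0 <= C2 by move: C21; lin.
have W0 : 0 <= W by rewrite /W mulr_ge0//; [rewrite mulr_ge0// addr_ge0|rewrite mulr_ge0// ltW].
(* [W] collects the perturbation terms and depends on [Q], so the size of the perturbation is chosen
   last; it makes [W * eps] at most a quarter. *)
pose eps0 := Num.min D (4 * W + 1)^-1.
have W1 : 0 < 4 * W + 1 by move: W0; lin.
exists Q, eps0; split => //.
  by rewrite lt_min D0 invr_gt0 W1 /= ge_min lexx.
move=> eps t1 rb X U P sg e0; rewrite le_min => /andP[eD' eW] orb s a ts sQ a0 bd.
have eD : 0 < eps <= D by rewrite e0.
have s4 : s <= s + 4 * D by move: D00; lin.
have sQ' : s <= s + Q by move: QD D00; lin.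
have s4t : s + 4 * D <= t1 by move: sQ QD D00; lin.
have bd4 := G1 _ _ _ _ _ _ _ eD orb s (s + 4 * D) a ts s4 s4t (lexx _) a0 bd.
have bdQ := G2 _ _ _ _ _ _ _ eD orb s (s + Q) a ts sQ' sQ (lexx _) a0 bd.
pose Lam := CL * (C2 * a).
have Lam0 : 0 <= Lam by rewrite /Lam !mulr_ge0 ?(ltW CL0)//; lra.
have ULip : forall x y : R, s <= x -> x <= y -> y <= s + Q -> `|U y - U x| <= Lam * (y - x).
  exact: UL eD orb s (s + Q) _ ts sQ bdQ.
have Xs1 : `|X (s + 4 * D)| <= C1 * a by case: bd4 => + _; apply; rewrite s4 lexx.
have ts1 : t0 + D <= s + 4 * D by move: ts D00; lin.
have s12 : s + 4 * D <= s + Q by move: QD D00; lin.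
have ULip1 x y : s + 4 * D - 2 * D - eps <= x -> x <= y -> y <= s + Q -> `|U y - U x| <= Lam * (y - x).
  by move=> hx xy hy; apply: ULip => //; move: hx eD' D00; lin.
have NC := nominal_compare eD orb NOM b0 lam0 nr bnr ts1 s12 sQ Xs1 Lam0 ULip1.
rewrite -/M in NC.
have eL0 : 0 <= eps * Lam by rewrite mulr_ge0// ltW.
have Xq q : s + 6 * D + 4 * A / lam <= q <= s + Q ->
    `|X q| <= b * (n%:R * (C1 * a)) * expR (- lam * (2 * D + 4 * A / lam)) + G * (eps * Lam).
  move=> hq; have hq' : s + 4 * D <= q <= s + Q.
    have : 0 <= 4 * A / lam by rewrite divr_ge0 ?(ltW lam0)// mulr_ge0.
    by move: hq D00; lin.
  apply: (le_trans (NC q hq')); apply: lerD.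
    apply: ler_wpM2l; first by rewrite !mulr_ge0// ?(ltW b0)//; move: C11; lin.
    by rewrite ler_expR !mulNr lerN2 ler_pM2l//; move: hq; lin.
  have -> : G * (eps * Lam) = 2 * expR (2 * (L * (1 + K)) * Q) *
    (L * (1 + K * M) * (eps * Lam) * Q) by rewrite /G; ring.
  have KM1 : 0 <= 1 + K * M by rewrite addr_ge0// mulr_ge0.
  have sQ4 : s + Q - (s + 4 * D) <= Q by move: D00; lin.
  have sQ40 : 0 <= s + Q - (s + 4 * D) by move: QD D00; lin.
  apply: ler_pM.
  - by rewrite mulr_ge0 ?expR_ge0.
  - by rewrite mulr_ge0// mulr_ge0// mulr_ge0.
  - by rewrite ler_pM2l// ler_expR ler_wpM2l// !mulr_ge0// addr_ge0.
  - by apply: ler_wpM2l => //; rewrite mulr_ge0// mulr_ge0.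
have key q : s + 6 * D + 4 * A / lam <= q <= s + Q -> `|X q| <= a / 2 /\ `|U q| <= a / 2.
  move=> hq; have Xb := Xq q hq.
  have hq' : s + 6 * D <= q <= s + Q.
    have : 0 <= 4 * A / lam by rewrite divr_ge0 ?(ltW lam0)// mulr_ge0.
    by move: hq; lin.
  have qD : t0 <= q - D by move: hq' ts D00; lin.
  have qt : q <= t1 by move: hq' sQ; lin.
  have Ub := U_small eD orb qD qt Lam0.
  have {}Ub : `|U q| <= K * (F * (`|X q| + J * (eps * Lam))).
    have -> : J * (eps * Lam) = L * (K * (M * (eps * Lam))) * D by rewrite /J; ring.
    by apply: Ub => x y hx xy hy; apply: ULip => //; move: hx hy hq' eD; lin.
  set S := `|X q| + J * (eps * Lam) in Ub.
  have S0 : 0 <= S by rewrite addr_ge0// mulr_ge0.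
  have XS : `|X q| <= S by rewrite lerDl mulr_ge0.
  have BS : B0 * S <= a / 2.
    have e1 : S <= b * (n%:R * (C1 * a)) * expR (- lam * (2 * D + 4 * A / lam)) + (G + J) * (eps * Lam).
      by rewrite [(G + J) * _]mulrDl addrA lerD2r.
    apply: (le_trans (ler_wpM2l B00 e1)).
    have -> : B0 * (b * (n%:R * (C1 * a)) * expR (- lam * (2 * D + 4 * A / lam)) + (G + J) * (eps * Lam)) =
      A * expR (- lam * (2 * D + 4 * A / lam)) * a + W * eps * a by rewrite /A /W /Lam; ring.
    have h1 : A * expR (- lam * (2 * D + 4 * A / lam)) <= 1 / 4.
      have lA : lam * (2 * D + 4 * A / lam) = 2 * (lam * D) + 4 * A by field; rewrite lt0r_neq0.
      have ex : 1 + 4 * A <= expR (lam * (2 * D + 4 * A / lam)).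
        apply: le_trans (expR_ge1Dx _); rewrite lA lerD2l lerDr.
        by rewrite !mulr_ge0// ltW.
      rewrite mulNr expRN ler_pdivrMr ?expR_gt0//; move: ex; lin.
    have h2 : W * eps <= 1 / 4.
      apply: (@le_trans _ _ (W * (4 * W + 1)^-1)); first by rewrite ler_wpM2l.
      by rewrite ler_pdivrMr//; lin.
    have := ler_wpM2r a0 h1; have := ler_wpM2r a0 h2; lin.
  have SB : B0 * S = S + K * F * S by rewrite /B0; ring.
  have KFS : 0 <= K * F * S by rewrite !mulr_ge0.
  split; first by move: KFS SB BS XS; lin.
  by apply: (le_trans Ub); rewrite mulrA; move: SB BS S0; lin.
split=> [x hx|x rx hx].
  have hx' : s + 6 * D + 4 * A / lam <= x <= s + Q by move: hx D0; rewrite /Q; lin.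
  by case: (key x hx').
have hx' : s + 6 * D + 4 * A / lam <= x <= s + Q by move: hx D0; rewrite /Q; lin.
by case: (key x hx').
Qed.

End Trajectories.

(** * Square integrable derivatives *)

Section L2.
Variable R : realType.
Local Notation mu := (@lebesgue_measure R).
Implicit Types (a b x y : R) (f g : R -> R).

Lemma mu_cc a b : a <= b -> mu `[a, b] = (b - a)%:E.
Proof.
rewrite le_eqVlt lebesgue_measure_itv/= lte_fin => /predU1P[->|->//].
by rewrite ltxx subrr.
Qed.

Lemma cst_integrable a b (c : R) : mu.-integrable `[a, b] (EFin \o (fun=> c)).
Proof.
by apply: continuous_compact_integrable; [exact: segment_compact|exact: within_cst].
Qed.

Lemma Rintegral_cst_itv a b (c : R) : a <= b -> \int[mu]_(s in `[a, b]) c = c * (b - a).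
Proof. by move=> ab; rewrite Rintegral_cst//= mu_cc. Qed.

(** On a bounded set [|g|] is dominated by the integrable function [1 + g ^ 2]. *)
Lemma sq_integrable (A : set R) g a b : measurable A -> A `<=` `[a, b] ->
  measurable_fun A g -> mu.-integrable A (EFin \o (fun s => g s ^+ 2)) ->
  mu.-integrable A (EFin \o g).
Proof.
move=> mA Aab mg ig.
have i1 : mu.-integrable A (EFin \o (fun _ : R => 1 : R)).
  exact: integrableS (cst_integrable a b 1).
have i2 : mu.-integrable A (EFin \o (fun s : R => 1 + g s ^+ 2)).
  exact: (integrableD _ i1 ig).
apply: le_integrable i2 => //.
- exact/measurable_EFinP.
- move=> s _; rewrite /= lee_fin [leRHS]ger0_norm; last by rewrite addr_ge0// sqr_ge0.
  have : 0 <= (`|g s| - 1) ^+ 2 by exact: sqr_ge0.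
  rewrite sqrrB expr1n mulr1 real_normK ?num_real//; have := normr_ge0 (g s); lra.
Qed.

(** Integrate [0 <= (g - c) ^ 2], with [c] the mean of [g]. *)
Lemma CS x y g : x <= y -> measurable_fun `[x, y] g ->
  mu.-integrable `[x, y] (EFin \o (fun s => g s ^+ 2)) ->
  (\int[mu]_(s in `[x, y]) g s) ^+ 2 <= (y - x) * \int[mu]_(s in `[x, y]) (g s ^+ 2).
Proof.
rewrite le_eqVlt => /predU1P[<- _ _|xy mg ig].
  by rewrite set_itv1 !Rintegral_set1 subrr mul0r expr0n.
have ig1 : mu.-integrable `[x, y] (EFin \o g) by exact: (sq_integrable (a := x) (b := y)).
set I := \int[mu]_(s in `[x, y]) g s.
have yx : 0 < y - x by rewrite subr_gt0.
pose c := I / (y - x).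
have : \int[mu]_(s in `[x, y]) (2 * c * g s) <= \int[mu]_(s in `[x, y]) (g s ^+ 2 + c ^+ 2).
  apply: le_Rintegral => //.
  - exact: (integrableZl _ _ ig1).
  - exact: (integrableD _ ig (cst_integrable x y (c ^+ 2))).
  - move=> s _; have : 0 <= (g s - c) ^+ 2 by exact: sqr_ge0.
    by rewrite sqrrB; lra.
rewrite RintegralZl// RintegralD//; last exact: cst_integrable.
rewrite Rintegral_cst_itv ?(ltW xy)// -/I.
have -> : 2 * c * I = 2 * (I ^+ 2 / (y - x)) by rewrite /c; ring.
have -> : c ^+ 2 * (y - x) = I ^+ 2 / (y - x) by rewrite /c; field; rewrite gt_eqF.
have : I ^+ 2 / (y - x) <= \int[mu]_(s in `[x, y]) (g s ^+ 2) ->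
  I ^+ 2 <= (y - x) * \int[mu]_(s in `[x, y]) (g s ^+ 2).
  by rewrite ler_pdivrMr// mulrC.
by move=> H h; apply: H; lra.
Qed.

Lemma Rint_split a b c f : a <= b -> b <= c -> mu.-integrable `[a, c] (EFin \o f) ->
  \int[mu]_(s in `[a, c]) f s = \int[mu]_(s in `[a, b]) f s + \int[mu]_(s in `[b, c]) f s.
Proof.
move=> ab bc ic; have := @Rintegral_itvB R f (BLeft a) (BRight c) b ic.
rewrite !bnd_simp => /(_ ab bc) /(canRL (subrK _)) ->; rewrite addrC; congr (_ + _).
apply: Rintegral_itv_obnd_cbnd; apply: integrableS ic => // s /=.
by rewrite !in_itv/= => /andP[/ltW h ->]; rewrite (le_trans ab).
Qed.

Lemma integrable_itvS a b c d f : a <= c -> d <= b -> mu.-integrable `[a, b] (EFin \o f) ->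
  mu.-integrable `[c, d] (EFin \o f).
Proof.
move=> ac db; apply: integrableS => // s /=; rewrite !in_itv/= => /andP[cs sd].
by rewrite (le_trans ac)// (le_trans sd).
Qed.

Lemma Rint_ge0 a b f : (forall s, 0 <= f s) -> 0 <= \int[mu]_(s in `[a, b]) f s.
Proof. by move=> f0; apply: Rintegral_ge0 => s _. Qed.

Lemma Rint_subset a b c d f : a <= c -> c <= d -> d <= b ->
  mu.-integrable `[a, b] (EFin \o f) -> (forall s, 0 <= f s) ->
  \int[mu]_(s in `[c, d]) f s <= \int[mu]_(s in `[a, b]) f s.
Proof.
move=> ac cd db iab f0; rewrite (Rint_split ac (le_trans cd db) iab).
have icb : mu.-integrable `[c, b] (EFin \o f) by exact: integrable_itvS iab.
rewrite (Rint_split cd db icb); have := Rint_ge0 a c f0; have := Rint_ge0 d b f0; lra.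
Qed.

(** The derivative is a separate argument, any function of which [g] is a primitive, so that
    primitives of a given function are covered without computing their derivative. *)
Record acL2 a b g (g' : R -> R) : Prop := AcL2 {
  ac_m : measurable_fun `[a, b] g';
  ac_i : mu.-integrable `[a, b] (EFin \o (fun s => g' s ^+ 2));
  ac_ftc : forall x y, a <= x -> x <= y -> y <= b ->
    g y - g x = \int[mu]_(s in `[x, y]) g' s }.

Lemma acL2_sub a b c d g g' : a <= c -> d <= b -> acL2 a b g g' -> acL2 c d g g'.
Proof.
move=> ac db [m i ftc]; split.
- apply: measurable_funS m => // s /=; rewrite !in_itv/= => /andP[cs sd].
  by rewrite (le_trans ac)// (le_trans sd).
- exact: integrable_itvS i.
- by move=> x y cx xy yd; apply: ftc => //; [exact: le_trans cx|exact: le_trans db].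
Qed.

Lemma acL2_int a b g g' : acL2 a b g g' -> mu.-integrable `[a, b] (EFin \o g').
Proof. by move=> [m i _]; exact: (sq_integrable (a := a) (b := b)). Qed.

Lemma acL2_holder a b g g' x y : acL2 a b g g' -> a <= x -> x <= y -> y <= b ->
  (g y - g x) ^+ 2 <= (y - x) * \int[mu]_(s in `[x, y]) (g' s ^+ 2).
Proof.
move=> ac ax xy yb; have [m i ftc] := acL2_sub ax yb ac.
by rewrite ftc//; exact: CS.
Qed.

Lemma acL2_continuous a b g g' : a <= b -> acL2 a b g g' -> {within `[a, b], continuous g}.
Proof.
move=> ab ac; have ig := acL2_int ac.
have c1 := parameterized_integral_continuous ab ig.
have c2 : {within `[a, b], continuous (fun x => g a + parameterized_integral mu a x g')}.
  by apply: withinD => //; exact: within_cst.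
apply/subspace_continuousP => x xab; have xab' := xab; rewrite /= in_itv/= in xab'.
have gE y : a <= y <= b -> g a + parameterized_integral mu a y g' = g y.
  move=> /andP[ay yb]; have [_ _ ftc] := ac.
  by rewrite /parameterized_integral -ftc// addrC subrK.
have := (subspace_continuousP _ _).1 c2 x xab; rewrite /from_subspace (gE x xab').
apply: cvg_trans => P; rewrite /nbhs/= /within/=.
by apply: filterS => y + yab => /(_ yab); rewrite gE.
Qed.

Lemma integral_continuous a b f : a <= b -> mu.-integrable `[a, b] (EFin \o f) ->
  {within `[a, b], continuous (fun x => \int[mu]_(s in `[a, x]) f s)}.
Proof. exact: parameterized_integral_continuous. Qed.

Lemma primitive_is_derive a b g g' x : acL2 a b g g' -> a < x < b ->
  {within `[a, b], continuous g'} -> is_derive x 1 g (g' x).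
Proof.
move=> ac /andP[ax xb] gc; have ig := acL2_int ac.
have xab : x \in `]a, b[ by rewrite in_itv/= ax xb.
have [] := @continuous_FTC1_closed R g' a x b xb ig ax
  (within_continuous_continuous (lt_trans ax xb) gc xab).
set F := fun x => _ => dF F'E.
have gE : \forall y \near x, g a + F y = g y.
  have : \forall y \near x, y \in `]a, b[ by exact: near_in_itvoo.
  apply: filterS => y; rewrite in_itv/= => /andP[ay yb]; have [_ _ ftc] := ac.
  by rewrite /F -ftc ?lexx ?ltW// addrCA subrr addr0.
have : is_derive x 1 (fun y => g a + F y) (g' x).
  have := is_deriveD (is_derive_cst (g a) x 1) (DeriveDef dF erefl).
  by rewrite add0r -derive1E F'E.
exact: (near_eq_is_derive gE).
Qed.

Lemma is_derive_eps g x (d : R) : is_derive x 1 g d ->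
  forall e, 0 < e -> exists2 del, 0 < del &
    forall h, `|h| < del -> `|g (x + h) - g x - d * h| <= e * `|h|.
Proof.
move=> [gd gE] e e0.
have : h^-1 *: ((g \o shift x) (h *: 1) - g x) @[h --> (0 : R)^'] --> d.
  by rewrite -gE; move/cvg_ex : gd => [l gl]; rewrite /derive (cvg_lim _ gl).
move=> /cvgrPdist_le /(_ e e0); rewrite /dnbhs near_withinE => /nbhs_ballP[del /= del0 H].
exists del => // h hd; have [->|h0] := eqVneq h 0.
  by rewrite addr0 subrr mulr0 subr0 normr0 mulr0.
have := H h; rewrite /ball/= sub0r normrN => /(_ hd h0).
rewrite /= [h *: 1]mulr1 [h + x]addrC distrC => le.
have -> : g (x + h) - g x - d * h = (h^-1 *: (g (x + h) - g x) - d) * h.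
  by rewrite /GRing.scale/=; field.
by rewrite normrM ler_wpM2r.
Qed.

Lemma is_derive_le_lip g x (d c e : R) : is_derive x 1 g d -> 0 < e ->
  (forall h, 0 < h -> h < e -> `|g (x + h) - g x| <= c * h) -> `|d| <= c.
Proof.
move=> gd e0 lip; rewrite leNgt; apply/negP => cd.
have eps0 : 0 < (`|d| - c) / 2 by lra.
have [del del0 H] := is_derive_eps gd eps0.
pose h := Num.min (del / 2) (e / 2).
have h0 : 0 < h by rewrite lt_min !divr_gt0.
have hd : h <= del / 2 by rewrite ge_min lexx.
have he : h <= e / 2 by rewrite ge_min lexx orbT.
have h1 : `|h| < del by rewrite gtr0_norm//; lra.
have h2 : h < e by lra.
have := H h h1; have := lip h h0 h2; rewrite (gtr0_norm h0) => b1 b2.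
have : `|d * h| <= `|g (x + h) - g x| + `|g (x + h) - g x - d * h|.
  have {1}-> : d * h = (g (x + h) - g x) - (g (x + h) - g x - d * h) by ring.
  exact: ler_normB.
rewrite normrM (gtr0_norm h0) => b3.
have : `|d| * h <= (c + (`|d| - c) / 2) * h by lra.
rewrite ler_pM2r//; lra.
Qed.

(** [g'] is differentiable at the single point [x]. The mean value theorem for
    [s |-> g (s + h) - g s] turns the quotient into a difference of [g'] at [c] and [c + h], both
    compared with [x]; the errors [e / 3 * (c - x)] and [e / 3 * (c + h - x)] add up to at most
    [e * h], as [c] is within [h] of [x]. *)
Lemma second_quotient g (g' : R -> R) x (w e0 : R) : 0 < e0 ->
  (forall y, `|y - x| < e0 -> is_derive y 1 g (g' y)) -> is_derive x 1 g' w ->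
  forall e : R, 0 < e -> exists2 del : R, 0 < del &
    forall h : R, 0 < h -> h < del ->
      `|(g (x + h + h) - g (x + h) - (g (x + h) - g x)) / (h * h) - w| <= e.
Proof.
move=> e00 gd g'd e e_0.
have e3 : 0 < e / 3 by rewrite divr_gt0.
have [del del0 H] := is_derive_eps g'd e3.
exists (Num.min (del / 2) (e0 / 2)) => [|h h0]; first by rewrite lt_min !divr_gt0.
rewrite lt_min => /andP[hd he].
have xh : x < x + h by rewrite ltrDl.
have dphi s : s \in `]x, x + h[ -> is_derive s 1 (fun s => g (s + h) - g s) (g' (s + h) - g' s).
  rewrite in_itv/= => hs.
  have d1 : is_derive (s + h) 1 g (g' (s + h)) by apply: gd; rewrite ltr_norml; lra.
  have d2 : is_derive s 1 g (g' s) by apply: gd; rewrite ltr_norml; lra.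
  exact: (is_deriveB (is_derive_translate d1) d2).
have cphi : {within `[x, x + h], continuous (fun s => g (s + h) - g s)}.
  apply: derivable_within_continuous => s; rewrite in_itv/= => hs.
  have d1 : is_derive (s + h) 1 g (g' (s + h)) by apply: gd; rewrite ltr_norml; lra.
  have d2 : is_derive s 1 g (g' s) by apply: gd; rewrite ltr_norml; lra.
  by case: (is_deriveB (is_derive_translate d1) d2).
have [c + ->] := MVT xh dphi cphi.
rewrite in_itv/= => hc.
have -> : x + h - x = h by rewrite addrC addKr.
have -> : (g' (c + h) - g' c) * h / (h * h) - w = (g' (c + h) - g' c - w * h) / h.
  by field; rewrite gt_eqF.
rewrite normrM normfV (gtr0_norm h0) ler_pdivrMr//.
have cx0 : 0 < c - x by lra.
have chx0 : 0 < c + h - x by lra.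
have := H (c + h - x); have := H (c - x).
rewrite (gtr0_norm cx0) (gtr0_norm chx0).
have -> : x + (c - x) = c by ring.
have -> : x + (c + h - x) = c + h by ring.
move=> b1 b2.
have {}b1 : `|g' c - g' x - w * (c - x)| <= e / 3 * (c - x) by apply: b1; lra.
have {}b2 : `|g' (c + h) - g' x - w * (c + h - x)| <= e / 3 * (c + h - x) by apply: b2; lra.
have -> : g' (c + h) - g' c - w * h =
  (g' (c + h) - g' x - w * (c + h - x)) - (g' c - g' x - w * (c - x)) by ring.
apply: (le_trans (ler_normB _ _)).
have : e / 3 * (c - x) <= e / 3 * h by rewrite ler_pM2l//; lra.
have : e / 3 * (c + h - x) <= e / 3 * (h + h) by rewrite ler_pM2l//; lra.
lra.
Qed.

Lemma acL2_lip a b g g' (c : R) : a <= b -> 0 <= c -> acL2 a b g g' ->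
  (forall x y, a <= x -> x <= y -> y <= b -> `|g y - g x| <= c * (y - x)) ->
  (forall x, a < x < b -> is_derive x 1 g (g' x)) ->
  \int[mu]_(s in `[a, b]) (g' s ^+ 2) <= c ^+ 2 * (b - a).
Proof.
move=> ab c0 ac lip gd; have [m i _] := ac.
have mo : measurable_fun (`]a, b[ : set R) (EFin \o (fun s => g' s ^+ 2)).
  apply: measurable_funS (measurable_int mu i) => //.
  by apply: subset_itvW.
have mc : measurable_fun (`]a, b[ : set R) (EFin \o (fun=> c ^+ 2)) by exact/measurable_EFinP/measurable_cst.
rewrite -(Rintegral_cst_itv _ ab) /Rintegral.
rewrite (integral_itv_bndoo _ _ mo) (integral_itv_bndoo _ _ mc).
have iS f : mu.-integrable `[a, b] (EFin \o f) -> mu.-integrable `]a, b[ (EFin \o f).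
  by apply: integrableS => //; apply: subset_itvW.
apply: (@le_Rintegral _ _ _ mu `]a, b[ (fun s => g' s ^+ 2) (fun=> c ^+ 2)) => //.
- exact: iS.
- by apply: iS; exact: cst_integrable.
- move=> s /=; rewrite in_itv/= => sab.
  rewrite -(real_normK (num_real (g' s))) lerXn2r ?nnegrE//.
  apply: (@is_derive_le_lip g s (g' s) c (b - s) (gd s sab)); first by lra.
  move=> h h0 hb; have := lip s (s + h).
  have -> : s + h - s = h by rewrite addrC addKr.
  by apply; lra.
Qed.

Lemma acL2_primitive (a b c : R) (g g' : R -> R) : {within `[a, b], continuous g'} ->
  (forall x, a <= x <= b -> g x = c + \int[mu]_(s in `[a, x]) g' s) -> acL2 a b g g'.
Proof.
move=> gc gE.
have ig : mu.-integrable `[a, b] (EFin \o g').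
  by apply: continuous_compact_integrable => //; exact: segment_compact.
split.
- by apply/measurable_EFinP; exact: measurable_int ig.
- apply: continuous_compact_integrable; first exact: segment_compact.
  by apply: (@withinM R _ _ g' g').
- move=> x y ax xy yb; rewrite !gE ?ax ?(le_trans ax)// ?(le_trans xy)//.
  rewrite (@Rint_split a x y)//; last exact: integrable_itvS ig.
  by rewrite opprD addrACA subrr add0r addrC addKr.
Qed.

(** The integral equals that of [m] over [[b, b + eta]] minus that over [[a, a + eta]], and
    monotonicity bounds these by the extreme values. *)
Lemma telescope_int a b (eta : R) (m : R -> R) : a < b -> 0 < eta -> {within `[a, b + eta], continuous m} ->
  (forall x y, a <= x -> x <= y -> y <= b + eta -> m x <= m y) ->
  \int[mu]_(t in `[a, b]) (m (t + eta) - m t) <= eta * (m (b + eta) - m a).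
Proof.
move=> ab e0 mc mm.
have abe : a <= b + eta by lra.
pose M x := \int[mu]_(s in `[a, x]) m s.
have im : mu.-integrable `[a, b + eta] (EFin \o m).
  by apply: continuous_compact_integrable => //; exact: segment_compact.
have Mac : acL2 a (b + eta) M m.
  by apply: (@acL2_primitive _ _ 0) => // x _; rewrite add0r.
have Mc := acL2_continuous abe Mac.
have Md x : a < x < b + eta -> is_derive x 1 M (m x) by move=> hx; exact: primitive_is_derive Mac hx mc.
pose q t := m (t + eta) - m t.
have qc : {within `[a, b], continuous q}.
  apply: withinB; last by apply: within_itvS mc; lra.
  by apply: within_shift; apply: within_itvS mc; lra.
pose G x := \int[mu]_(s in `[a, x]) q s.
have Gac : acL2 a b G q.
  by apply: (@acL2_primitive _ _ 0) => // x _; rewrite add0r.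
have Gc := acL2_continuous (ltW ab) Gac.
have Gd x : a < x < b -> is_derive x 1 G (q x) by move=> hx; exact: primitive_is_derive Gac hx qc.
(* In place of a change of variables: this function of [t] has zero derivative, hence equal values
   at [a] and [b]. *)
have := @mvi_scalar R (fun t => (M (t + eta) - M t) - G t) (cst 0) (fun t => q t - q t) (cst 0) a b
  (ltW ab).
rewrite /cst subrr normr_le0 subr_eq0 => H.
have {H} E : M (b + eta) - M b - G b = M (a + eta) - M a - G a.
  apply/eqP; apply: H.
  - apply: withinB => //; apply: withinB; last by apply: within_itvS Mc; lra.
    by apply: within_shift; apply: within_itvS Mc; lra.
  - exact: within_cst.
  - move=> s hs; apply: is_deriveB; last exact: Gd.
    apply: is_deriveB; last by apply: Md; lra.
    by apply: is_derive_translate; apply: Md; lra.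
  - by move=> s _; rewrite subrr normr0.
have Ga : G a = 0 by rewrite /G set_itv1 Rintegral_set1.
have [_ _ ftc] := Mac.
have be : b <= b + eta by lra.
have ae : a <= a + eta by lra.
have M1 : M (b + eta) - M b <= eta * m (b + eta).
  rewrite ftc ?(ltW ab)//.
  have -> : eta * m (b + eta) = \int[mu]_(s in `[b, b + eta]) m (b + eta).
    by rewrite Rintegral_cst_itv// [b + eta]addrC addrK mulrC.
  apply: le_Rintegral => //; first by apply: integrable_itvS im => //; exact: ltW.
    exact: cst_integrable.
  by move=> s /=; rewrite in_itv/= => /andP[bs sb]; apply: mm => //; lra.
have M2 : eta * m a <= M (a + eta) - M a.
  rewrite ftc ?lexx//; last by lra.
  have -> : eta * m a = \int[mu]_(s in `[a, a + eta]) m a.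
    by rewrite Rintegral_cst_itv// [a + eta]addrC addrK mulrC.
  apply: le_Rintegral => //; first exact: cst_integrable.
    by apply: integrable_itvS im => //; lra.
  by move=> s /=; rewrite in_itv/= => /andP[bs sb]; apply: mm => //; lra.
have -> : \int[mu]_(t in `[a, b]) (m (t + eta) - m t) = G b by [].
rewrite mulrBr; lra.
Qed.

(** Lebesgue differentiation, applied to [W] cut off outside the interval; inside, its primitive
    differs from [V] by a constant. *)
Lemma ae_is_derive a b (V W : R -> R) : measurable_fun (`]a, b[ : set R) W ->
  mu.-integrable `]a, b[ (EFin \o W) ->
  (forall x y, a < x -> x <= y -> y < b -> V y - V x = \int[mu]_(s in `[x, y]) W s) ->
  {ae mu, forall x, `]a, b[%classic x -> is_derive x 1 V (W x)}.
Proof.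
move=> mW iW VW; pose f := W \_ `]a, b[.
have fi : mu.-integrable setT (EFin \o f).
  by move: iW; rewrite integrable_mkcond//= restrict_EFin.
have fis (A : set R) : measurable A -> mu.-integrable A (EFin \o f).
  by move=> mA; exact: integrableS fi.
have lf : locally_integrable setT f by exact: integrable_locally_restrict.
have := @FTC1 R f (BLeft a) (fun y => fis _ (measurable_itv _)) lf.
set F := fun x => _.
have FV x y : a < x -> x <= y -> y < b -> F y - F x = V y - V x.
  move=> ax xy yb; rewrite VW// /F (@Rint_split a x y) ?(ltW ax)//; last exact: fis.
  rewrite addrC addKr; apply: eq_Rintegral => s; rewrite inE/= in_itv/= => /andP[xs sy].
  by rewrite /f patchE mem_set//= in_itv/= (lt_le_trans ax)// (le_lt_trans sy).
apply: filterS; first exact: (ae_filter_ringOfSetsType mu).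
move=> x Fx; rewrite /= in_itv/= => /andP[ax xb].
have [dF F'] := Fx ax.
have VE : \forall y \near x, F y + (V x - F x) = V y.
  have xab : x \in `]a, b[ by rewrite in_itv/= ax.
  have := near_in_itvoo xab; apply: filterS => y; rewrite in_itv/= => /andP[ay yb].
  have [xy|/ltW yx] := leP x y; [have := FV x y ax xy yb|have := FV y x ay yx xb]; lra.
have : is_derive x 1 (fun y => F y + (V x - F x)) (W x).
  have := is_deriveD (DeriveDef dF erefl) (is_derive_cst (V x - F x) x 1).
  by rewrite addr0 -derive1E F' /f patchE mem_set//= in_itv/= ax.
exact: near_eq_is_derive VE.
Qed.

Lemma limn_einf_le (v : (\bar R)^nat) (c : \bar R) :
  (forall k, (v k <= c)%E) -> (limn_einf v <= c)%E.
Proof.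
move=> vc; rewrite limn_einf_lim; apply: lime_le; first exact: is_cvg_einfs.
by apply: nearW => k; apply: le_trans (vc k); apply: ereal_inf_lbound; exists k => /=.
Qed.

(* Fatou's lemma: at almost every point the second difference quotients of [U]
   converge to [W], and the increments of [m] telescope under the integral. *)
Lemma L2_of_second_diff a b b1 (A B h0 : R) (U V W m : R -> R) : a < b -> b < b1 ->
  0 <= A -> 0 <= B -> 0 < h0 ->
  measurable_fun (`]a, b[ : set R) W ->
  mu.-integrable `]a, b[ (fun s => (W s ^+ 2)%:E) ->
  (forall x y, a < x -> x <= y -> y < b -> V y - V x = \int[mu]_(s in `[x, y]) W s) ->
  (forall x, a < x < b -> is_derive x 1 U (V x)) ->
  {within `[a, b1], continuous U} -> {within `[a, b1], continuous m} ->
  (forall x y, a <= x -> x <= y -> y <= b1 -> m x <= m y) ->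
  (forall h t : R, 0 < h -> h < h0 -> a <= t -> t <= b -> t + h + h <= b1 ->
    (U (t + h + h) - U (t + h) - (U (t + h) - U t)) ^+ 2 <=
      A * h ^+ 4 + B * h ^+ 3 * (m (t + h + h) - m t)) ->
  \int[mu]_(s in `[a, b]) (W s ^+ 2) <= A * (b - a) + 2 * B * (m b1 - m a).
Proof.
move=> ab bb1 A0 B0 h00 mW iW2 VW UV Uc mc mm sd.
have mab : measurable (`]a, b[ : set R) by exact: measurable_itv.
have iW : mu.-integrable `]a, b[ (EFin \o W).
  by apply: (@sq_integrable _ W a b) => //; exact: subset_itvW.
have aeV := ae_is_derive mW iW VW.
(* Halved so that [t + h + h <= b1] for all [t <= b], and so that steps stay strictly below [h0]. *)
pose h1 := Num.min (h0 / 2) ((b1 - b) / 2).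
have h10 : 0 < h1 by rewrite lt_min !divr_gt0// subr_gt0.
have h1h0 : h1 <= h0 / 2 by rewrite ge_min lexx.
have h1b : h1 <= (b1 - b) / 2 by rewrite ge_min lexx orbT.
pose h k : R := h1 / k.+1%:R.
have hk0 k : 0 < h k by rewrite divr_gt0.
have hk1 k : h k <= h1 by rewrite ler_pdivrMr// ler_peMr ?(ltW h10)// ler1n.
pose q k t := (U (t + h k + h k) - U (t + h k) - (U (t + h k) - U t)) / (h k * h k).
set C := A * (b - a) + 2 * B * (m b1 - m a).
have qc k : {within `[a, b], continuous (q k)}.
  have hk := hk0 k; have hk' := hk1 k.
  apply: withinM; last exact: within_cst.
  apply: withinB; apply: withinB.
  - apply: (@within_shift _ _ (fun t => U (t + h k))); apply: within_shift.
    by apply: within_itvS Uc; lra.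
  - by apply: within_shift; apply: within_itvS Uc; lra.
  - by apply: within_shift; apply: within_itvS Uc; lra.
  - by apply: within_itvS Uc; lra.
have q2c k : {within `[a, b], continuous (fun t => q k t ^+ 2)}.
  by apply: (@withinM R _ _ (q k) (q k)).
have iq k : mu.-integrable `[a, b] (EFin \o (fun t => q k t ^+ 2)).
  by apply: continuous_compact_integrable; [exact: segment_compact|].
have iq' k : mu.-integrable `]a, b[ (fun t => (q k t ^+ 2)%:E).
  by apply: integrableS (iq k) => //; exact: subset_itvW.
have qC k : (\int[mu]_(t in `]a, b[) (q k t ^+ 2)%:E <= C%:E)%E.
  rewrite -(@integral_itv_bndoo R a b (fun t => (q k t ^+ 2)%:E) true false); last first.
    exact: measurable_int (iq' k).
  have -> : (\int[mu]_(t in `[a, b]) (q k t ^+ 2)%:E =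
    (\int[mu]_(t in `[a, b]) (q k t ^+ 2))%:E)%E.
    by rewrite /Rintegral fineK//; exact: (integrable_fin_num _ (iq k)).
  rewrite lee_fin; have hk := hk0 k; have hk' := hk1 k.
  have im : mu.-integrable `[a, b] (EFin \o (fun t => m (t + (h k + h k)) - m t)).
    apply: continuous_compact_integrable; first exact: segment_compact.
    apply: withinB; last by apply: within_itvS mc; lra.
    by apply: within_shift; apply: within_itvS mc; lra.
  have im2 : mu.-integrable `[a, b]
      (EFin \o (fun t => B / h k * (m (t + (h k + h k)) - m t))).
    exact: (integrableZl _ _ im).
  have := @telescope_int a b (h k + h k) m ab.
  have -> : (0 < h k + h k) = true by rewrite addr_gt0.
  have mc' : {within `[a, b + (h k + h k)], continuous m} by apply: within_itvS mc; lra.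
  move=> /(_ isT mc') tel.
  have {}tel := tel (fun x y ax xy yb => mm x y ax xy (le_trans yb (_ : b + (h k + h k) <= b1))).
  have {}tel : \int[mu]_(t in `[a, b]) (m (t + (h k + h k)) - m t)
      <= (h k + h k) * (m b1 - m a).
    apply: (le_trans (tel _)); first by lra.
    by rewrite ler_pM2l ?addr_gt0// lerD2r; apply: mm; lra.
  (* Division by [h ^ 4] leaves [A] and [B / h] times an increment of [m] over a step [2h]. Such
     increments integrate to at most [2h] times the total increment, which cancels the [1 / h] and
     leaves [2 * B]. *)
  apply: (@le_trans _ _ (\int[mu]_(t in `[a, b]) (A + B / h k * (m (t + (h k + h k)) - m t)))).
    apply: le_Rintegral => //.
    - exact: (integrableD _ (cst_integrable a b A) im2).
    - move=> t /=; rewrite in_itv/= => /andP[at_ tb].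
      rewrite /q expr_div_n ler_pdivrMr; last by rewrite exprn_gt0// mulr_gt0.
      have -> : (A + B / h k * (m (t + (h k + h k)) - m t)) * (h k * h k) ^+ 2 =
        A * h k ^+ 4 + B * h k ^+ 3 * (m (t + h k + h k) - m t).
        by rewrite addrA; field; rewrite gt_eqF.
      by apply: sd => //; lra.
  rewrite RintegralD//; last exact: cst_integrable.
  rewrite Rintegral_cst_itv ?(ltW ab)// RintegralZl// /C lerD2l.
  apply: (@le_trans _ _ (B / h k * ((h k + h k) * (m b1 - m a)))).
    by rewrite ler_wpM2l// divr_ge0// ltW.
  by rewrite le_eqVlt; apply/orP; left; apply/eqP; field; rewrite gt_eqF.
have C0 : 0 <= C.
  rewrite /C addr_ge0 ?mulr_ge0 ?subr_ge0//; first exact: ltW.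
  by apply: mm; lra.
have mW2 : measurable_fun (`]a, b[ : set R) (fun s => (W s ^+ 2)%:E) by exact: measurable_int iW2.
have mq k : measurable_fun (`]a, b[ : set R) (fun s => (q k s ^+ 2)%:E).
  exact: measurable_int (iq' k).
have key : (\int[mu]_(s in `]a, b[) (W s ^+ 2)%:E <= C%:E)%E.
  apply: (@le_trans _ _ (\int[mu]_(s in `]a, b[) limn_einf (fun k => (q k s ^+ 2)%:E))%E).
    apply: ae_ge0_le_integral => //.
    - by move=> s _; rewrite lee_fin sqr_ge0.
    - move=> s _; rewrite limn_einf_lim; apply: lime_ge; first exact: is_cvg_einfs.
      apply: nearW => k; apply: le_ereal_inf_tmp => _ [j _ <-].
      by rewrite lee_fin sqr_ge0.
    (* The lower limit is the negative of the upper limit of the negatives. *)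
    - apply: (@measurableT_comp _ _ _ _ _ _ (-%E)%E) => //.
      apply: (@measurable_fun_limn_esup _ _ _ _ (fun k s => (- (q k s ^+ 2)%:E)%E)) => k.
      exact: (@measurableT_comp _ _ _ _ _ _ (-%E)%E).
    - move: aeV; apply: filterS; first exact: (ae_filter_ringOfSetsType mu).
      move=> x Vx xab.
      have Vx' := Vx xab; move: xab; rewrite /= in_itv/= => /andP[ax xb].
      suff /cvg_limn_einf_sup[-> _] : (fun k => (q k x ^+ 2)%:E) @ \oo --> (W x ^+ 2)%:E.
        exact: lexx.
      apply: cvg_EFin; first by near=> k.
      have qW : q ^~ x @ \oo --> W x.
        pose e0 := Num.min (x - a) (b - x).
        have e00 : 0 < e0 by rewrite lt_min !subr_gt0 ax.
        have gd y : `|y - x| < e0 -> is_derive y 1 U (V y).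
          rewrite lt_min !ltr_norml => /andP[/andP[y1 y2] /andP[y3 y4]].
          by apply: UV; lra.
        apply/cvgrPdist_le => e e_0.
        have [del del0 H] := second_quotient e00 gd Vx' e_0.
        have hcvg : h @ \oo --> 0.
          rewrite -[X in _ --> X](mulr0 h1); apply: cvgM; first exact: cvg_cst.
          exact: cvg_harmonic.
        have := hcvg; move/cvgrPdist_lt => /(_ del del0); apply: filterS => k.
        rewrite sub0r normrN gtr0_norm// => hd.
        by rewrite distrC; apply: H.
      exact: (cvgM qW qW).
  apply: (le_trans (@fatou _ _ R mu `]a, b[ mab (fun k s => (q k s ^+ 2)%:E) mq _)).
    by move=> k s _; rewrite lee_fin sqr_ge0.
  exact: limn_einf_le.
rewrite /Rintegral (integral_itv_bndoo _ _ mW2) -[C]/(fine C%:E) fine_le//.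
exact: (integrable_fin_num _ iW2).
Unshelve. all: by end_near. Qed.

End L2.

(** * The closed loop *)

Section Loop.
Variable R : realType.
Local Notation mu := (@lebesgue_measure R).

Lemma acL2_glue (a b d : R) g g' : a <= b -> b <= d ->
  acL2 a b g g' -> acL2 b d g g' -> acL2 a d g g'.
Proof.
move=> ab bd [m1 i1 f1] [m2 i2 f2].
have E : `[a, d]%classic = `[a, b] `|` `[b, d] :> set R.
  apply/seteqP; split => s /=; rewrite !in_itv/=.
    by move=> /andP[as_ sd]; have [sb|/ltW bs] := leP s b; [left|right]; rewrite ?as_ ?sd ?sb ?bs.
  by move=> [/andP[as_ sb]|/andP[bs sd]]; apply/andP; split => //;
     [exact: le_trans bd|exact: le_trans bs].
have m3 : measurable_fun `[a, d] g' by rewrite E; apply/measurable_funU.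
have i3 : mu.-integrable `[a, d] (EFin \o (fun s => g' s ^+ 2)).
  have m4 : measurable_fun `[a, d] (EFin \o (fun s => g' s ^+ 2)).
    by apply/measurable_EFinP; exact: measurable_funX.
  have i2' : mu.-integrable `]b, d] (EFin \o (fun s => g' s ^+ 2)).
    apply: integrableS i2 => // s /=; rewrite !in_itv/= => /andP[bs ->].
    by rewrite (ltW bs).
  have /integrableP[_ j1] := i1; have /integrableP[_ j2] := i2'.
  apply/integrableP; split => //.
  (* Half-open on the right, since additivity of the integral asks for disjoint pieces. *)
  have E' : `[a, d]%classic = `[a, b] `|` `]b, d] :> set R.
    by apply: itv_bndbnd_setU; rewrite bnd_simp.
  rewrite E' ge0_integral_setU//.
  - by rewrite lte_add_pinfty.
  - by rewrite -E'; apply: measurableT_comp.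
  - apply/disj_setPLR => s /=; rewrite !in_itv/= => /andP[_ sb].
    by apply/negP; rewrite negb_and -leNgt sb.
split=> // x y ax xy yd.
have i4 : mu.-integrable `[a, d] (EFin \o g') by exact: (sq_integrable (a := a) (b := d)).
have [yb|/ltW by_] := leP y b; first exact: f1.
have [bx|/ltW xb] := leP b x; first exact: f2.
rewrite (@Rint_split _ x b y)//; last exact: integrable_itvS i4.
by rewrite -(f1 x b)// -(f2 b y)//; ring.
Qed.

Lemma H1_acL2 (a b : R) g : H1_on `[a, b] g -> acL2 a b g (g^`())%classic.
Proof.
move=> [m i ftc]; split => // x y ax xy yb.
by apply: ftc; rewrite // in_itv/= ?ax ?yb ?(le_trans xy)// (le_trans ax).
Qed.

Lemma H1_oo_acL2 (a b x y : R) g : H1_on `]a, b[ g -> a < x -> y < b ->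
  acL2 x y g (g^`())%classic.
Proof.
move=> [m i ftc] ax yb.
have S : `[x, y] `<=` (`]a, b[ : set R).
  move=> s /=; rewrite !in_itv/= => /andP[xs sy].
  by rewrite (lt_le_trans ax)// (le_lt_trans sy).
split => [||v w xv vw wy].
- exact: measurable_funS m.
- exact: integrableS i.
- by apply: ftc => //; apply: S; rewrite /= in_itv/= ?xv ?wy ?(le_trans vw)// (le_trans xv).
Qed.

Lemma within_le_left (g : R -> R) (a t c : R) : a < t -> {within `[a, t], continuous g} ->
  (forall s, a <= s < t -> g s <= c) -> g t <= c.
Proof.
move=> at_ gc gle; rewrite leNgt; apply/negP => ct.
have tat : `[a, t]%classic t by rewrite /= in_itv/= (ltW at_) lexx.
have gt0 : 0 < g t - c by rewrite subr_gt0.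
have := (subspace_continuousP _ _).1 gc t tat; move/cvgrPdist_lt => /(_ _ gt0).
rewrite near_withinE => /nbhs_ballP[e /= e0 H].
have [s sat st] : exists2 s, a <= s < t & t - s < e.
  exists (Num.max a (t - e / 2)); last first.
    have : t - e / 2 <= Num.max a (t - e / 2) by rewrite le_max lexx orbT.
    by lra.
  by rewrite le_max lexx/= gt_max at_/=; lra.
have /andP[as_ st'] := sat.
have := H s; rewrite /ball/= => /(_ _ _)/wrap[].
- by rewrite gtr0_norm// subr_gt0.
- by rewrite in_itv/= as_ ltW.
- move=> d; have := gle s sat; have := ler_norm (g t - g s); lra.
Qed.

End Loop.

Section Arithmetic.
Variable R : realType.

(** An energy is quadratic in the size [N]; it is weakened to a linear bound, to be added to the
    norms of state and input. *)
Lemma square_slope_le (c N d h : R) : 0 <= N <= 1 -> 0 <= d -> d <= h ->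
  (c * N) ^+ 2 * d <= c ^+ 2 * N * h.
Proof.
move=> /andP[N0 N1] d0 dh; rewrite exprMn.
apply: ler_pM => //; first by rewrite mulr_ge0 ?sqr_ge0.
by rewrite ler_wpM2l ?sqr_ge0// expr2 ler_piMr.
Qed.

Lemma curvature_le (c N D h w v : R) : 0 <= N <= 1 -> 0 <= h -> h <= D -> w <= v ->
  2 * c ^+ 2 * N ^+ 2 * h + 8 * c ^+ 2 * w <= 2 * c ^+ 2 * D * N + 8 * c ^+ 2 * v.
Proof.
move=> N01 h0 hD wv; apply: lerD.
  have := square_slope_le c N01 h0 hD; rewrite exprMn => H; lra.
by rewrite ler_wpM2l// mulr_ge0// sqr_ge0.
Qed.

End Arithmetic.

Section ClosedLoop.
Variables (R : realType) (n : nat).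
Local Notation V := 'cV[R]_n.
Local Notation mu := (@lebesgue_measure R).
Variables (f : V * R -> V) (D t0 : R) (kappa delta : R * V -> R) (T : \bar R).
Variables (X : R -> V) (U : R -> R) (P : R -> R -> V) (u : R -> R -> R).
Hypotheses (D0 : 0 < D) (tT : (t0%:E < T)%E) (fc : continuous f).
Hypothesis cl : closed_loop f D t0 kappa delta T X U P u.

Ltac keep H ::=
  lazymatch constr:((D0, tT, fc, cl)) with
  | context [H] => idtac
  end.

Let rb := delay_reach D delta X t0.
Let sg t := t - D - delta (t, X t).
Let U1 : R -> R := (U^`())%classic.

Lemma reach_le t : delay_reach D delta X t <= t - D.
Proof. by rewrite /delay_reach lerBlDr lerDl le_max lexx. Qed.

Lemma reach_le_sg t : delay_reach D delta X t <= sg t.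
Proof. by rewrite /delay_reach /sg lerD2l lerN2 le_max lexx orbT. Qed.

(** The closed loop gives this regularity only on a window ending at [t]. Each window has length at
    least [D], so finitely many of them, glued at [s], reach back from [t] to [rb]. *)
Lemma loop_acL2 t : t0 <= t -> (t%:E < T)%E -> acL2 rb t U U1.
Proof.
suff H k : forall t, t0 <= t -> t <= t0 + k%:R * D -> (t%:E < T)%E -> acL2 rb t U U1.
  move=> tt; have h0 : 0 <= (t - t0) / D by rewrite divr_ge0 ?subr_ge0// ltW.
  apply: (H (Num.bound ((t - t0) / D))) => //.
  by rewrite -lerBlDl -ler_pdivrMr// ltW// archi_boundP.
elim: k => [|k IH] {}t tt tk tlT.
  have -> : t = t0 by apply/eqP; rewrite eq_le tt andbT; move: tk; rewrite mul0r addr0.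
  exact: H1_acL2 (cl_U1 cl (lexx _) tT).
pose s := Num.max t0 (t - D).
have st : s <= t by rewrite ge_max tt gerBl ltW.
have ts : t0 <= s by rewrite le_max lexx.
apply: (@acL2_glue _ _ s) => //.
- by apply: (le_trans (reach_le t0)); apply: le_trans ts; rewrite gerBl ltW.
- apply: IH => //; last by apply: le_lt_trans tlT; rewrite lee_fin.
  rewrite ge_max lerDl mulr_ge0 ?ler0n ?(ltW D0)//=.
  by move: tk; rewrite -natr1 mulrDl mul1r; lra.
- apply: acL2_sub (H1_acL2 (cl_U1 cl tt tlT)) => //.
  by apply: (le_trans (reach_le t)); rewrite le_max lexx orbT.
Qed.

(** [U1] is locally absolutely continuous there, in particular continuous, so its primitive [U] has
    it as derivative at every point. *)
Lemma loop_C1 t s : t0 <= t -> (t%:E < T)%E -> t - D < s < t -> is_derive s 1 U (U1 s).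
Proof.
move=> tt tlT hs; pose x := (t - D + s) / 2; pose y := (s + t) / 2.
have hx : t - D < x /\ x < s by rewrite /x; split; lra.
have hy : s < y /\ y < t by rewrite /y; split; lra.
have ac1 : acL2 x y U1 ((U1^`())%classic).
  by apply: H1_oo_acL2 (cl_U2 cl tt tlT) _ _; [exact: hx.1|exact: hy.2].
have rbt : rb <= t0 - D := reach_le t0.
apply: (@primitive_is_derive _ x y) => //; last 2 first.
- by rewrite hx.2 hy.1.
- by apply: acL2_continuous ac1; lra.
apply: acL2_sub (loop_acL2 tt tlT); lra.
Qed.

Lemma loop_U_cont t : t0 <= t -> (t%:E < T)%E -> {within `[rb, t], continuous U}.
Proof.
move=> tt tlT; apply: acL2_continuous (loop_acL2 tt tlT).
by have := reach_le t0; rewrite -/rb; move: D0 tt; lra.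
Qed.

Lemma loop_predictor t th : t0 <= t -> (t%:E < T)%E -> t - D < th < t ->
  is_derive th 1 (P t) (f (P t th, U th)).
Proof.
move=> tt tlT hth; apply: is_derive_mx => i.
have rbt := reach_le t0; rewrite -/rb in rbt.
have gc : {within `[t - D, t], continuous (fun s => f (P t s, U s) i 0)}.
  apply: (within_coord (F := fun s => f (P t s, U s))).
  apply: (within_comp (F := fun s => (P t s, U s))) => //.
  apply: within_pair; first exact: (@cl_P _ _ _ _ _ _ _ _ _ _ _ _ cl t tt tlT).
  by apply: within_itvS (loop_U_cont tt tlT); lra.
apply: (@primitive_is_derive _ (t - D) t _ (fun s => f (P t s, U s) i 0)) => //.
apply: (@acL2_primitive _ _ _ (X t i 0)) => // x hx.
exact: (cl_predictor cl).
Qed.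

Lemma loop_X_cont t : (t%:E < T)%E -> {within `[t0, t], continuous X}.
Proof.
move=> tlT; apply: continuous_subspaceW (cl_X cl) => s /=; rewrite in_itv/= => /andP[ts st].
by split=> //; apply: le_lt_trans tlT; rewrite lee_fin.
Qed.

(** There is a circle to break: that [sg] is monotone, hence never before [rb], needs a Lipschitz
    bound on [X]; this needs a bound on the delayed input, which is only known from [rb] on. *)
Lemma loop_orbit (eps r L rho t1 : R) : 0 < eps -> lip_ball f r L -> 0 < L ->
  0 < rho -> 2 * rho <= r -> rho <= 1 -> f (0, 0) = 0 ->
  eps <= D -> eps * (1 + n%:R * (3 * L * rho)) <= 1 ->
  Ck (from_time t0) 1 delta ->
  (forall t xi, t0 <= t -> `|xi| <= 1 ->
     `|delta (t, xi)| + `|derive_within (from_time t0) (dir_t R n) delta (t, xi)|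
       + dnorm t0 0 1 delta (t, xi) <= eps) ->
  t0 <= t1 -> (t1%:E < T)%E ->
  (forall t, t0 <= t <= t1 -> `|X t| <= rho) ->
  (forall t, rb <= t <= t1 -> `|U t| <= rho) ->
  trajectory f kappa D t0 rho eps t1 rb X U P sg.
Proof.
move=> e0 fL L0 rho0 rr r1 f00 eD e1 dC dB tt1 t1T Xr Ur.
have rbt := reach_le t0; rewrite -/rb in rbt.
have T' t : t <= t1 -> (t%:E < T)%E by move=> ?; apply: le_lt_trans t1T; rewrite lee_fin.
have dl := delta_lip (ltW e0) dC dB.
have d0 t : t0 <= t <= t1 -> `|delta (t, X t)| <= eps.
  move=> ht; have X1 : `|X t| <= 1 by apply: le_trans r1; exact: Xr.
  have := dB t (X t); move: ht => /andP[-> _] /(_ isT X1).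
  have := normr_ge0 (derive_within (from_time t0) (dir_t R n) delta (t, X t)).
  have : 0 <= dnorm t0 0 1 delta (t, X t) by exact: sqrtr_ge0.
  lin.
have f_le x w : `|x| <= rho -> `|w| <= 2 * rho -> `|f (x, w)| <= 3 * L * rho.
  move=> xr wr.
  have H := fL x 0 w 0 (le_trans xr _) _ (le_trans wr rr) _.
  have {}H : `|f (x, w)| <= L * (`|x| + `|w|).
    by move: H; rewrite f00 !subr0 !normr0; apply; move: rr rho0; lin.
  apply: (le_trans H); rewrite [3 * L]mulrC -mulrA ler_pM2l//; move: wr xr; lin.
have sg_le t : t0 <= t <= t1 -> sg t <= t1.
  by move=> ht; have := d0 t ht; rewrite ler_norml /sg; move: ht eD; lin.
have Uc := loop_U_cont tt1 t1T.
(* Some room before [rb] opens the bootstrap. If [sg] ever gets before [rb], the regularity window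
   at that time extends beyond [rb], so [U] is continuous at [rb] from the left and bounded by
   [2 * rho] slightly before it. *)
have [eta eta0 etaU] : exists2 eta, 0 < eta &
    forall t, t0 <= t <= t1 -> rb - eta <= sg t -> `|U (sg t)| <= 2 * rho.
  have [[ts [hts tsb]]|nb] := pselect (exists t, t0 <= t <= t1 /\ sg t < rb); last first.
    exists 1 => // t ht _; apply: (@le_trans _ _ rho); last by move: rho0; lin.
    apply: Ur; rewrite sg_le// andbT leNgt; apply/negP => tb.
    by apply: nb; exists t.
  have reb : delay_reach D delta X ts < rb by apply: le_lt_trans (reach_le_sg ts) tsb.
  have /andP[h1 h2] := hts.
  have Uc1 : {within `[delay_reach D delta X ts, rb], continuous U}.
    apply: (acL2_continuous (g' := U1)); first exact: ltW.
    by apply: acL2_sub (H1_acL2 (cl_U1 cl h1 (T' _ h2))) => //; move: rbt hts eD e0; lin.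
  have bin : `[delay_reach D delta X ts, rb]%classic rb by rewrite /= in_itv/= lexx ltW.
  have /cvgrPdist_lt := (subspace_continuousP _ _).1 Uc1 rb bin.
  move=> /(_ _ rho0); rewrite near_withinE => /nbhs_ballP[e /= e_0 H].
  pose eta := Num.min (e / 2) (rb - delay_reach D delta X ts).
  exists eta; first by rewrite lt_min divr_gt0//= subr_gt0.
  have eta1 : eta <= e / 2 by rewrite ge_min lexx.
  have eta2 : eta <= rb - delay_reach D delta X ts by rewrite ge_min lexx orbT.
  move=> t ht hs; have Urb : `|U rb| <= rho by apply: Ur; rewrite lexx; move: rbt tt1 eD e0; lin.
  have [bs|sb] := leP rb (sg t).
    by apply: (@le_trans _ _ rho); [apply: Ur; rewrite bs sg_le|move: rho0; lin].
  have := H (sg t); rewrite /ball/= => H1.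
  have {}H1 : `|U rb - U (sg t)| < rho.
    by apply: H1; [rewrite gtr0_norm ?subr_gt0//; move: hs eta1 e_0; lin|rewrite in_itv/= (ltW sb) andbT; move: hs eta2; lin].
  have := ler_normB (U rb) (U rb - U (sg t)).
  by rewrite subKr; move: H1 Urb; lin.
have Xc := loop_X_cont t1T.
have idc : {within `[t0, t1], continuous (fun t : R => t)}.
  by apply: continuous_subspaceT => x; exact: cvg_id.
have pc : {within `[t0, t1], continuous (fun t => (t, X t))}.
  by apply: within_pair; [exact: idc|exact: Xc].
have sgc : {within `[t0, t1], continuous sg}.
  rewrite /sg; apply: withinB.
    by apply: withinB; [exact: idc|exact: within_cst].
  apply: (within_within (B := from_time t0) pc); last by case: dC.
  by move=> t /=; rewrite in_itv/= => /andP[].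
have Xlip a b : t0 <= a -> a <= b -> b <= t1 ->
    (forall s, a < s < b -> rb - eta <= sg s) -> `|X b - X a| <= 3 * L * rho * (b - a).
  move=> ta ab bt hs; apply: (@mvi_lin _ _ _ (fun t => f (X t, U (sg t)))) => //.
  - by apply: within_itvS Xc; move: ta bt; lin.
  - by move=> s hs'; apply: (cl_plant cl); [move: hs' ta; lin|apply: T'; move: hs' bt; lin].
  - by move=> s hs'; apply: f_le; [apply: Xr; move: hs' bt ta; lin|apply: etaU; [move: hs' bt ta; lin|exact: hs]].
have sglip a b : t0 <= a -> a <= b -> b <= t1 ->
    (forall s, a < s < b -> rb - eta <= sg s) -> 0 <= sg b - sg a <= 2 * (b - a).
  move=> ta ab bt hs; have Xab := Xlip a b ta ab bt hs.
  have Xa1 : `|X a| <= 1 by apply: le_trans r1; apply: Xr; move: bt ab ta; lin.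
  have Xb1 : `|X b| <= 1 by apply: le_trans r1; apply: Xr; move: bt ab ta; lin.
  have H := dl a b (X a) (X b) ta ab Xa1 Xb1.
  (* The condition on [eps] makes [delta] along the state 1-Lipschitz; hence [sg] is nondecreasing
     and 2-Lipschitz. *)
  have {}H : `|delta (b, X b) - delta (a, X a)| <= 1 * (b - a).
    apply: (le_trans H); apply: (@le_trans _ _ (eps * (1 + n%:R * (3 * L * rho)) * (b - a))).
      have : n%:R * eps * `|X b - X a| <= n%:R * eps * (3 * L * rho * (b - a)).
        by rewrite ler_wpM2l// mulr_ge0// ltW.
      lin.
    by rewrite ler_wpM2r// subr_ge0.
  by move: H; rewrite mul1r ler_norml /sg; lin.
have sg0 : rb <= sg t0 by exact: reach_le_sg.
(* While [sg] stays above [rb - eta] it is monotone, hence above [sg t0], which is at least [rb]. *)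
have sgb : forall t, t0 <= t <= t1 -> rb - sg t < eta.
  apply: bootstrap; first by apply: withinB => //; exact: within_cst.
  move=> t ht hs.
  have /andP[tt tt1'] := ht.
  have H : forall s, t0 < s < t -> rb - eta <= sg s by move=> s hs'; have := hs s; move: hs'; lin.
  by have := sglip t0 t (lexx _) tt tt1' H; move: sg0 eta0; lin.
have sgL s t : t0 <= s -> s <= t -> t <= t1 -> 0 <= sg t - sg s <= 2 * (t - s).
  move=> ts st tt; apply: sglip => // x hx; have := sgb x; move: hx tt ts; lin.
split=> //.
- by move=> t ht; apply: (cl_plant cl); [move: ht; lin|apply: T'; move: ht; lin].
- move=> t ht; apply: (@cl_P _ _ _ _ _ _ _ _ _ _ _ _ cl t); [move: ht; lin|apply: T'; move: ht; lin].
- move=> t ht; apply/matrixP => i j; rewrite ord1.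
  rewrite (cl_predictor cl); [|move: ht; lin|apply: T'; move: ht; lin|move: eD e0; lin].
  by rewrite set_itv1 Rintegral_set1 addr0.
- by move=> t th ht hth; apply: loop_predictor => //; [move: ht; lin|apply: T'; move: ht; lin].
- by move=> t ht; apply: (cl_control cl); [move: ht; lin|apply: T'; move: ht; lin].
- by move=> t ht; have := sgL t0 t; move: ht sg0; lin.
- by move=> t ht; have := d0 t ht; rewrite /sg addrAC subrr add0r normrN.
Qed.

Lemma reach_ge (eps : R) :
  (forall t xi, t0 <= t -> `|xi| <= 1 ->
     `|delta (t, xi)| + `|derive_within (from_time t0) (dir_t R n) delta (t, xi)|
       + dnorm t0 0 1 delta (t, xi) <= eps) ->
  forall t, t0 <= t -> `|X t| <= 1 -> t - D - eps <= delay_reach D delta X t.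
Proof.
move=> dB t tt X1; have := dB t (X t) tt X1.
have := normr_ge0 (derive_within (from_time t0) (dir_t R n) delta (t, X t)).
have : 0 <= dnorm t0 0 1 delta (t, X t) by exact: sqrtr_ge0.
move=> h1 h2 h3; rewrite /delay_reach lerD2l lerN2 ge_max.
have := normr_ge0 (delta (t, X t)); have := ler_norm (delta (t, X t)).
by move=> h4 h5; apply/andP; split; move: h5 h3 h2 h1 h4; lin.
Qed.

Lemma state_le_Pi t : enorm (X t) <= Pi D delta (fun x => x) X U t.
Proof.
by rewrite /Pi -!addrA lerDl !addr_ge0//; apply: Rint_ge0 => s //; exact: sqr_ge0.
Qed.

(** Somewhere in the window [|U|] is at most its mean, which is at most [p / D]; from there the
    oscillation over a length at most [2 * D] is bounded by Cauchy-Schwarz. Finally [p <= sqrt p],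
    as [p <= 1]. *)
Lemma loop_history (p : R) : p = Pi D delta (fun x => x) X U t0 -> p <= 1 ->
  t0 - 2 * D <= rb ->
  [/\ 0 <= p, enorm (X t0) <= p,
      forall s, rb <= s <= t0 -> `|U s| <= (D^-1 + Num.sqrt (2 * D)) * Num.sqrt p,
      \int[mu]_(s in `[rb, t0]) (U1 s ^+ 2) <= p &
      \int[mu]_(s in `[t0 - D, t0]) ((U^`(2))%classic s ^+ 2) <= p].
Proof.
move=> pE p1 rb2; have rbt := reach_le t0; rewrite -/rb in rbt.
move: pE; rewrite /Pi -/rb -/U1.
set I1 := \int[mu]_(s in _) `|U s|; set I2 := \int[mu]_(s in _) _; set I3 := \int[mu]_(s in _) _.
move=> pE.
have X0 : 0 <= enorm (X t0) by exact: sqrtr_ge0.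
have I10 : 0 <= I1 by exact: Rint_ge0.
have I20 : 0 <= I2 by apply: Rint_ge0 => s; exact: sqr_ge0.
have I30 : 0 <= I3 by apply: Rint_ge0 => s; exact: sqr_ge0.
have [p0 pX pI1 pI3 pI2] : [/\ 0 <= p, enorm (X t0) <= p, I1 <= p, I3 <= p & I2 <= p].
  by clearbody I1 I2 I3; split; move: I30 I20 I10 X0 pE; lin.
split => //.
have ac := loop_acL2 (lexx _) tT.
have Uc : {within `[t0 - D, t0], continuous (fun s => `|U s|)}.
  apply: within_norm; apply: within_itvS (loop_U_cont (lexx _) tT) => //; exact: lexx.
have tDt : t0 - D <= t0 by rewrite gerBl ltW.
have [c cin cmin] := EVT_min tDt Uc; rewrite in_itv/= in cin.
have Uc_p : `|U c| <= p / D.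
  rewrite ler_pdivlMr//; apply: le_trans pI1.
  have -> : `|U c| * D = \int[mu]_(s in `[t0 - D, t0]) `|U c|.
    by rewrite Rintegral_cst_itv// opprB addrC subrK.
  apply: le_Rintegral => //; first exact: cst_integrable.
    by apply: continuous_compact_integrable => //; exact: segment_compact.
have I3S x y : rb <= x -> x <= y -> y <= t0 -> \int[mu]_(z in `[x, y]) (U1 z ^+ 2) <= p.
  move=> rx xy yt; apply: le_trans pI3.
  by apply: Rint_subset => //; [exact: ac_i ac|move=> z; exact: sqr_ge0].
clear I10 I20 I30 pE pI1 pI2 pI3; clear I1 I2 I3.
have p_sq : p <= Num.sqrt p.
  rewrite -{1}(sqr_sqrtr p0) expr2 ler_piMl ?sqrtr_ge0//.
  by rewrite -[leRHS]sqrtr1 ler_sqrt.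
move=> s hs.
have osc x y : rb <= x -> x <= y -> y <= t0 -> `|U y - U x| <= Num.sqrt (2 * D) * Num.sqrt p.
  move=> rx xy yt; rewrite -sqrtrM ?mulr_ge0 ?(ltW D0)// -sqrtr_sqr ler_wsqrtr//.
  apply: (le_trans (acL2_holder ac rx xy yt)); have := I3S x y rx xy yt.
  have : 0 <= \int[mu]_(z in `[x, y]) (U1 z ^+ 2) by apply: Rint_ge0 => z; exact: sqr_ge0.
  set J := \int[mu]_(z in _) _ => J0 Jp; clearbody J.
  have h1 : 0 <= y - x by rewrite subr_ge0.
  have h2 : y - x <= 2 * D by move: yt rx rb2; lin.
  exact: ler_pM.
have {}osc : `|U s - U c| <= Num.sqrt (2 * D) * Num.sqrt p.
  have rc : rb <= c by move: rbt cin; lin.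
  by have [cs|/ltW sc] := leP c s; [apply: osc; move: cin rbt cs hs; lin|rewrite distrC; apply: osc; move: hs sc cin; lin].
have pD : p / D <= Num.sqrt p / D by rewrite ler_pM2r// invr_gt0.
have := ler_normD (U c) (U s - U c); rewrite addrC subrK mulrDl [D^-1 * _]mulrC.
by move: osc Uc_p pD; lin.
Qed.

(** This and the next three definitions restate, for the given closed loop, the conclusions of
    [second_diff_bound], [U_lip_bound], [growth] and [decay], so that what follows is free of the
    hypotheses on [f] and [kappa] behind them. *)
Definition curvature_bound CS t1 := forall t h N w : R,
  t0 <= t -> 0 <= h -> h + h <= D -> t + h + h <= t1 ->
  N <= 1 -> bnd_on D rb X U t (t + h + h) N ->
  (forall s, t <= s <= t + h -> `|U (sg (s + h)) - U (sg s)| <= w) ->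
  (forall s, t - D <= s <= t - D + h -> `|U (s + h) - U s| <= w) ->
  `|U (t + h + h) - U (t + h) - (U (t + h) - U t)| <= CS * h * (h * N + w).

Definition slope_bound CL t1 := forall s N, t0 <= s -> bnd_on D rb X U s t1 N ->
  forall x y, s <= x -> x <= y -> y <= t1 -> `|U y - U x| <= CL * N * (y - x).

Definition growth_bound C1 Q t1 := forall s t a, t0 <= s -> s <= t -> t <= t1 ->
  (* Three periods: a time is treated from a grid point up to two periods earlier, and second
     differences look a little beyond that time. *)
  t <= s + 3 * Q -> 0 <= a -> bnd_on D rb X U s s a -> bnd_on D rb X U s t (C1 * a).

Definition halving_bound Q t1 := forall s a, t0 <= s -> s + Q <= t1 -> 0 <= a ->
  bnd_on D rb X U s s a -> bnd_on D rb X U (s + Q) (s + Q) (a / 2).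

Lemma loop_halving (Q a t1 : R) : 0 <= a -> 0 < Q ->
  halving_bound Q t1 -> bnd_on D rb X U t0 t0 a ->
  forall k, t0 + k%:R * Q <= t1 ->
    bnd_on D rb X U (t0 + k%:R * Q) (t0 + k%:R * Q) (a * 2^-1 ^+ k).
Proof.
move=> a0 Q0 dec b0; elim => [|k IH] kt; first by rewrite mul0r addr0 expr0 mulr1.
have kE : t0 + k.+1%:R * Q = t0 + k%:R * Q + Q by rewrite -natr1 mulrDl mul1r addrA.
rewrite kE exprSr mulrA; rewrite kE in kt.
have k0 : 0 <= k%:R * Q by rewrite mulr_ge0 ?ler0n ?ltW.
apply: dec => //; first by lra.
  by rewrite mulr_ge0// exprn_ge0.
by apply: IH; lra.
Qed.

Lemma grid (Q t : R) : 0 < Q -> t0 <= t ->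
  exists k : nat, t0 + k%:R * Q <= t /\ t < t0 + k%:R * Q + Q.
Proof.
move=> Q0 tt; have h : 0 <= (t - t0) / Q by rewrite divr_ge0 ?subr_ge0// ltW.
exists (Num.truncn ((t - t0) / Q)); have /andP[] := truncn_itv h.
rewrite ler_pdivlMr// ltr_pdivrMr// -natr1 [(_ + 1) * Q]mulrDl mul1r => h1 h2; split; lra.
Qed.

(** A bound by [rho] up to some time makes the loop a trajectory up to there; halving at the grid
    points and growth in between then improve the bound to [C1 * a < rho], and [bootstrap] closes
    the argument. *)
Lemma loop_bounded (eps r L rho Q C1 a : R) : 0 < eps -> lip_ball f r L -> 0 < L ->
  0 < rho -> 2 * rho <= r -> rho <= 1 -> f (0, 0) = 0 ->
  eps <= D -> eps * (1 + n%:R * (3 * L * rho)) <= 1 ->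
  Ck (from_time t0) 1 delta ->
  (forall t xi, t0 <= t -> `|xi| <= 1 ->
     `|delta (t, xi)| + `|derive_within (from_time t0) (dir_t R n) delta (t, xi)|
       + dnorm t0 0 1 delta (t, xi) <= eps) ->
  (forall t1, trajectory f kappa D t0 rho eps t1 rb X U P sg -> growth_bound C1 Q t1) ->
  (forall t1, trajectory f kappa D t0 rho eps t1 rb X U P sg -> halving_bound Q t1) ->
  0 < Q -> 1 <= C1 -> 0 <= a -> C1 * a < rho -> t0 - 2 * D <= rb ->
  bnd_on D rb X U t0 t0 a ->
  forall t1, t0 <= t1 -> (t1%:E < T)%E ->
    trajectory f kappa D t0 rho eps t1 rb X U P sg.
Proof.
move=> e0 fL L0 rho0 rr r1 f00 eD e1 dC dB G Dc Q0 C11 a0 C1a rb2 b0 t1 tt1 t1T.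
have aC : a <= C1 * a by rewrite ler_peMl.
have orb t : t0 <= t -> (t%:E < T)%E -> (forall s, t0 <= s <= t -> `|X s| <= rho /\ `|U s| <= rho) ->
    trajectory f kappa D t0 rho eps t rb X U P sg.
  move=> tt tlT H; apply: (loop_orbit (r := r) (L := L)) => // s hs; first by have [] := H s hs.
  have [st|/ltW ts] := leP s t0; last by have [] := H s _; [move: ts hs; lin|].
  have [_ bU] := b0; apply: le_trans (bU s _ _) _; move: hs st rb2 aC C1a; lin.
have small t : t0 <= t -> trajectory f kappa D t0 rho eps t rb X U P sg ->
    `|X t| <= C1 * a /\ `|U t| <= C1 * a.
  move=> tt ob; have [k [k1 k2]] := grid Q0 tt.
  have bk := loop_halving a0 Q0 (Dc t ob) b0 k1.
  have h0 : 0 <= k%:R * Q by rewrite mulr_ge0 ?ler0n ?ltW.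
  have ak0 : 0 <= a * 2^-1 ^+ k by rewrite mulr_ge0// exprn_ge0.
  have [] := G t ob (t0 + k%:R * Q) t _ _ k1 (lexx _) _ ak0 bk; [move: h0; lin|move: k2 Q0; lin|].
  have ak : C1 * (a * 2^-1 ^+ k) <= C1 * a.
    rewrite ler_pM2l ?ler_piMr//; last by move: C11; lin.
    by rewrite exprn_ile1//; lin.
  have rbt := reach_le t0; rewrite -/rb in rbt.
  move=> bX bU; split; apply: le_trans ak; [apply: bX|apply: bU]; move: k1 rbt tt eD e0; lin.
have Xc := loop_X_cont t1T; have Uc := loop_U_cont tt1 t1T.
have rbt := reach_le t0; rewrite -/rb in rbt.
have gc : {within `[t0, t1], continuous (fun t => Num.max `|X t| `|U t|)}.
  apply: within_max; apply: within_norm => //.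
  by apply: within_itvS Uc; move: D0 rbt; lin.
have H : forall t, t0 <= t <= t1 -> Num.max `|X t| `|U t| < rho.
  apply: bootstrap => // t /andP[tt tt1'] hs; apply: le_lt_trans C1a.
  have : t0 <= t by []. rewrite le_eqVlt => /predU1P[tE|tlt].
    have [bX bU] := b0; rewrite -tE ge_max; apply/andP; split; apply: le_trans aC.
      by apply: bX; lin.
    by apply: bU; move: D0 rbt; lin.
  (* The bound is available only before [t], so the improved bound is proved at earlier times and
     passed to the limit. *)
  apply: (@within_le_left _ (fun t => Num.max `|X t| `|U t|) t0) => //.
    exact: within_itvS gc.
  move=> s /andP[ts st]; rewrite ge_max.
  suff ob : trajectory f kappa D t0 rho eps s rb X U P sg.
    by have [-> ->] := small s ts ob.
  apply: orb => //; first by apply: le_lt_trans t1T; rewrite lee_fin; move: st tt1'; lin.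
  move=> x hx; have hx' : t0 <= x < t by move: hx st; lin.
  by have := hs x hx'; rewrite ge_max => /andP[].
apply: orb => // s hs; have := H s hs; rewrite gt_max => /andP[/ltW ? /ltW ?]; split=> //.
Qed.

Lemma loop_lip_energy (s t c : R) : t0 <= s -> s <= t -> (t%:E < T)%E -> 0 <= c ->
  (forall x y, s <= x -> x <= y -> y <= t -> `|U y - U x| <= c * (y - x)) ->
  \int[mu]_(x in `[s, t]) (U1 x ^+ 2) <= c ^+ 2 * (t - s).
Proof.
move=> ts st tlT c0 lip; have rbt := reach_le t0; rewrite -/rb in rbt.
apply: (@acL2_lip _ s t U U1 c) => //.
  by apply: acL2_sub (loop_acL2 (le_trans ts st) tlT); move: D0; lra.
(* [loop_C1] differentiates only within one delay before its end time; [t'] is an end time just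
   after [x]. *)
move=> x /andP[sx xt]; pose t' := Num.min t (x + D / 2).
have t't : t' <= t by rewrite ge_min lexx.
have t'x : t' <= x + D / 2 by rewrite ge_min lexx orbT.
have xt' : x < t' by rewrite lt_min xt ltrDl divr_gt0.
apply: (@loop_C1 t'); first by lra.
  by apply: le_lt_trans tlT; rewrite lee_fin.
by move: D0; lra.
Qed.

(** * Energies of the derivatives of the input *)

Definition energy x := \int[mu]_(s in `[rb, x]) (U1 s ^+ 2).

Lemma energyB x y t : (t%:E < T)%E -> t0 <= t -> rb <= x -> x <= y -> y <= t ->
  energy y - energy x = \int[mu]_(s in `[x, y]) (U1 s ^+ 2).
Proof.
move=> tlT tt rx xy yt; have i := ac_i (loop_acL2 tt tlT).
rewrite /energy (@Rint_split _ rb x y)//; first by rewrite addrC addKr.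
by apply: integrable_itvS i.
Qed.

Lemma energy_le x y t : (t%:E < T)%E -> t0 <= t -> rb <= x -> x <= y -> y <= t ->
  energy x <= energy y.
Proof.
move=> tlT tt rx xy yt; rewrite -subr_ge0 (energyB tlT tt)//.
by apply: Rint_ge0 => s; exact: sqr_ge0.
Qed.

Lemma energy_cont t : (t%:E < T)%E -> t0 <= t -> {within `[rb, t], continuous energy}.
Proof.
move=> tlT tt; have i := ac_i (loop_acL2 tt tlT).
apply: integral_continuous => //.
by have := reach_le t0; rewrite -/rb; move: D0; lra.
Qed.

Lemma loop_osc (t x y : R) : (t%:E < T)%E -> t0 <= t -> rb <= x -> x <= y -> y <= t ->
  (U y - U x) ^+ 2 <= (y - x) * (energy y - energy x).
Proof.
move=> tlT tt rx xy yt; rewrite (energyB tlT tt)//.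
exact: acL2_holder (loop_acL2 tt tlT) _ _ _.
Qed.

(** The monotone function for [L2_of_second_diff]: its increments control the oscillation of both
    rough inputs that a second difference at [t] sees, the delayed one and the one at the start of
    the predictor window. *)
Definition window_energy t := energy (sg t) + energy (t - D).

Lemma energy_ge0 x : 0 <= energy x.
Proof. by apply: Rint_ge0 => z; exact: sqr_ge0. Qed.

Lemma window_energyE t : window_energy t = energy (sg t) + energy (t - D).
Proof. by []. Qed.

Opaque energy.

Lemma loop_osc_le (t x y c g : R) : (t%:E < T)%E -> t0 <= t -> rb <= x -> x <= y -> y <= t ->
  y - x <= c -> energy y - energy x <= g -> `|U y - U x| <= Num.sqrt (c * g).
Proof.
move=> tlT tt rx xy yt xyc eg; rewrite -sqrtr_sqr ler_wsqrtr//.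
apply: (le_trans (loop_osc tlT tt rx xy yt)).
by apply: ler_pM; rewrite // subr_ge0// (energy_le tlT tt).
Qed.

(** By Cauchy-Schwarz both oscillations are at most [sqrt (2 * h * dm)], with [dm] the increment of
    [window_energy] over [[t, t + 2h]]; the 2 is the Lipschitz constant of [sg]. Squaring
    [curvature_bound] gives the form that [L2_of_second_diff] asks for. *)
Lemma loop_second_diff (eps rho t1 CS N t h : R) : 0 < eps <= D -> 0 <= CS ->
  trajectory f kappa D t0 rho eps t1 rb X U P sg ->
  curvature_bound CS t1 ->
  t0 <= t -> 0 < h -> h + h <= D -> t + h + h <= t1 -> (t1%:E < T)%E -> 0 <= N <= 1 ->
  bnd_on D rb X U t (t + h + h) N ->
  (U (t + h + h) - U (t + h) - (U (t + h) - U t)) ^+ 2 <=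
    2 * CS ^+ 2 * N ^+ 2 * h ^+ 4 +
    4 * CS ^+ 2 * h ^+ 3 * (window_energy (t + h + h) - window_energy t).
Proof.
move=> eD CS0 ob SD tt h0 hD tht t1T /andP[N0 N1] bd.
have rbt := reach_le t0; rewrite -/rb in rbt.
have tt1 : t0 <= t1 by lra.
set dm := window_energy (t + h + h) - window_energy t.
have eS x y : rb <= x -> x <= y -> y <= t1 -> energy x <= energy y by exact: energy_le.
have sgM x y : t0 <= x -> x <= y -> y <= t1 ->
    [/\ rb <= sg x, sg x <= sg y, sg y - sg x <= 2 * (y - x) & sg y <= t1].
  move=> tx xy yt; have /andP[s1 s2] := orb_sL ob tx xy yt.
  have hy : t0 <= y <= t1 by rewrite yt (le_trans tx).
  have hx : t0 <= x <= t1 by rewrite tx (le_trans xy).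
  have := orb_sD ob hy; rewrite ler_norml => /andP[_ s3].
  split; [exact: (orb_sb ob hx)|by rewrite -subr_ge0|exact: s2|lra].
have th1 : t <= t + h + h by lra.
have [sg1 sg2 sg3 sg4] := sgM t (t + h + h) tt th1 tht.
have e1 : energy (sg t) <= energy (sg (t + h + h)) by exact: eS.
have e2 : energy (t - D) <= energy (t + h + h - D) by apply: eS; move: rbt tt h0 tht eD; lin.
have hdm0 : 0 <= 2 * h * dm.
  apply: mulr_ge0; first by move: h0; lin.
  by rewrite /dm /window_energy; move: e2 e1; lin.
have wX s : t <= s <= t + h -> `|U (sg (s + h)) - U (sg s)| <= Num.sqrt (2 * h * dm).
  move=> /andP[ts sth].
  have ts0 : t0 <= s := le_trans tt ts.
  have ssh : s <= s + h by move: h0; lin.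
  have sht : s + h <= t + h + h by move: sth; lin.
  have tsh0 : t0 <= s + h by move: ts h0 tt; lin.
  have sh1 : s + h <= t1 := le_trans sht tht.
  have [a1 a2 a3 a4] := sgM s (s + h) ts0 ssh sh1; rewrite [s + h - s]addrC addKr in a3.
  have [b1 b2 b3 b4] := sgM t s tt ts (le_trans ssh sh1).
  have [c1 c2 c3 c4] := sgM (s + h) (t + h + h) tsh0 sht tht.
  have eb : energy (sg t) <= energy (sg s) by apply: eS => //; exact: le_trans a4.
  have ec : energy (sg (s + h)) <= energy (sg (t + h + h)) by apply: eS.
  apply: (loop_osc_le t1T tt1) => //.
  by rewrite /dm /window_energy; move: ec eb e2; lin.
have wU s : t - D <= s <= t - D + h -> `|U (s + h) - U s| <= Num.sqrt (2 * h * dm).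
  move=> /andP[ts sth].
  have [a1 a2 a3 a4] : [/\ rb <= t - D, rb <= s, s <= s + h & s + h <= t + h + h - D].
    by split; move: rbt tt ts h0 sth; lin.
  have a5 : t + h + h - D <= t1 by move: tht eD; lin.
  have eb : energy (t - D) <= energy s by apply: eS => //; move: sth tht h0 eD; lin.
  have ec : energy (s + h) <= energy (t + h + h - D) by apply: eS => //; move: ts rbt h0 tt; lin.
  apply: (loop_osc_le t1T tt1) => //; [exact: le_trans a5|move: h0; lin|].
  by rewrite /dm /window_energy; move: ec eb e1; lin.
have := SD t h N (Num.sqrt (2 * h * dm)) tt (ltW h0) hD tht N1 bd wX wU.
set w := Num.sqrt _ => H.
have w2 : w ^+ 2 = 2 * h * dm by rewrite sqr_sqrtr.
have : `|U (t + h + h) - U (t + h) - (U (t + h) - U t)| ^+ 2 <= (CS * h * (h * N + w)) ^+ 2.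
  rewrite lerXn2r// nnegrE mulr_ge0//; first by rewrite mulr_ge0// ltW.
  by rewrite addr_ge0 ?sqrtr_ge0// mulr_ge0// ltW.
rewrite real_normK ?num_real// => /le_trans; apply.
have -> : (CS * h * (h * N + w)) ^+ 2 = (CS * h) ^+ 2 * (h * N + w) ^+ 2 by ring.
have hw : (h * N + w) ^+ 2 <= 2 * (h * N) ^+ 2 + 2 * w ^+ 2.
  have : 0 <= (h * N - w) ^+ 2 by exact: sqr_ge0.
  by rewrite sqrrB sqrrD; lin.
apply: (le_trans (ler_wpM2l (sqr_ge0 _) hw)); rewrite w2.
by rewrite le_eqVlt; apply/orP; left; apply/eqP; ring.
Qed.

(** The end [b1 > b] leaves room for the forward steps of the difference quotients; [b - D <= a]
    keeps the interval inside the window on which the second derivative is known to be square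
    integrable. *)
Lemma loop_energy (eps rho t1 CS N a b b1 : R) : 0 < eps <= D -> 0 <= CS ->
  trajectory f kappa D t0 rho eps t1 rb X U P sg ->
  {within from_time t0, continuous delta} ->
  curvature_bound CS t1 ->
  t0 <= a -> b - D <= a -> a < b -> b < b1 -> b1 <= t1 -> (t1%:E < T)%E -> 0 <= N <= 1 ->
  bnd_on D rb X U a b1 N ->
  \int[mu]_(s in `[a, b]) ((U^`(2))%classic s ^+ 2) <=
    2 * CS ^+ 2 * N ^+ 2 * (b - a) +
    8 * CS ^+ 2 * (window_energy b1 - window_energy a).
Proof.
move=> eD CS0 ob dC SD ta ba ab bb1 b1t t1T /andP[N0 N1] bd.
have tt1 : t0 <= t1 by lra.
have T' t : t <= t1 -> (t%:E < T)%E by move=> ?; apply: le_lt_trans t1T; rewrite lee_fin.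
have rbt := reach_le t0; rewrite -/rb in rbt.
have Uc := loop_U_cont tt1 t1T.
have U2 := cl_U2 cl (le_trans ta (ltW ab)) (T' b (le_trans (ltW bb1) b1t)).
have [mW iW _] := U2.
have S : `]a, b[ `<=` (`]b - D, b[ : set R).
  by move=> s /=; rewrite !in_itv/= => /andP[as_ ->]; rewrite (le_lt_trans ba).
have sgt t : t0 <= t <= t1 -> rb <= sg t <= t.
  move=> ht; have := orb_sb ob ht; have := orb_sD ob ht; rewrite ler_norml; move: eD; lin.
have idc x y : {within `[x, y], continuous (fun t : R => t)}.
  by apply: continuous_subspaceT => z; exact: cvg_id.
have sgc : {within `[a, b1], continuous sg}.
  rewrite /sg; apply: withinB.
    by apply: withinB; [exact: idc|exact: within_cst].
  apply: (within_within (B := from_time t0) (F := fun t => (t, X t))) => //.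
    apply: within_pair; first exact: idc.
    by apply: within_itvS (loop_X_cont t1T).
  by move=> t /=; rewrite in_itv/= => /andP[h _]; exact: le_trans h.
have ec := energy_cont t1T tt1.
have mc : {within `[a, b1], continuous window_energy}.
  apply: withinD.
    apply: (within_within (B := `[rb, t1]%classic) sgc) => // t /=.
    by rewrite !in_itv/= => ht; have := sgt t; move: ht b1t ta; lin.
  apply: (within_within (B := `[rb, t1]%classic) (F := fun t => t - D)) => //.
    by apply: withinB; [exact: idc|exact: within_cst].
  by move=> t /=; rewrite !in_itv/= => ht; move: D0 ht rbt b1t ta; lin.
have mm x y : a <= x -> x <= y -> y <= b1 -> window_energy x <= window_energy y.
  move=> ax xy yb; have tx : t0 <= x by move: ax ta; lin.
  have yt : y <= t1 by move: yb b1t; lin.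
  have := orb_sL ob tx xy yt; have := sgt x; have := sgt y => h1 h2 h3.
  by apply: lerD; apply: (energy_le t1T tt1); move: D0 h2 yb xy ax b1t ta h3 h1 rbt; lin.
have h00 : 0 < D / 2 by rewrite divr_gt0.
have -> : 8 * CS ^+ 2 * (window_energy b1 - window_energy a) =
  2 * (4 * CS ^+ 2) * (window_energy b1 - window_energy a) by ring.
apply: (@L2_of_second_diff _ a b b1 _ _ (D / 2) U U1 _ window_energy) => //.
- by rewrite !mulr_ge0// sqr_ge0.
- by rewrite mulr_ge0// sqr_ge0.
- exact: measurable_funS mW.
- exact: integrableS iW.
- move=> x y ax xy yb; have [_ _ ftc] := H1_oo_acL2 U2 (le_lt_trans ba ax) yb.
  exact: ftc.
- by move=> x hx; apply: (@loop_C1 b); [move: ab ta; lin|apply: T'; move: b1t bb1; lin|move: hx ba; lin].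
- by apply: within_itvS Uc; move: D0 rbt ta b1t; lin.
move=> h t h0 hD at_ tb tb1.
have bdt : bnd_on D rb X U t (t + h + h) N.
  case: bd => bX bU; split=> x; first by move=> hx; apply: bX; move: hx tb1 at_; lin.
  by move=> rx hx; apply: bU => //; move: hx tb1 at_; lin.
by apply: (loop_second_diff eD CS0 ob SD _ _ _ _ t1T _ bdt); move: at_ ta h0 hD tb1 b1t N1 N0; lin.
Qed.

Lemma integrable_itv_closure (a b : R) (g : R -> \bar R) :
  mu.-integrable `]a, b[ g -> mu.-integrable `[a, b] g.
Proof.
move=> /integrableP[mg ig]; apply/integrableP; split; first exact: emeasurable_fun_itv_cc mg.
by rewrite integral_itv_bndoo//; exact: measurableT_comp.
Qed.

Lemma bnd_onS (s s' t t' N : R) : s <= s' -> t' <= t ->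
  bnd_on D rb X U s t N -> bnd_on D rb X U s' t' N.
Proof.
by move=> ss tt [bX bU]; split=> z *; [apply: bX|apply: bU]; lra.
Qed.

Lemma loop_Pi_le (t N W E1 : R) : t0 <= t -> (t%:E < T)%E ->
  `|X t| <= N -> (forall s, t - D <= s <= t -> `|U s| <= N) ->
  \int[mu]_(s in `[t - D, t]) ((U^`(2))%classic s ^+ 2) <= W ->
  \int[mu]_(s in `[delay_reach D delta X t, t]) (U1 s ^+ 2) <= E1 ->
  Pi D delta (fun x => x) X U t <= n%:R * N + D * N + W + E1.
Proof.
move=> tt tlT XN UN.
have rbt := reach_le t0; rewrite -/rb in rbt.
have Uc : {within `[t - D, t], continuous (fun s => `|U s|)}.
  by apply: within_norm; apply: within_itvS (loop_U_cont tt tlT); lra.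
have XI : enorm (X t) <= n%:R * N.
  by apply: (le_trans (enorm_le _)); rewrite ler_wpM2l.
have UI : \int[mu]_(s in `[t - D, t]) `|U s| <= D * N.
  have -> : D * N = \int[mu]_(s in `[t - D, t]) N.
    by rewrite Rintegral_cst_itv ?gerBl ?(ltW D0)// opprB addrC subrK mulrC.
  apply: le_Rintegral => //.
    by apply: continuous_compact_integrable => //; exact: segment_compact.
  exact: cst_integrable.
by move=> WI EI; rewrite /Pi -/U1; apply: lerD => //; apply: lerD => //; apply: lerD.
Qed.

(** * The functional during and after the initial window *)

Section Bounds.
Variables (eps rho t1 CS CL : R).
Hypotheses (eD : 0 < eps <= D) (CS0 : 0 <= CS) (CL0 : 0 <= CL).
Hypothesis ob : trajectory f kappa D t0 rho eps t1 rb X U P sg.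
Hypothesis dC : {within from_time t0, continuous delta}.
Hypothesis SD : curvature_bound CS t1.
Hypothesis t1T : (t1%:E < T)%E.
Hypothesis UL : slope_bound CL t1.

Ltac keep H ::=
  lazymatch constr:((D0, tT, fc, cl, eD, CS0, CL0, ob, dC, SD, t1T, UL)) with
  | context [H] => idtac
  end.

Let T' t : t <= t1 -> (t%:E < T)%E.
Proof. by move=> ?; apply: le_lt_trans t1T; rewrite lee_fin. Qed.

Lemma loop_energy_lip s N x y h : t0 <= s -> 0 <= N <= 1 -> bnd_on D rb X U s t1 N ->
  s <= x -> x <= y -> y <= t1 -> y - x <= h ->
  \int[mu]_(z in `[x, y]) (U1 z ^+ 2) <= CL ^+ 2 * N * h.
Proof.
move=> ts N01 bd sx xy yt xyh; have /andP[N0 N1] := N01.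
apply: le_trans (square_slope_le _ N01 _ xyh); last by rewrite subr_ge0.
apply: loop_lip_energy => //; [exact: le_trans sx|exact: T'|exact: mulr_ge0|].
move=> v w xv vw wy; apply: (UL ts bd) => //; [exact: le_trans xv|exact: le_trans yt].
Qed.

(** Three delays after [s] all inputs that matter are taken after [s], where the slope bound holds,
    so every energy is at most a multiple of [N]. The constant 48 is 8 from [loop_energy] times the
    total length [4 * D + 2 * D] of the two energy increments. *)
Lemma loop_late s t N : t0 <= s -> s + 3 * D <= t -> t < t1 -> t1 <= t + D ->
  t - 2 * D <= delay_reach D delta X t -> 0 <= N <= 1 -> bnd_on D rb X U s t1 N ->
  Pi D delta (fun x => x) X U t <=
    N * (n%:R + D + 2 * CS ^+ 2 * D + 48 * CS ^+ 2 * CL ^+ 2 * D + 2 * CL ^+ 2 * D).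
Proof.
move=> ts sDt tt1 t1D rt N01 bd.
have rbt := reach_le t0; rewrite -/rb in rbt.
have [tt t01 a1 a2] : [/\ t0 <= t, t0 <= t1, t0 <= t - D & t - D < t].
  by move: D0; split; move: t1D tt1 sDt ts; lin.
have tlT := T' (ltW tt1).
have EL x y h := loop_energy_lip (h := h) (x := x) (y := y) ts N01 bd.
have WE : window_energy t1 - window_energy (t - D) <=
    CL ^+ 2 * N * (4 * D) + CL ^+ 2 * N * (2 * D).
  have a3 : t - D <= t1 by lra.
  have /andP[s1 s2] := orb_sL ob a1 a3 (lexx _).
  have h1 : t0 <= t - D <= t1 by move: t1D tt1 sDt ts; lin.
  have h2 : t0 <= t1 <= t1 by move: t1D tt1 sDt ts; lin.
  have := orb_sD ob h1; rewrite ler_norml => /andP[s3 s4].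
  have := orb_sD ob h2; rewrite ler_norml => /andP[s5 s6].
  have s7 := orb_sb ob h1.
  have [s8 s9 s10 s11] : [/\ s <= sg (t - D), sg (t - D) <= sg t1, sg t1 <= t1 &
    sg t1 - sg (t - D) <= 4 * D] by split; move: eD D0 s3 sDt s1 s6 s2 t1D; lin.
  have [r1 r2 r3 r4] : [/\ s <= t - D - D, t - D - D <= t1 - D, t1 - D <= t1 &
    t1 - D - (t - D - D) <= 2 * D] by split; move: D0 sDt tt1 t1D; lin.
  have r5 : rb <= t - D - D by move: D0 rbt sDt ts; lin.
  rewrite !window_energyE opprD addrACA; apply: lerD.
    by rewrite (energyB t1T t01)//; exact: EL.
  by rewrite (energyB t1T t01)//; exact: EL.
have bd' : bnd_on D rb X U (t - D) t1 N by apply: bnd_onS bd => //; move: D0 sDt; lin.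
have [q1 q2 q3] : [/\ s <= delay_reach D delta X t, delay_reach D delta X t <= t &
    t - delay_reach D delta X t <= 2 * D].
  by have := reach_le t; move: D0; split; move: rt t1D tt1 sDt H; lin.
have XN : `|X t| <= N by have [bX _] := bd; apply: bX; move: D0 tt1 sDt; lin.
have UN z : t - D <= z <= t -> `|U z| <= N.
  by have [_ bU] := bd => hz; apply: bU; move: D0 hz rbt sDt ts tt1; lin.
have WI := loop_energy eD CS0 ob dC SD a1 (lexx _) a2 tt1 (lexx _) t1T N01 bd'.
have tD0 : 0 <= t - (t - D) by rewrite subr_ge0 ltW.
have tDD : t - (t - D) <= D by rewrite opprB addrC subrK.
have {}WI := le_trans WI (curvature_le CS N01 tD0 tDD WE).
have E1 := EL _ _ _ q1 q2 (ltW tt1) q3.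
apply: (le_trans (loop_Pi_le tt tlT XN UN WI E1)).
by rewrite le_eqVlt; apply/orP; left; apply/eqP; ring.
Qed.

(** Windows may reach into the history, where no slope bound holds. There the energies are taken
    from the initial value of the functional through [p], and only the part after [t0] is estimated
    by the slope. *)
Lemma loop_early t N p H : t0 <= t -> t < t1 -> t1 <= t + D -> t1 <= t0 + H ->
  energy t0 <= p -> \int[mu]_(s in `[t0 - D, t0]) ((U^`(2))%classic s ^+ 2) <= p ->
  p <= N -> 0 <= N <= 1 -> bnd_on D rb X U t0 t1 N -> t0 - 2 * D <= rb ->
  Pi D delta (fun x => x) X U t <=
    N * (n%:R + D + 2 + 2 * CS ^+ 2 * D + 16 * CS ^+ 2 + 16 * CS ^+ 2 * CL ^+ 2 * H + CL ^+ 2 * H).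
Proof.
move=> tt tt1 t1D t1H ep up pN N01 bd rb2.
have rbt := reach_le t0; rewrite -/rb in rbt.
have tlT := T' (ltW tt1).
have [t01 rt0 H0] : [/\ t0 <= t1, rb <= t0 & t1 - t0 <= H].
  by clear up; move: D0; split; move: tt1 tt rbt t1D t1H; lin.
have EL := loop_energy_lip (lexx _) N01 bd (lexx _) t01 (lexx _) H0.
pose B := N + CL ^+ 2 * N * H.
have Ex x : rb <= x -> x <= t1 -> energy x <= B.
  move=> rx xt; apply: (le_trans (energy_le t1T t01 rx xt (lexx _))).
  rewrite -(subrK (energy t0) (energy t1)) addrC; apply: lerD; first exact: le_trans pN.
  by rewrite (energyB t1T t01 rt0 t01 (lexx _)).
have htt : t0 <= t <= t1 by rewrite tt ltW.
have rr : rb <= delay_reach D delta X t.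
  rewrite /delay_reach lerBrDl -lerBrDr ge_max; apply/andP; split.
    by clear up EL; lra.
  by have := orb_sb ob htt; rewrite /sg; clear up EL; lra.
have rtt : rb <= t by apply: (le_trans rt0).
have E1 : \int[mu]_(z in `[delay_reach D delta X t, t]) (U1 z ^+ 2) <= B.
  apply: le_trans (Ex t rtt (ltW tt1)).
  apply: Rint_subset => //; [|exact: ac_i (loop_acL2 tt tlT)|by move=> z; exact: sqr_ge0].
  by apply: (le_trans (reach_le t)); rewrite gerBl ltW.
pose A := 2 * CS ^+ 2 * D * N + 8 * CS ^+ 2 * (B + B).
have N0 : 0 <= N by case/andP: N01.
have B0 : 0 <= B.
  rewrite /B addr_ge0// mulr_ge0//; first by rewrite mulr_ge0// sqr_ge0.
  by apply: le_trans H0; rewrite subr_ge0.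
have WE a : t0 <= a -> t - D <= a -> a < t ->
    \int[mu]_(s in `[a, t]) ((U^`(2))%classic s ^+ 2) <= A.
  clear EL E1 up; move=> ta tDa at_.
  have bd' : bnd_on D rb X U a t1 N by exact: bnd_onS bd.
  apply: (le_trans (loop_energy eD CS0 ob dC SD ta tDa at_ tt1 (lexx _) t1T N01 bd')).
  have h2 : t0 <= t1 <= t1 by rewrite t01 lexx.
  have s7 := orb_sb ob h2.
  have s8 : sg t1 <= t1 by have := orb_sD ob h2; rewrite ler_norml; move: eD; lin.
  have [r1 r2] : rb <= t1 - D /\ t1 - D <= t1 by move: D0; split; move: rbt tt1 tt t1D; lin.
  have g1 := Ex (sg t1) s7 s8; have g2 := Ex (t1 - D) r1 r2.
  apply: curvature_le => //; [by rewrite subr_ge0 ltW|by move: tDa; lin|].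
  by rewrite !window_energyE lerBlDr ler_wpDr ?addr_ge0 ?energy_ge0// lerD.
have A0 : 0 <= A.
  have D00 := ltW D0; have C2 := sqr_ge0 CS.
  apply: addr_ge0; (apply: mulr_ge0; last by rewrite // addr_ge0).
    by apply: mulr_ge0 => //; exact: mulr_ge0.
  exact: mulr_ge0.
(* If the window contains [t0] in its interior, it is split there: the first part belongs to the
   history, the second is covered by [WE]. *)
have W1 : \int[mu]_(s in `[t - D, t]) ((U^`(2))%classic s ^+ 2) <= N + A.
  have [tE|tlt] : t = t0 \/ t0 < t.
    by move: tt; rewrite le_eqVlt => /predU1P[->|]; [left|right].
    by rewrite tE ler_wpDr//; apply: le_trans pN.
  have [tD|tD] := leP t0 (t - D).
    by rewrite ler_wpDl//; apply: WE => //; rewrite gtrBl.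
  have [_ iW _] := cl_U2 cl tt tlT; have [_ iW0 _] := cl_U2 cl (lexx _) tT.
  rewrite (@Rint_split _ (t - D) t0 t) ?(ltW tD) ?(ltW tlt)//; last exact: integrable_itv_closure iW.
  apply: lerD; last by apply: WE => //; exact: ltW.
  apply: le_trans pN; apply: le_trans up; apply: Rint_subset => //.
  - by rewrite lerD2r.
  - exact: ltW.
  - exact: integrable_itv_closure iW0.
  - by move=> z; exact: sqr_ge0.
have XN : `|X t| <= N by have [bX _] := bd; apply: bX.
have UN z : t - D <= z <= t -> `|U z| <= N.
  by have [_ bU] := bd => hz; apply: bU; clear EL up E1 W1; move: D0 hz rbt tt tt1; lin.
apply: (le_trans (loop_Pi_le tt tlT XN UN W1 E1)).
by rewrite /A /B le_eqVlt; apply/orP; left; apply/eqP; ring.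
Qed.

End Bounds.

Ltac keep H ::=
  lazymatch constr:((D0, tT, fc, cl)) with
  | context [H] => idtac
  end.

(** Bounding the second derivative up to [t] uses the solution a little beyond [t]. *)
Lemma later_time t : (t%:E < T)%E -> exists t1, [/\ t < t1, t1 <= t + D & (t1%:E < T)%E].
Proof.
case: T => [T0| |//]; last by exists (t + D); rewrite ltrDl lexx ltry.
rewrite lte_fin => tT0; exists (Num.min (t + D) ((t + T0) / 2)).
have h1 : t < (t + T0) / 2 by lra.
have h2 : (t + T0) / 2 < T0 by lra.
by rewrite ge_min lexx lt_min ltrDl D0 h1 lte_fin gt_min h2 orbT.
Qed.

Lemma loop_decay (eps rho Q C1 CS CL a p t : R) :
  0 < eps <= D -> rho <= 1 -> 8 * D <= Q -> 1 <= C1 -> 0 <= CS -> 0 <= CL ->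
  {within from_time t0, continuous delta} ->
  (forall t, t0 <= t -> `|X t| <= 1 -> t - 2 * D <= delay_reach D delta X t) ->
  (forall t1, t0 <= t1 -> (t1%:E < T)%E -> trajectory f kappa D t0 rho eps t1 rb X U P sg /\
     [/\ growth_bound C1 Q t1, halving_bound Q t1, curvature_bound CS t1 & slope_bound CL t1]) ->
  0 <= a -> C1 * a <= rho -> p <= a -> energy t0 <= p ->
  \int[mu]_(s in `[t0 - D, t0]) ((U^`(2))%classic s ^+ 2) <= p ->
  bnd_on D rb X U t0 t0 a -> t0 - 2 * D <= rb -> t0 <= t -> (t%:E < T)%E ->
  exists2 k : nat, t - t0 <= k.+2%:R * Q &
    Pi D delta (fun x => x) X U t <= C1 * (a * 2^-1 ^+ k) *
      ((n%:R + D + 2 + 2 * CS ^+ 2 * D + 16 * CS ^+ 2 + 16 * CS ^+ 2 * CL ^+ 2 * (3 * Q)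
        + CL ^+ 2 * (3 * Q))
       + (n%:R + D + 2 * CS ^+ 2 * D + 48 * CS ^+ 2 * CL ^+ 2 * D + 2 * CL ^+ 2 * D)).
Proof.
move=> eD rho1 QD C11 CS0 CL0 dc rB OB a0 C1a pa ep up bd0 rb2 tt tlT.
set Se := _ + CL ^+ 2 * (3 * Q); set Sl := _ + 2 * CL ^+ 2 * D.
have D00 := ltW D0; have C10 : 0 <= C1 by exact: le_trans C11.
have Q0 : 0 <= Q by apply: le_trans QD; rewrite mulr_ge0.
have [x1 x2] := (sqr_ge0 CS, sqr_ge0 CL).
have Se0 : 0 <= Se by rewrite /Se !(addr_ge0, mulr_ge0).
have Sl0 : 0 <= Sl by rewrite /Sl !(addr_ge0, mulr_ge0).
have [t1 [tt1 t1D t1T]] := later_time tlT.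
have t01 : t0 <= t1 := le_trans tt (ltW tt1).
have [orb1 [G H SD UL]] := OB t1 t01 t1T.
have Qp : 0 < Q by apply: lt_le_trans QD; rewrite mulr_gt0.
(* In the first period the early bound is used. In period [k + 1] the late one is used from the grid
   point [k], one period back, so that [3 * D] have passed; this costs one halving and explains
   [k.+2] in the statement. *)
have [[|k] [k1 k2]] := grid Qp tt.
  have t1Q : t1 <= t0 + 3 * Q by clear up ep; move: k2; rewrite mul0r; move: t1D QD eD; lin.
  exists 0%N; first by clear up ep; move: k2; rewrite mul0r; move: QD eD; lin.
  rewrite expr0 mulr1.
  have bd1 : bnd_on D rb X U t0 t1 (C1 * a) by exact: G.
  have N01 : 0 <= C1 * a <= 1 by rewrite mulr_ge0//=; exact: le_trans rho1.
  have pN : p <= C1 * a by apply: (le_trans pa); rewrite ler_peMl.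
  apply: (le_trans (loop_early eD CS0 CL0 orb1 dc SD t1T UL tt tt1 t1D t1Q ep up pN N01 bd1 rb2)).
  by apply: ler_wpM2l; [case/andP: N01|rewrite -/Se lerDl].
clear up ep.
exists k; first by move: k2; rewrite -!natr1 !mulrDl; lin.
pose s := t0 + k%:R * Q.
have kQ0 : 0 <= k%:R * Q by rewrite mulr_ge0 ?ler0n.
have [ts st sQ] : [/\ t0 <= s, s + Q <= t & t < s + Q + Q].
  by rewrite -natr1 mulrDl mul1r in k1 k2; rewrite /s; split; move: kQ0 k1 k2; lin.
have [st1 s3 st1Q] : [/\ s <= t1, s + 3 * D <= t & t1 <= s + 3 * Q].
  by split; move: st tt1 QD D00 t1D sQ; lin.
have bs := loop_halving a0 Qp H bd0 st1.
rewrite -/s in bs.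
set h := a * 2^-1 ^+ k in bs *.
have h0 : 0 <= h by rewrite mulr_ge0// exprn_ge0.
have ha : h <= a by rewrite ler_piMr// exprn_ile1// invf_le1// ler1n.
have bd1 : bnd_on D rb X U s t1 (C1 * h) by exact: G.
have Ch : C1 * h <= C1 * a by exact: ler_wpM2l.
have N01 : 0 <= C1 * h <= 1.
  by rewrite mulr_ge0//= (le_trans Ch)// (le_trans C1a).
have ht : t0 <= t <= t1 by rewrite tt ltW.
have rt := rB t tt (le_trans (orb_Xr orb1 ht) rho1).
apply: (le_trans (loop_late eD CS0 CL0 orb1 dc SD t1T UL ts s3 tt1 t1D rt N01 bd1)).
by apply: ler_wpM2l; [case/andP: N01|rewrite -/Sl lerDr].
Qed.

End ClosedLoop.

(** * Comparison functions and the theorem *)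

Section Comparison.
Variable R : realType.

Lemma classKinf_scale (c : R) : 0 < c -> classKinf (fun x => c * x).
Proof.
move=> c0; split; last by apply: gt0_cvgMry => //; exact: cvg_id.
split; first by rewrite mulr0.
- apply: continuous_subspaceT => x; exact: mulrl_continuous.
- by move=> x y _ xy; rewrite ltr_pM2l.
Qed.

Lemma classKinf_id : classKinf (fun x : R => x).
Proof. by have := classKinf_scale ltr01; under eq_fun do rewrite mul1r. Qed.

Lemma classKCinf_fst : classKCinf (fun r _ : R => r).
Proof.
split; last by move=> c _; exact: classKinf_id.
split; first by move=> c _; case: classKinf_id.
by move=> r _; exact: within_cst.
Qed.

Lemma classKL_sqrt_expR (M l : R) : 0 < M -> 0 < l ->
  classKL (fun r s => M * Num.sqrt r * expR (- (l * s))).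
Proof.
move=> M0 l0; split.
- apply: continuous_subspaceT => p; apply: cvgM.
    apply: cvgM; first exact: cvg_cst.
    by apply: (continuous_comp (f := fst)); [exact: cvg_fst|exact: sqrt_continuous].
  apply: (continuous_comp (f := fun p : R * R => - (l * p.2))); last exact: continuous_expR.
  by apply: cvgN; apply: cvgM; [exact: cvg_cst|exact: cvg_snd].
- move=> s s0; split; first by rewrite sqrtr0 mulr0 mul0r.
    apply: continuous_subspaceT => r; apply: cvgM; last exact: cvg_cst.
    by apply: cvgM; [exact: cvg_cst|exact: sqrt_continuous].
  move=> x y x0 xy; rewrite ltr_pM2r ?expR_gt0// ltr_pM2l// ltr_sqrt//.
  exact: le_lt_trans xy.
- move=> r s s' r0 s0 ss; rewrite ler_wpM2l ?mulr_ge0 ?sqrtr_ge0 ?(ltW M0)//.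
  by rewrite ler_expR lerN2 ler_pM2l.
- move=> r r0; rewrite -[X in _ --> X](mulr0 (M * Num.sqrt r)).
  apply: cvgM; first exact: cvg_cst.
  apply: (@cvg_comp _ _ _ (fun s => l * s) (fun x => expR (- x)) _ +oo); last exact: cvgr_expR.
  by apply: gt0_cvgMry => //; exact: cvg_id.
Qed.

(** The factor 4 makes up for the two halvings by which [k] lags behind [k.+2]. *)
Lemma half_pow_le (Q d : R) k : 0 < Q -> d <= k.+2%:R * Q ->
  2^-1 ^+ k <= 4 * expR (- (ln 2 / Q * d)).
Proof.
move=> Q0 dk; have ln0 : 0 < ln (2 : R) by rewrite ln_gt0// ltr1n.
have -> : 2^-1 ^+ k = 4 * expR (- (k.+2%:R * ln 2)) :> R.
  rewrite expRN expRM_natl lnK ?posrE// -exprVn !exprS; by field.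
rewrite ler_pM2l// ler_expR lerN2 mulrAC ler_pdivrMr// mulrC [k.+2%:R * _]mulrC -mulrA.
by rewrite [d * _]mulrC ler_pM2l.
Qed.

Lemma small_radius (A B C r s : R) : 0 <= A -> 0 <= B -> 0 <= C -> 0 < r -> 0 < s ->
  exists rho : R, [/\ 0 < rho, A * rho < r, B * rho <= s, C * rho <= r & 2 * rho <= r].
Proof.
move=> A0 B0 C0 r0 s0; have M0 : 0 < A + B + C + 2 by rewrite ltr_wpDl// !addr_ge0.
pose m := Num.min r s; have m0 : 0 < m by rewrite lt_min r0.
have mr : m <= r by rewrite ge_min lexx.
have ms : m <= s by rewrite ge_min lexx orbT.
pose rho := m / (A + B + C + 2).
have rho0 : 0 < rho by rewrite divr_gt0.
have rM : rho * (A + B + C + 2) = m by rewrite /rho mulfVK// gt_eqF.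
have [a b c] : [/\ 0 <= A * rho, 0 <= B * rho & 0 <= C * rho].
  by split; rewrite mulr_ge0// ltW.
by exists rho; split=> //; lra.
Qed.

End Comparison.

Theorem theorem1 (R : realType) (n : nat) (f : 'cV[R]_n * R -> 'cV[R]_n)
    (Dhat t0 : R) (kappa : R * 'cV[R]_n -> R) (rstar : R) :
  Ck setT 2 f -> f (0, 0) = 0 -> 0 < Dhat ->
  strong_forward_complete f ->
  feedback_assumption f t0 kappa rstar ->
  exists (c1 cstar : R) (muhat astar : R -> R) (zeta beta : R -> R -> R) (c : R),
    [/\ 0 < c1 /\ 0 < cstar,
        classKinf muhat /\ classKinf astar,
        classKCinf zeta /\ classKL beta,
        0 < c < 1 &
        forall delta : R * 'cV[R]_n -> R,
          Ck (from_time t0) 1 delta ->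
          perturbation_bound t0 delta c1 muhat ->
          forall (T : \bar R) (X : R -> 'cV[R]_n) (U : R -> R)
                 (P : R -> R -> 'cV[R]_n) (u : R -> R -> R),
            (t0%:E < T)%E ->
            closed_loop f Dhat t0 kappa delta T X U P u ->
            Pi Dhat delta astar X U t0 < cstar ->
            forall t, t0 <= t -> (t%:E < T)%E ->
              Pi Dhat delta astar X U t
                <= beta (zeta (Pi Dhat delta astar X U t0)
                              (Num.min (Num.min rstar c) Dhat))
                        (t - t0)].
Proof.
move=> fC f00 D0 _ [rs0 kC [mu [b [lam [ahat [[mu0 b0 lam0] ahK kb0 kb1 NOM]]]]]].
have [r [L [r01 L0 fL fL2]]] := f_local fC.
have [K K0 kT] := kappa_tame mu0 ahK kC kb0 kb1.
have /andP[r0 r1] := r01.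
have D00 := ltW D0; have n0 : 0 <= n%:R :> R by exact: ler0n.
(* The conditions keep, in order, predictors within [r / 3], initial states of the delay-free system
   within [rstar], its solutions and their feedback within [r], and the inputs slightly before [rb]
   within [r]. *)
have [rho [rho0 rhor nr bnr rr]] : exists rho : R,
  [/\ 0 < rho, 3 * (gain Dhat L * (1 + L * Dhat) * rho) < r, n%:R * rho <= rstar,
      (1 + K) * (b * (n%:R * rho)) <= r & 2 * rho <= r].
  have G0 : 0 <= 3 * (gain Dhat L * (1 + L * Dhat)).
    by rewrite !mulr_ge0// ?gainE ?mulr_ge0 ?expR_ge0// addr_ge0// mulr_ge0// ltW.
  have C0 : 0 <= (1 + K) * (b * n%:R).
    by rewrite mulr_ge0 ?mulr_ge0 ?(ltW b0)// addr_ge0// ltW.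
  have [rho [h1 h2 h3 h4 h5]] := small_radius G0 n0 C0 r0 rs0.
  by exists rho; split; rewrite ?mulrA// in h2 h4 *; rewrite ?mulrA.
have rho1 : rho <= 1 by lra.
have [Q [eps0 [QD /andP[eps00 eps0D] dec]]] :=
  decay D0 r01 L0 K0 f00 fL kT rho0 rhor NOM b0 lam0 nr bnr.
have Q0 : 0 < Q by lra.
have [C1 C11 gro] := growth D0 r01 L0 K0 f00 fL kT rho0 rhor (ltac:(lra) : 0 <= 3 * Q).
have [CS CS0 SD] := second_diff_bound D0 r01 L0 K0 f00 fL fL2 kT rho0 rhor.
have [CL CL0 UL] := U_lip_bound D0 r01 L0 K0 f00 fL kT rho0 rhor.
have LR : 0 <= n%:R * (3 * L * rho) by rewrite !mulr_ge0// ltW.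
(* Small enough for [decay] and, by the second term, for [delta] to be 1-Lipschitz along the
   state. *)
pose eps := Num.min eps0 (1 + n%:R * (3 * L * rho))^-1.
have eps1 : 0 < 1 + n%:R * (3 * L * rho) by lra.
have eps_gt0 : 0 < eps by rewrite lt_min eps00 invr_gt0.
have epsle : eps <= eps0 by rewrite ge_min lexx.
have epsD : eps <= Dhat by exact: le_trans eps0D.
have eD : 0 < eps <= Dhat by rewrite eps_gt0.
have epsL : eps * (1 + n%:R * (3 * L * rho)) <= 1.
  by rewrite -ler_pdivlMr// mul1r ge_min lexx orbT.
have n1 : 0 < 1 + n%:R :> R by lra.
(* On the unit ball of the sup norm the Euclidean norm is at most [n], so [c1 + c1 * enorm xi] is at
   most [eps] there. *)
pose c1 := eps / (1 + n%:R); have c10 : 0 < c1 by rewrite divr_gt0.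
(* The bracket is the constant of [loop_history] for the input; the 1 makes [Ca * sqrt p] dominate
   also [p] and the initial state. *)
pose Ca := 1 + (Dhat^-1 + Num.sqrt (2 * Dhat)).
have DV0 : 0 < Dhat^-1 by rewrite invr_gt0.
have S0 : 0 <= Num.sqrt (2 * Dhat) by exact: sqrtr_ge0.
have Ca1 : 1 <= Ca by rewrite /Ca; lra.
have Ca0 : 0 < Ca by lra.
have C10 : 0 < C1 by lra.
(* If [sqrt p <= q], then [C1 * (Ca * sqrt p)] is at most [rho / 2], strictly below [rho] as
   [loop_bounded] demands. *)
pose q := rho / (2 * C1 * Ca).
have q0 : 0 < q by rewrite divr_gt0// !mulr_gt0.
pose Se := n%:R + Dhat + 2 + 2 * CS ^+ 2 * Dhat + 16 * CS ^+ 2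
  + 16 * CS ^+ 2 * CL ^+ 2 * (3 * Q) + CL ^+ 2 * (3 * Q).
pose Sl := n%:R + Dhat + 2 * CS ^+ 2 * Dhat + 48 * CS ^+ 2 * CL ^+ 2 * Dhat + 2 * CL ^+ 2 * Dhat.
have [Se0 Sl0] : 0 < Se /\ 0 < Sl.
  have [x1 x2] := (sqr_ge0 CS, sqr_ge0 CL).
  have x3 : 0 <= CS ^+ 2 * CL ^+ 2 by exact: mulr_ge0.
  have x4 := mulr_ge0 x1 D00; have x5 := mulr_ge0 x2 D00; have x6 := mulr_ge0 x3 D00.
  have x7 := mulr_ge0 x2 (ltW Q0); have x8 := mulr_ge0 x3 (ltW Q0).
  by rewrite /Se /Sl; split; lra.
(* The 4 comes from [half_pow_le]; [Se] and [Sl] are the constants of the early and the late bound,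
   added to serve in both cases. *)
pose M := 4 * ((Se + Sl) * C1 * Ca).
have M0 : 0 < M by rewrite /M !mulr_gt0// addr_gt0.
pose l := ln 2 / Q.
have l0 : 0 < l by rewrite divr_gt0// ln_gt0// ltr1n.
exists c1, (Num.min 1 (q ^+ 2)), (fun x => c1 * x), (fun x => x), (fun r _ => r),
  (fun r s => M * Num.sqrt r * expR (- (l * s))), (1 / 2).
split.
- by split=> //; rewrite lt_min ltr01 exprn_gt0.
- by split; [exact: classKinf_scale|exact: classKinf_id].
- by split; [exact: classKCinf_fst|exact: classKL_sqrt_expR].
- by apply/andP; split; lra.
move=> delta dC dB T X U P u tT cl; have [p pE] : exists p, p = Pi Dhat delta (fun x => x) X U t0 by eexists.
rewrite -pE => pc t tt tlT.
have fc : continuous f by case: fC => /within_setT.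
have dB' s xi : t0 <= s -> `|xi| <= 1 ->
    `|delta (s, xi)| + `|derive_within (from_time t0) (dir_t R n) delta (s, xi)|
      + dnorm t0 0 1 delta (s, xi) <= eps.
  move=> ts xi1; apply: (le_trans (dB s xi ts)).
  have -> : eps = c1 + c1 * n%:R by rewrite /c1; field; rewrite gt_eqF.
  rewrite lerD2l ler_pM2l//; apply: (le_trans (enorm_le xi)).
  by rewrite ler_piMr.
have [p1 pq] : p <= 1 /\ p <= q ^+ 2.
  by move: pc; rewrite lt_min => /andP[/ltW ? /ltW ?].
have X0p : enorm (X t0) <= p by rewrite pE; exact: state_le_Pi.
have X01 : `|X t0| <= 1 by apply: (le_trans (norm_le_enorm _)); exact: le_trans p1.
set rb := delay_reach Dhat delta X t0.
have rB s : t0 <= s -> `|X s| <= 1 -> s - 2 * Dhat <= delay_reach Dhat delta X s.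
  by move=> ts Xs; apply: le_trans (reach_ge Dhat dB' ts Xs); clear -epsD; lra.
have rb2 : t0 - 2 * Dhat <= rb by exact: rB.
have [p0 _ UH _ _] := loop_history D0 tT cl pE p1 rb2.
have sqp : p <= Num.sqrt p.
  rewrite -{1}(sqr_sqrtr p0) expr2 ler_piMl ?sqrtr_ge0//.
  by rewrite -[leRHS]sqrtr1 ler_sqrt.
have sp0 : 0 <= Num.sqrt p by exact: sqrtr_ge0.
pose a := Ca * Num.sqrt p.
have a0 : 0 <= a by rewrite mulr_ge0// ltW.
have pa : p <= a by apply: (le_trans sqp); rewrite ler_peMl.
have C1a : C1 * a < rho.
  have : Num.sqrt p <= q.
    by rewrite -(ger0_norm (ltW q0)) -sqrtr_sqr ler_wsqrtr.
  rewrite ler_pdivlMr ?mulr_gt0//.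
  have -> : Num.sqrt p * (2 * C1 * Ca) = 2 * (C1 * a) by rewrite /a; ring.
  by move=> qa; clear -qa rho0; lra.
have bd0 : bnd_on Dhat rb X U t0 t0 a.
  split=> [x hx|x rx hx].
    have -> : x = t0 by apply/eqP; rewrite eq_le andbC.
    by apply: (le_trans (norm_le_enorm _)); apply: (le_trans X0p).
  have hx' : rb <= x <= t0 by rewrite rx; case/andP: hx.
  by apply: (le_trans (UH x hx')); rewrite /a ler_wpM2r// /Ca lerDr.
pose O t1 := trajectory f kappa Dhat t0 rho eps t1 rb X U P (fun s => s - Dhat - delta (s, X s)).
have gro' t1 : O t1 -> growth_bound Dhat t0 delta X U C1 Q t1.
  by move=> o s' t' a'; exact: (gro _ _ _ _ _ _ _ eD o).
have dec' t1 : O t1 -> halving_bound Dhat t0 delta X U Q t1.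
  by move=> o s' a'; exact: (dec _ _ _ _ _ _ _ eps_gt0 epsle o).
have SD' t1 : O t1 -> curvature_bound Dhat t0 delta X U CS t1.
  by move=> o t' h N w; exact: (SD _ _ _ _ _ _ _ eD o).
have UL' t1 : O t1 -> slope_bound Dhat t0 delta X U CL t1.
  by move=> o s' N ts bd; exact: (UL _ _ _ _ _ _ _ eD o s' t1 N ts (lexx _) bd).
have ob := loop_bounded D0 tT fc cl eps_gt0 fL L0 rho0 rr rho1 f00 epsD epsL dC dB'
  gro' dec' Q0 C11 a0 C1a rb2 bd0.
have dc : {within from_time t0, continuous delta} by case: dC.
have OB t1 : t0 <= t1 -> (t1%:E < T)%E -> O t1 /\
    [/\ growth_bound Dhat t0 delta X U C1 Q t1, halving_bound Dhat t0 delta X U Q t1,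
        curvature_bound Dhat t0 delta X U CS t1 & slope_bound Dhat t0 delta X U CL t1].
  move=> tt1 t1T; have o := ob t1 tt1 t1T; split=> //.
  by split; [exact: gro'|exact: dec'|exact: SD'|exact: UL'].
have [p0' _ _ EH WH] := loop_history D0 tT cl pE p1 rb2.
have [k dk Pk] := loop_decay D0 tT cl eD rho1 QD C11 (ltW CS0) (ltW CL0) dc rB OB a0
  (ltW C1a) pa EH WH bd0 rb2 tt tlT.
rewrite -/Se -/Sl in Pk; apply: (le_trans Pk).
have := half_pow_le Q0 dk; rewrite -/l => hk.
have -> : C1 * (a * 2^-1 ^+ k) * (Se + Sl) = C1 * a * (Se + Sl) * 2^-1 ^+ k by ring.
have A0 : 0 <= C1 * a * (Se + Sl).
  exact: (mulr_ge0 (mulr_ge0 (ltW C10) a0) (addr_ge0 (ltW Se0) (ltW Sl0))).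
apply: (le_trans (ler_wpM2l A0 hk)).
by rewrite /M /a le_eqVlt; apply/orP; left; apply/eqP; ring.
Qed.
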